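(* Let $G$ be $GL_n(\mathbb{C})$ or $SL_n(\mathbb{C})$ with Lie algebra $\mathfrak{g}$, and let $M\in\mathfrak{g}$ be a linear operator, with Jordan decomposition $M=s+(M-s)$, $s$ semisimple and $M-s$ nilpotent. Then there exists a Bruhat decomposition, i.e. a choice of Cartan subalgebra $\mathfrak{h}$ and Borel subgroup $B$ with Lie algebra $\mathfrak{b}\supseteq\mathfrak{h}$ (with $M\in\mathfrak{b}$ and $s\in\mathfrak{h}$), whose intersection with each Hessenberg variety $\mathcal{H}(M,H)$ (for every Hessenberg space $H\supseteq\mathfrak{b}$) is a paving by affines of $\mathcal{H}(M,H)$. Its nonempty cells are those $B\pi B\cap\mathcal{H}(M,H)$ such that $\pi^{-1}\cdot M\in H$, and they have dimension $$|\Phi_\pi|-|\Phi_{U_{\pi,M}\cdot(M-s)}\cap\mathcal{C}_{\pi\cdot H}|-|\Phi_\pi\cap\Phi_{\mathfrak{n}_M}\cap\mathcal{C}_{\pi\cdot H}|.$$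
   Context: Write $\mathfrak{g}=\mathfrak{h}\oplus\bigoplus_{\alpha\in\Phi}\mathfrak{g}_\alpha$, $\Phi^+$ for the roots occurring in $\mathfrak{b}$, $\Phi^-=-\Phi^+$, $\Delta$ for the simple roots, $W$ for the Weyl group, $U$ for the unipotent radical of $B$, $U^-$ for the opposite unipotent group, and $g\cdot X=\mathrm{Ad}\,g(X)$. A Hessenberg space is a subspace $H$ with $\mathfrak{b}\subseteq H\subseteq\mathfrak{g}$ and $[\mathfrak{b},H]\subseteq H$. Put $\mathcal{M}_H=\{\alpha\in\Phi:\mathfrak{g}_\alpha\subseteq H\}$. The Hessenberg variety is $\mathcal{H}(M,H)=\{gB\in G/B: g^{-1}\cdot M\in H\}$. $B\pi B$ also denotes the Schubert cell in $G/B$. A paving of a variety $X$ is an ordered partition $(\mathcal{P}_1,\mathcal{P}_2,\ldots)$ of $X$ into disjoint subvarieties such that each finite union $\bigcup_{j\le i}\mathcal{P}_j$ is closed in $X$; it is a paving by affines if each $\mathcal{P}_i$ is isomorphic to an affine space. Here the parts are the nonempty sets $B\pi B\cap\mathcal{H}(M,H)$, $\pi\in W$, in a suitable order. Notation: $\Phi_\pi=\Phi^+\cap\pi\Phi^-$; $U_\pi=\{u\in U:\pi^{-1}u\pi\in U^-\}$; $\mathcal{C}_{\pi\cdot H}=\Phi^+\setminus\pi\mathcal{M}_H$. Let $\mathfrak{p}_M\supseteq\mathfrak{b}$ be the standard parabolic subalgebra associated to the set of simple roots $\{\alpha\in\Delta:\alpha(s)=0\}$, with nilradical $\mathfrak{n}_M$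 and Levi subalgebra $\mathfrak{l}_M\supseteq\mathfrak{h}$; let $L_M$ be the Levi subgroup with Lie algebra $\mathfrak{l}_M$, and $U_{\pi,M}=U_\pi\cap L_M$. For $X\in\mathfrak{g}$, $\Phi_X$ is the set of roots $\alpha$ for which $X$ has nonzero component in $\mathfrak{g}_\alpha$; for a subset $\mathfrak{u}\subseteq\mathfrak{g}$, $\Phi_{\mathfrak{u}}=\bigcup_{X\in\mathfrak{u}}\Phi_X$; and $U_{\pi,M}\cdot X=\{u\cdot X:u\in U_{\pi,M}\}$. *)

(* Defs.v *)
From mathcomp Require Import all_boot all_order all_algebra finmap.
From mathcomp Require Import boolp classical_sets functions cardinality fsbigop.
From mathcomp Require Import mpoly.

Set Implicit Arguments.
Unset Strict Implicit.
Unset Printing Implicit Defensive.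

Import GRing.Theory.

Local Open Scope classical_set_scope.
Local Open Scope ring_scope.

(** A variety over [k] is handled as a set with a Zariski topology and a sheaf
    of [k]-valued functions.  [zregular U f] says that [f] is regular on the open
    set [U]; the values of [f] outside [U] are irrelevant. *)
Record kspace (k : fieldType) := KSpace {
  points :> Type;
  zopen : set points -> Prop;
  zregular : set points -> (points -> k) -> Prop }.

Definition zclosed k (S : kspace k) (Z : set S) := zopen (~` Z).

Definition zconnected k (S : kspace k) :=
  forall U V : set S, zopen U -> zopen V -> U `|` V = setT ->
    U !=set0 -> V !=set0 -> U `&` V !=set0.

Definition peval (k : fieldType) m n (p : {mpoly k[(m * n)%N]})
  (A : 'M[k]_(m, n)) : k := p.@[fun i => mxvec A 0 i].

Definition nonvanishing (k : fieldType) m n (I : set {mpoly k[(m * n)%N]}) :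
    set 'M[k]_(m, n) :=
  [set A | exists2 p, I p & peval p A != 0].

(** The affine space of [m x n] matrices; affine [d]-space is the case of rows. *)
Definition affine_mx (k : fieldType) m n : kspace k := {|
  points := 'M[k]_(m, n);
  zopen U := exists I, U = nonvanishing I;
  zregular U f := forall A, U A ->
    exists I (p q : {mpoly k[(m * n)%N]}),
      [/\ nonvanishing I A, nonvanishing I `<=` U
        & forall C, nonvanishing I C ->
            peval q C != 0 /\ f C = peval p C / peval q C] |}.

Definition affine_space (k : fieldType) d := affine_mx k 1 d.

(** The induced structure on a subset [X]: a function is regular when it is
    locally the restriction of a regular function of the ambient space. *)
Definition induced k (S : kspace k) (X : set S) : kspace k := {|
  points := X;
  zopen U := exists2 V : set S, zopen V & U = [set x | V (val x)];
  zregular U f := forall x : X, U x ->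
    exists (V : set S) (g : S -> k),
      [/\ zopen V, V (val x), (forall y : X, V (val y) -> U y), zregular V g
        & forall y : X, V (val y) -> f y = g (val y)] |}.

Definition quotient_space k (S : kspace k) (T : Type) (q : S -> T) : kspace k := {|
  points := T;
  zopen U := zopen (q @^-1` U);
  zregular U f := zregular (q @^-1` U) (f \o q) |}.

Definition isomorphic k (S T : kspace k) :=
  exists phi : S -> T,
    [/\ bijective phi,
        forall U : set T, zopen U <-> zopen (phi @^-1` U)
      & forall (U : set T) (f : T -> k), zopen U ->
          (zregular U f <-> zregular (phi @^-1` U) (f \o phi))].

(** The closure condition is relative to [X]; it makes every part locally closed
    in [X].  A part isomorphic to affine [d]-space has dimension [d]. *)
Definition paving_by_affines k (S : kspace k) (X : set S) m (P : 'I_m -> set S) :=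
  [/\ \bigcup_i P i = X,
      trivIset setT P,
      forall i, exists2 Z : set S, zclosed Z &
        \bigcup_(j in [set j : 'I_m | (j <= i)%N]) P j = X `&` Z
    & forall i, exists d, isomorphic (induced (P i)) (affine_space k d)].

Section LinearGroups.
Variables (k : fieldType) (n : nat).
Implicit Types (G K B T L : set 'M[k]_n) (X Y g w : 'M[k]_n) (U V : {vspace 'M[k]_n}).

Definition GL : set 'M[k]_n := [set g | g \in unitmx].
Definition SL : set 'M[k]_n := [set g | \det g = 1].

Definition Ad g X := g *m X *m invmx g.
Definition bracket X Y := X *m Y - Y *m X.

Definition subgroup K :=
  [/\ K `<=` GL, K 1%:M, forall a b, K a -> K b -> K (a *m b)
    & forall a, K a -> K (invmx a)].

Definition gen_subgroup (A : set 'M[k]_n) : set 'M[k]_n :=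
  [set g | forall K, subgroup K -> A `<=` K -> K g].

Definition derived_group K : set 'M[k]_n :=
  gen_subgroup [set c | exists a b,
    [/\ K a, K b & c = a *m b *m invmx a *m invmx b]].

Definition solvable_group K := exists m, iter m derived_group K = [set 1%:M].

Definition closed_connected_subgroup G K :=
  [/\ subgroup K, K `<=` G,
      exists2 Z : set (affine_mx k n n), zclosed Z & K = G `&` Z
    & zconnected (@induced k (affine_mx k n n) K)].

Definition borel_subgroup G B :=
  [/\ closed_connected_subgroup G B, solvable_group B
    & forall K, closed_connected_subgroup G K -> solvable_group K ->
        B `<=` K -> K = B].

(** The tangent space at the identity: the matrices killed by the differentials
    at [1] of all polynomials vanishing on [K]. *)
Definition lie_algebra K : set 'M[k]_n :=
  [set X | forall p : {mpoly k[(n * n)%N]}, (forall g, K g -> peval p g = 0) ->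
    \sum_(i < (n * n)%N) peval (mderiv i p) 1%:M * mxvec X 0 i = 0].

Definition nilpotent_mx X := exists m, X ^+ m = 0.

Definition jordan_decomposition X s :=
  [/\ diagonalizable s, nilpotent_mx (X - s) & s *m X = X *m s].

(** The union of all closed connected normal unipotent subgroups of [B]; it is
    itself one of them. *)
Definition unipotent_radical B : set 'M[k]_n :=
  [set u | exists N, [/\ closed_connected_subgroup B N,
     forall b v, B b -> N v -> N (Ad b v),
     forall v, N v -> nilpotent_mx (v - 1%:M) & N u]].

Definition lie_prod U V : {vspace 'M[k]_n} :=
  <<[seq bracket X Y | X <- vbasis U, Y <- vbasis V]>>%VS.

Definition cartan_subalgebra G (h : {vspace 'M[k]_n}) :=
  [/\ forall X, X \in h -> lie_algebra G X,
      (lie_prod h h <= h)%VS,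
      exists m, iter m (lie_prod h) h = 0%VS
    & forall X, lie_algebra G X ->
        (forall Y, Y \in h -> bracket X Y \in h) -> X \in h].

Definition left_coset g B : set 'M[k]_n := [set g *m b | b in B].

Definition cosets G B : set (set 'M[k]_n) := [set left_coset g B | g in G].

Lemma cosets_mem G B (g : G) : left_coset (val g) B \in cosets G B.
Proof. by apply/mem_set; exists (val g) => //; apply: set_valP. Qed.

Definition coset_map G B (g : G) : cosets G B := SigSub (cosets_mem B g).

(** [G/B], with the quotient topology, a function being regular when its
    pullback to [G] is. *)
Definition flag_variety G B : kspace k :=
  @quotient_space k (@induced k (affine_mx k n n) G) (cosets G B) (coset_map B).

Definition hessenberg_space G B (H : {vspace 'M[k]_n}) :=
  [/\ forall X, lie_algebra B X -> X \in H,
      forall X, X \in H -> lie_algebra G X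
    & forall X Y, lie_algebra B X -> Y \in H -> bracket X Y \in H].

Definition hessenberg_variety G B (M : 'M[k]_n) (H : {vspace 'M[k]_n}) :
    set (flag_variety G B) :=
  [set C | exists g, [/\ G g, val C = left_coset g B & Ad (invmx g) M \in H]].

Definition schubert_cell G B w : set (flag_variety G B) :=
  [set C | exists2 b, B b & val C = left_coset (b *m w) B].

Variable h : {vspace 'M[k]_n}.

(** The maximal torus with Lie algebra [h], for [h] a Cartan subalgebra. *)
Definition torus G : set 'M[k]_n :=
  [set t | G t /\ forall X, X \in h -> t *m X = X *m t].

(** [W] is [N_G(T)/T]; an element is handled through a representative in
    [N_G(T)], and everything indexed by it depends only on its class. *)
Definition weyl_rep G : set 'M[k]_n :=
  [set w | G w /\ [set Ad w t | t in torus G] = torus G].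

Definition opposite_borel G B Bm :=
  borel_subgroup G Bm /\ B `&` Bm = torus G.

Local Notation dual := 'Hom(subvs_of h, k^o).
Implicit Types (a : dual) (A : set dual).

Definition root_space G a : set 'M[k]_n :=
  [set X | lie_algebra G X /\
     forall Y : subvs_of h, bracket (vsval Y) X = a Y *: X].

Definition root_set G : set dual :=
  [set a | a != 0 /\ exists2 X, root_space G a X & X != 0].

Definition roots_in G (S : set 'M[k]_n) : set dual :=
  [set a | root_set G a /\ root_space G a `<=` S].

Definition pos_roots G B := roots_in G (lie_algebra B).

Definition neg_roots G B : set dual := [set - a | a in pos_roots G B].

Definition simple_roots G B : set dual :=
  [set a | pos_roots G B a /\
     ~ exists b c, [/\ pos_roots G B b, pos_roots G B c & a = b + c]].

Definition weyl_act w a : dual :=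
  linfun (fun X : subvs_of h => a (vsproj h (Ad (invmx w) (vsval X)))).

Definition root_sum G A : set 'M[k]_n :=
  [set X | exists Y : dual -> 'M[k]_n,
     (forall a, A a -> root_space G a (Y a)) /\ X = \sum_(a \in A) Y a].

(** [Phi_X]: the roots [a] such that the [a]-component of [X] in the
    decomposition of the Lie algebra into [h] and the root spaces is nonzero. *)
Definition root_support G X : set dual :=
  [set a | root_set G a /\ exists (X0 : 'M[k]_n) (Y : dual -> 'M[k]_n),
     [/\ X0 \in h, forall b, root_set G b -> root_space G b (Y b),
         X = X0 + \sum_(b \in root_set G) Y b & Y a != 0]].

Definition root_supports G (S : set 'M[k]_n) : set dual :=
  \bigcup_(X in S) root_support G X.

(** [Phi_w], the positive roots made negative by the inverse of [w]. *)
Definition inversions G B w : set dual :=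
  pos_roots G B `&` (weyl_act w @` neg_roots G B).

(** [U_w], with [Bm] the Borel subgroup opposite to [B]. *)
Definition unipotent_cell B Bm w : set 'M[k]_n :=
  [set u | unipotent_radical B u /\ unipotent_radical Bm (Ad (invmx w) u)].

Definition hessenberg_complement G B (H : {vspace 'M[k]_n}) w : set dual :=
  pos_roots G B `\` (weyl_act w @` roots_in G [set X | X \in H]).

Variable s : 'M[k]_n.

Definition levi_roots G B : set dual :=
  [set a | root_set G a /\ exists c : dual -> int,
     a = \sum_(b \in [set b | simple_roots G B b /\ b (vsproj h s) = 0]) b *~ c b].

(** With [Phi_L] the set of [levi_roots], the standard parabolic subalgebra is
    [h] plus the root spaces of [Phi_L] and of the positive roots. *)
Definition levi_subalgebra G B : set 'M[k]_n :=
  [set X | exists X0 X1,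
     [/\ X0 \in h, root_sum G (levi_roots G B) X1 & X = X0 + X1]].

Definition nilradical G B : set 'M[k]_n :=
  root_sum G (pos_roots G B `\` levi_roots G B).

(** A closed connected subgroup is determined by its Lie algebra when [k] has
    characteristic zero. *)
Definition levi_subgroup G B L :=
  closed_connected_subgroup G L /\ lie_algebra L = levi_subalgebra G B.

End LinearGroups.

Arguments GL k n : clear implicits.
Arguments SL k n : clear implicits.
Arguments schubert_cell {k n} G B w.
Arguments hessenberg_variety {k n} G B M H.
Arguments inversions {k n} h G B w _.
Arguments root_supports {k n} h G S _.
Arguments hessenberg_complement {k n} h G B H w _.

(* Main.v *)
Require Import Defs.
From HB Require Import structures.
From mathcomp Require Import all_boot all_order all_fingroup all_algebra finmap.
From mathcomp Require Import boolp classical_sets functions cardinality fsbigop.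
From mathcomp Require Import reals complex.
From mathcomp Require Import mpoly.
From mathcomp Require Import ring zify.

Set Implicit Arguments.
Unset Strict Implicit.
Unset Printing Implicit Defensive.

Import Order.TTheory GRing.Theory Num.Theory.

Local Open Scope classical_set_scope.
Local Open Scope ring_scope.

(** Choose a Jordan basis [e_0, .., e_(n-1)] of [M = s + N] in which equal
    eigenvalues are contiguous and, within a generalized eigenspace, [N] kills an
    initial segment of the basis and sends the other vectors [e_l] to basis
    vectors [e_(r l)] with [r] increasing.  With respect to the corresponding
    torus and Borel subgroup, a point of the cell of [pi] is [u pi B] for a unique
    [u] in [U_pi], and it lies in the Hessenberg variety when the entries [(i, l)]
    of [u^-1 M u] indexed by the positive roots outside [pi M_H] vanish.
    Modulo the coordinates of [u] in the rows below [i] and those to the left in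
    row [i], such an entry is an affine function of a single coordinate of [u],
    with nonzero coefficient: the coordinate [(i, l)] if the eigenvalues at [i]
    and [l] differ, [(i, r l)] if they agree and [i < r l].  In the remaining case
    the entry vanishes identically as soon as [M] belongs to [pi H], which holds
    when the cell meets the variety.  Distinct entries involve distinct
    coordinates in this way, so solving from the bottom row up exhibits the
    intersection as the graph of a polynomial map on the other coordinates.  The
    equations of the first kind are counted by the term with [n_M], those of the
    second kind by the term with the orbit of [N]. *)

(** * Polynomial functions of matrices *)

Section PolynomialFunctions.
Variable F : fieldType.

(** The groups and algebras of the statement are given intrinsically (maximal solvable, tangent
    space, centraliser), so each has to be recognised as a set of matrices with prescribed zeros in
    the basis [P]. Connectedness and tangent vectors are both tested on polynomial curves, where
    they reduce to a polynomial in one variable having finitely many roots. Roots become ordered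
    pairs of indices, and the sets of roots in the dimension formula become relations on indices.
    The order of the Jordan basis makes the equations triangular: as [r] increases within an
    eigenspace, unitriangular conjugation inside a block neither moves nor rescales the lowest
    nonzero entry of a column of the nilpotent part. With Jordan chains listed one after the other
    this can fail. An isomorphism with affine space must be regular on G/B, hence come from
    functions on G constant on cosets: the entries of the lower factor in the Gauss decomposition of
    w^-1 g, with leading minors as denominators. The order of the cells comes from ranks of lower
    left corners, which are semicontinuous and determine the permutation. *)

Lemma mpoly_ring_ind n (Pr : {mpoly F[n]} -> Prop) :
  (forall c, Pr c%:MP) -> (forall i, Pr 'X_i) ->
  (forall p q, Pr p -> Pr q -> Pr (p + q)) ->
  (forall p q, Pr p -> Pr q -> Pr (p * q)) -> forall p, Pr p.
Proof.
move=> PC PX PD PM p; rewrite [p]mpolyE.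
apply: (big_ind Pr) => [||m _]; [by rewrite -mpolyC0|exact: PD|].
rewrite -mul_mpolyC; apply: (PM) => //; rewrite mpolyXE_id.
apply: (big_ind Pr) => [||i _]; [by rewrite -mpolyC1|exact: PM|].
by elim: (m i) => [|k IHk]; rewrite ?expr0 -?mpolyC1 // exprS; apply: PM.
Qed.

Definition polyf m n (f : 'M[F]_(m, n) -> F) := exists p, forall A, f A = peval p A.

Definition polymap m n m' n' (f : 'M[F]_(m, n) -> 'M[F]_(m', n')) :=
  forall i j, polyf (fun A => f A i j).

Section Closure.
Variables m n : nat.
Implicit Types f g : 'M[F]_(m, n) -> F.

Lemma polyf_peval p : polyf (fun A : 'M[F]_(m, n) => peval p A).
Proof. by exists p. Qed.

Lemma eq_polyf f g : f =1 g -> polyf f -> polyf g.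
Proof. by move=> fg [p fp]; exists p => A; rewrite -fg. Qed.

Lemma polyfC c : polyf (fun _ : 'M[F]_(m, n) => c).
Proof. by exists c%:MP => A; rewrite /peval mevalC. Qed.

Lemma polyfD f g : polyf f -> polyf g -> polyf (fun A => f A + g A).
Proof. by move=> [p fp] [q gq]; exists (p + q) => A; rewrite /peval mevalD fp gq. Qed.

Lemma polyfM f g : polyf f -> polyf g -> polyf (fun A => f A * g A).
Proof. by move=> [p fp] [q gq]; exists (p * q) => A; rewrite /peval mevalM fp gq. Qed.

Lemma polyfN f : polyf f -> polyf (fun A => - f A).
Proof. by move=> [p fp]; exists (- p) => A; rewrite /peval mevalN fp. Qed.

Lemma polyfB f g : polyf f -> polyf g -> polyf (fun A => f A - g A).
Proof. by move=> pf pg; apply: polyfD => //; apply: polyfN. Qed.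

Lemma polyfX f k : polyf f -> polyf (fun A => f A ^+ k).
Proof.
move=> pf; elim: k => [|k IHk]; first exact: polyfC.
by apply: eq_polyf (polyfM pf IHk) => A; rewrite exprS.
Qed.

Lemma polyf_sum (I : Type) (r : seq I) (Q : pred I) (f : I -> 'M[F]_(m, n) -> F) :
  (forall i, Q i -> polyf (f i)) -> polyf (fun A => \sum_(i <- r | Q i) f i A).
Proof.
move=> pf; elim: r => [|i r IHr].
  by apply: eq_polyf (polyfC 0) => A; rewrite big_nil.
case Qi: (Q i); last by apply: eq_polyf IHr => A; rewrite big_cons Qi.
by apply: eq_polyf (polyfD (pf i Qi) IHr) => A; rewrite big_cons Qi.
Qed.

Lemma polyf_prod (I : Type) (r : seq I) (Q : pred I) (f : I -> 'M[F]_(m, n) -> F) :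
  (forall i, Q i -> polyf (f i)) -> polyf (fun A => \prod_(i <- r | Q i) f i A).
Proof.
move=> pf; elim: r => [|i r IHr].
  by apply: eq_polyf (polyfC 1) => A; rewrite big_nil.
case Qi: (Q i); last by apply: eq_polyf IHr => A; rewrite big_cons Qi.
by apply: eq_polyf (polyfM (pf i Qi) IHr) => A; rewrite big_cons Qi.
Qed.

Lemma polyf_entry i j : polyf (fun A : 'M[F]_(m, n) => A i j).
Proof. by exists 'X_(mxvec_index i j) => A; rewrite /peval mevalXU mxvecE. Qed.

Lemma polymap_id : polymap (fun A : 'M[F]_(m, n) => A).
Proof. by move=> i j; apply: polyf_entry. Qed.

Lemma polymapC m' n' (C : 'M[F]_(m', n')) : polymap (fun _ : 'M[F]_(m, n) => C).
Proof. by move=> i j; apply: polyfC. Qed.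

Lemma polymapD m' n' (f g : 'M[F]_(m, n) -> 'M[F]_(m', n')) :
  polymap f -> polymap g -> polymap (fun A => f A + g A).
Proof.
by move=> pf pg i j; apply: eq_polyf (polyfD (pf i j) (pg i j)) => A; rewrite mxE.
Qed.

Lemma polymapM m' n' k (f : 'M[F]_(m, n) -> 'M[F]_(m', k)) (g : 'M[F]_(m, n) -> 'M[F]_(k, n')) :
  polymap f -> polymap g -> polymap (fun A => f A *m g A).
Proof.
move=> pf pg i j; apply: (@eq_polyf (fun A => \sum_l f A i l * g A l j)).
  by move=> A; rewrite mxE.
by apply: polyf_sum => l _; apply: polyfM.
Qed.

Lemma polyf_det k (f : 'M[F]_(m, n) -> 'M[F]_k) :
  polymap f -> polyf (fun A => \det (f A)).
Proof.
move=> pf; apply: polyf_sum => s _; apply: polyfM; first exact: polyfC.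
by apply: polyf_prod.
Qed.

Lemma polymap_adj k (f : 'M[F]_(m, n) -> 'M[F]_k) :
  polymap f -> polymap (fun A => \adj (f A)).
Proof.
move=> pf i j; apply: (@eq_polyf (fun A => cofactor (f A) j i)).
  by move=> A; rewrite mxE.
apply: polyfM; first exact: polyfC.
apply: polyf_det => i' j'.
apply: (@eq_polyf (fun A => f A (lift j i') (lift i j'))); last exact: pf.
by move=> A; rewrite !mxE.
Qed.

End Closure.

Arguments polyfC {m n} c.
Arguments polymapC {m n m' n'} C.
Arguments polymap_id {m n}.

Lemma polyf_comp m n m' n' (f : 'M[F]_(m', n') -> F) (g : 'M[F]_(m, n) -> 'M[F]_(m', n')) :
  polyf f -> polymap g -> polyf (fun A => f (g A)).
Proof.
move=> [p fp] pg; apply: (@eq_polyf _ _ (fun A => peval p (g A))).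
  by move=> A; rewrite fp.
elim/mpoly_ring_ind: p {f fp} => [c|i|p q IHp IHq|p q IHp IHq].
- by apply: eq_polyf (polyfC c) => A; rewrite /peval mevalC.
- case/mxvec_indexP: i => i j.
  by apply: (eq_polyf _ (pg i j)) => A; rewrite /peval mevalXU mxvecE.
- by apply: eq_polyf (polyfD IHp IHq) => A; rewrite /peval mevalD.
- by apply: eq_polyf (polyfM IHp IHq) => A; rewrite /peval mevalM.
Qed.

Lemma polymap_comp m n m' n' m2 n2 (f : 'M[F]_(m', n') -> 'M[F]_(m2, n2))
    (g : 'M[F]_(m, n) -> 'M[F]_(m', n')) :
  polymap f -> polymap g -> polymap (fun A => f (g A)).
Proof. by move=> pf pg i j; apply: polyf_comp (pf i j) pg. Qed.

(** Clearing denominators in a rational map [num / den] is what lets open sets and regular functions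
    be pulled back along it. The formula says nothing where [den] vanishes. *)
Lemma polyf_clear m n m' n' (f : 'M[F]_(m', n') -> F)
    (num : 'M[F]_(m, n) -> 'M[F]_(m', n')) (den : 'M[F]_(m, n) -> F) :
  polyf f -> polymap num -> polyf den ->
  exists N h, polyf h /\
    forall A, den A != 0 -> h A = den A ^+ N * f ((den A)^-1 *: num A).
Proof.
move=> [p fp] pn pd.
suff [N [h [ph hE]]] : exists N h, polyf h /\
    forall A, den A != 0 -> h A = den A ^+ N * peval p ((den A)^-1 *: num A).
  by exists N, h; split=> // A /hE ->; rewrite fp.
elim/mpoly_ring_ind: p {f fp} => [c|i|p q|p q].
- exists 0%N, (fun=> c); split; first exact: polyfC.
  by move=> A _; rewrite expr0 mul1r /peval mevalC.
- case/mxvec_indexP: i => i j; exists 1%N, (fun A => num A i j); split=> // A dA.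
  by rewrite /peval mevalXU mxvecE mxE expr1 mulVKf.
- move=> [N [h [ph hE]]] [N' [h' [ph' hE']]].
  exists (N + N')%N, (fun A => den A ^+ N' * h A + den A ^+ N * h' A); split.
    by apply: polyfD; apply: polyfM => //; apply: polyfX.
  by move=> A dA; rewrite hE // hE' // /peval mevalD exprD; ring.
- move=> [N [h [ph hE]]] [N' [h' [ph' hE']]].
  exists (N + N')%N, (fun A => h A * h' A); split; first exact: polyfM.
  by move=> A dA; rewrite hE // hE' // /peval mevalM exprD; ring.
Qed.

Definition evmx m n (a : 'M[{poly F}]_(m, n)) (t : F) : 'M[F]_(m, n) :=
  map_mx (horner_eval t) a.

Lemma evmxE m n (a : 'M[{poly F}]_(m, n)) t i j : evmx a t i j = (a i j).[t].
Proof. by rewrite mxE. Qed.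

(** The logarithmic derivative of the cleared denominator appears because
    [P] is [q ^+ N] times the value of [p] along the curve. *)
Lemma peval_curve m n (p : {mpoly F[(m * n)%N]}) (a : 'M[{poly F}]_(m, n)) (q : {poly F}) :
  exists N (P : {poly F}),
    (forall t, q.[t] != 0 -> P.[t] = q.[t] ^+ N * peval p ((q.[t])^-1 *: evmx a t)) /\
    (q.[0] = 1 -> P^`().[0] = N%:R * q^`().[0] * peval p (evmx a 0) +
       \sum_i peval (mderiv i p) (evmx a 0) *
         mxvec (evmx (map_mx (@deriv _) a) 0 - q^`().[0] *: evmx a 0) 0 i).
Proof.
elim/mpoly_ring_ind: p => [c|i|p p'|p p'].
- exists 0%N, c%:P; split=> [t qt|q0].
    by rewrite hornerC expr0 mul1r /peval mevalC.
  rewrite derivC horner0 !mul0r add0r big1 // => i _.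
  by rewrite mderivC /peval meval0 mul0r.
- case/mxvec_indexP: i => i j; exists 1%N, (a i j); split=> [t qt|q0].
    by rewrite /peval mevalXU mxvecE mxE expr1 mulVKf // evmxE.
  rewrite (bigD1 (mxvec_index i j)) //= big1 ?addr0 => [|k ki].
    rewrite mderivX mnm1E eqxx scale1r -[X in (X - _)%MM]add0m addmK /peval mpolyX0 meval1.
    rewrite mxvecE !mxE.
    by rewrite mevalXU mxvecE !mxE /horner_eval; ring.
  by rewrite mderivX mnm1E eq_sym (negPf ki) scale0r /peval meval0 mul0r.
- move=> [N [P [PE P']]] [N2 [P2 [P2E P2']]].
  exists (N + N2)%N, (q ^+ N2 * P + q ^+ N * P2); split=> [t qt|q0].
    by rewrite hornerD !hornerM !horner_exp PE // P2E // /peval mevalD exprD; ring.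
  have qn0 : q.[0] != 0 by rewrite q0 oner_eq0.
  have PE0 : P.[0] = peval p (evmx a 0) by rewrite PE // q0 expr1n invr1 scale1r mul1r.
  have P2E0 : P2.[0] = peval p' (evmx a 0) by rewrite P2E // q0 expr1n invr1 scale1r mul1r.
  rewrite derivD !derivM !deriv_exp !(hornerD, hornerM, horner_exp, hornerMn) P' // P2' //.
  rewrite PE0 P2E0 q0 !expr1n.
  under [in RHS]eq_bigr do rewrite mderivD /peval mevalD mulrDl.
  rewrite big_split /= /peval mevalD natrD.
  set S1 := (X in _ = _ + (X + _)); set S2 := (X in _ = _ + (_ + X)).
  rewrite -/S1 -/S2.
  move: S1 S2 (meval _ p) (meval _ p') (q^`()).[0] => A1 A2 A3 A4 A5.
  by ring.
- move=> [N [P [PE P']]] [N2 [P2 [P2E P2']]].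
  exists (N + N2)%N, (P * P2); split=> [t qt|q0].
    by rewrite hornerM PE // P2E // /peval mevalM exprD; ring.
  have qn0 : q.[0] != 0 by rewrite q0 oner_eq0.
  have PE0 : P.[0] = peval p (evmx a 0) by rewrite PE // q0 expr1n invr1 scale1r mul1r.
  have P2E0 : P2.[0] = peval p' (evmx a 0) by rewrite P2E // q0 expr1n invr1 scale1r mul1r.
  rewrite derivM !(hornerD, hornerM) P' // P2' // PE0 P2E0 /peval mevalM natrD.
  under [in RHS]eq_bigr do rewrite mderivM mevalD !mevalM mulrDl mulrAC -[X in _ + X]mulrA.
  rewrite big_split /= -mulr_suml -mulr_sumr.
  set S1 := (X in _ = _ + (X * _ + _)); set S2 := (X in _ = _ + (_ + _ * X)).
  rewrite -/S1 -/S2.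
  move: S1 S2 (meval _ p) (meval _ p') (q^`()).[0] => A1 A2 A3 A4 A5.
  by ring.
Qed.

End PolynomialFunctions.

Arguments polyfC {F m n} c.
Arguments polymapC {F m n m' n'} C.
Arguments polymap_id {F m n}.

(** * Subsets of the flag variety isomorphic to affine spaces *)

Section AffineCriterion.
Variables (F : fieldType) (n d : nat).
Variables (num : 'M[F]_n -> 'rV[F]_d) (Q : 'M[F]_n -> F).
Hypotheses (num_poly : polymap num) (Q_poly : polyf Q).

Let v A := (Q A)^-1 *: num A.

Definition pullback (U : set 'rV[F]_d) : set 'M[F]_n := [set A | Q A != 0 /\ U (v A)].

Lemma pullback_open (U : set 'rV[F]_d) :
  @zopen _ (affine_space F d) U -> @zopen _ (affine_mx F n n) (pullback U).
Proof.
move=> [I ->].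
exists [set q | exists2 p, I p & exists N, forall A,
   peval q A != 0 <-> Q A != 0 /\ Q A ^+ N * peval p (v A) != 0] => /=.
rewrite predeqE => A; split=> [[QA [p Ip pA]]|[q [p Ip [N qE]] /qE[QA pA]]]; last first.
  by split=> //; exists p => //; apply: contraNneq pA => ->; rewrite mulr0.
have [N [h [hp hE]]] := polyf_clear (polyf_peval p) num_poly Q_poly.
(* [h] is unconstrained where [Q] vanishes; the extra factor [Q] makes the polynomial vanish
   there. *)
have [q qE] := polyfM Q_poly hp.
have qP C : peval q C != 0 <-> Q C != 0 /\ Q C ^+ N * peval p (v C) != 0.
  rewrite -qE mulf_eq0 negb_or; split=> [/andP[QC hC]|[QC hC]].
    by rewrite -hE.
  by rewrite QC hE.
exists q; first by exists p => //; exists N.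
by apply/qP; split=> //; rewrite mulf_neq0 // expf_neq0.
Qed.

Lemma pullback_regular (U : set 'rV[F]_d) (f : 'rV[F]_d -> F) :
  @zregular _ (affine_space F d) U f -> @zregular _ (affine_mx F n n) (pullback U) (f \o v).
Proof.
move=> Uf A [QA UA]; have [I [p [q [IA IU pqE]]]] := Uf _ UA.
have [J JE] : @zopen _ (affine_mx F n n) (pullback (nonvanishing I)).
  by apply: pullback_open; exists I.
have [N [h0 [[h h0E] hE]]] := polyf_clear (polyf_peval p) num_poly Q_poly.
have [N' [h0' [[h' h0E'] hE']]] := polyf_clear (polyf_peval q) num_poly Q_poly.
have [Q1 Q1E] := Q_poly.
exists J, (h * Q1 ^+ N'), (h' * Q1 ^+ N); rewrite -JE; split=> //.
  by move=> C [QC IC]; split=> //; apply: IU.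
move=> C [QC IC]; have [qC fC] := pqE _ IC.
have -> : peval (h * Q1 ^+ N') C = Q C ^+ N * peval p (v C) * Q C ^+ N'.
  by rewrite -hE // h0E Q1E /peval mevalM rmorphXn.
have -> : peval (h' * Q1 ^+ N) C = Q C ^+ N' * peval q (v C) * Q C ^+ N.
  by rewrite -hE' // h0E' Q1E /peval mevalM rmorphXn.
rewrite /= fC; split; first by rewrite !mulf_neq0 ?expf_neq0.
by rewrite mulrAC [in RHS]mulrC mulrA -mulrA; field; rewrite qC expf_neq0 // expf_neq0.
Qed.

Variables (G B : set 'M[F]_n) (a : 'rV[F]_d -> 'M[F]_n).
Variable X : set (flag_variety G B).
Hypotheses (a_poly : polymap a) (aG : forall y, G (a y)).
Hypothesis XE : forall C : flag_variety G B, X C <-> exists y, val C = left_coset (a y) B.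
Hypothesis v_coset : forall g g', G g -> G g' ->
  left_coset g B = left_coset g' B -> Q g != 0 -> Q g' != 0 /\ v g = v g'.
Hypothesis v_section : forall y, Q (a y) != 0 /\ v (a y) = y.

Lemma preimage_open (W : set 'M[F]_n) :
  @zopen _ (affine_mx F n n) W -> @zopen _ (affine_space F d) (a @^-1` W).
Proof.
move=> [I ->]; exists [set q | exists2 p, I p & forall y, peval q y = peval p (a y)].
rewrite predeqE => y; split=> [[p Ip pa]|[q [p Ip qE] qy]].
  have [q qE] := polyf_comp (polyf_peval p) a_poly.
  by exists q; rewrite -?qE //; exists p.
by exists p => //; rewrite -qE.
Qed.

Let repr (C : flag_variety G B) := cid2 (set_mem (valP C)).
Let rep C := s2val (repr C).

Let repG C : G (rep C).
Proof. by rewrite /rep; case: (repr C). Qed.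

Let repE C : val C = left_coset (rep C) B.
Proof. by rewrite /rep; case: (repr C). Qed.

Let psi0 y : flag_variety G B := coset_map B (SigSub (mem_set (aG y)) : G).

Let psi0X y : X (psi0 y).
Proof. by apply/XE; exists y. Qed.

Let psi y : X := SigSub (mem_set (psi0X y)).

Let phi (x : X) : 'rV[F]_d := v (rep (val x)).

Let phiK y : phi (psi y) = y.
Proof.
have [Qa va] := v_section y.
have [|_ E] := v_coset (aG y) (repG (psi0 y)) _ Qa; first by rewrite -repE.
by rewrite /phi -[RHS]va E.
Qed.

Let psi_onto (x : X) : exists y, x = psi y.
Proof.
have /XE[y xy] : X (val x) by apply: set_valP.
by exists y; apply: val_inj; apply: val_inj; rewrite xy.
Qed.

Let Qrep (x : X) : Q (rep (val x)) != 0.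
Proof.
have [y ->] := psi_onto x; have [Qa _] := v_section y.
by have [|] := v_coset (aG y) (repG (psi0 y)) _ Qa; first by rewrite -repE.
Qed.

(** [rep] is an arbitrary choice in each coset; [chartE] shows that the choice does not matter, so
    the preimage in [G] is given by [pullback U]. *)
Let chart (U : set 'rV[F]_d) : set (flag_variety G B) := [set C | pullback U (rep C)].

Let chartE U (g : G) : chart U (coset_map B g) <-> pullback U (val g).
Proof.
have gG : G (val g) by apply: set_valP.
have E : left_coset (val g) B = left_coset (rep (coset_map B g)) B by rewrite -repE.
split=> -[Qg Ug].
  by have [|Qg' vg'] := v_coset (repG _) gG _ Qg => //; split=> //; rewrite -vg'.
by have [|Qg' vg'] := v_coset gG (repG (coset_map B g)) _ Qg => //; split=> //; rewrite -vg'.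
Qed.

Let chart_open U : @zopen _ (affine_space F d) U -> zopen (chart U).
Proof.
move=> /pullback_open oU; exists (pullback U) => //.
by rewrite predeqE => g; apply: chartE.
Qed.

(** [a] parametrises [X] by representatives of cosets, and its inverse [v] is the
    quotient of [num] by [Q], which is well defined on cosets. *)
Lemma affine_criterion : isomorphic (induced X) (affine_space F d).
Proof.
exists phi; split.
- exists psi => // x; have [y ->] := psi_onto x; by rewrite phiK.
- move=> U; split=> [oU|[V [W oW VW] UV]].
    exists (chart U); first exact: chart_open.
    by rewrite predeqE => x; split=> [Ux|[]//]; split=> //; apply: Qrep.
  suff -> : U = a @^-1` W by apply: preimage_open.
  rewrite predeqE => y; rewrite -{1}[y]phiK.
  transitivity (V (psi0 y)).
    by have := UV; rewrite predeqE => /(_ (psi y)).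
  by have := VW; rewrite predeqE => /(_ (SigSub (mem_set (aG y)))).
- move=> U f oU; split=> [Uf x Ux|Uf y Uy].
    exists (chart U), (fun C => f (v (rep C))); split=> //.
    + exact: chart_open.
    + by move=> y [].
    move=> g gU; exists (pullback U), (f \o v); split.
    + exact: pullback_open.
    + exact/chartE.
    + by move=> g' /chartE.
    + exact: pullback_regular.
    move=> g' [Qg' Ug'] /=.
    have gG : G (val g') by apply: set_valP.
    by have [|_ ->] := v_coset gG (repG (coset_map B g')) _ Qg'; rewrite -?repE.
  (* Near [a y] the function is a fraction in the matrix entries; substituting the polynomial map
     [a] turns it into a fraction in [y]. *)
  have Upsi : (phi @^-1` U) (psi y) by rewrite /= phiK.
  have [V [g [oV Vy VU Vg fE]]] := Uf _ Upsi.
  have [V' [g' [oV' V'y V'V V'g' g'E]]] := Vg (SigSub (mem_set (aG y))) Vy.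
  have [I [p [q [Iy IV' pq]]]] := V'g' _ V'y.
  have [J JE] : @zopen _ (affine_space F d) (a @^-1` nonvanishing I).
    by apply: preimage_open; exists I.
  have [p1 p1E] := polyf_comp (polyf_peval p) a_poly.
  have [q1 q1E] := polyf_comp (polyf_peval q) a_poly.
  have IV z : nonvanishing I (a z) -> V (psi0 z).
    by move=> /IV' Vz; apply: (V'V (SigSub (mem_set (aG z)))).
  exists J, p1, q1; rewrite -JE; split=> //.
    by move=> z /IV Vz; have := VU (psi z) Vz; rewrite /= phiK.
  move=> z Iz; have [qz gz] := pq _ Iz.
  rewrite -p1E -q1E; split=> //.
  have := fE (psi z) (IV _ Iz); rewrite /= phiK => ->.
  by rewrite -gz -(g'E (SigSub (mem_set (aG z)))) //; apply: IV'.
Qed.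

End AffineCriterion.

(** * Groups of matrices with prescribed zero entries *)

Section AdjointAction.
Variables (F : fieldType) (n : nat).
Implicit Types g h X Y : 'M[F]_n.

Lemma AdM g X Y : g \in unitmx -> Ad g (X *m Y) = Ad g X *m Ad g Y.
Proof. by move=> ug; rewrite /Ad !mulmxA mulmxKV. Qed.

Lemma AdD g X Y : Ad g (X + Y) = Ad g X + Ad g Y.
Proof. by rewrite /Ad mulmxDr mulmxDl. Qed.

Lemma AdN g X : Ad g (- X) = - Ad g X.
Proof. by rewrite /Ad mulmxN mulNmx. Qed.

Lemma AdB g X Y : Ad g (X - Y) = Ad g X - Ad g Y.
Proof. by rewrite AdD AdN. Qed.

Lemma AdZ g a X : Ad g (a *: X) = a *: Ad g X.
Proof. by rewrite /Ad -scalemxAr -scalemxAl. Qed.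

Lemma Ad0 g : Ad g 0 = 0.
Proof. by rewrite /Ad mulmx0 mul0mx. Qed.

Lemma Ad1 g : g \in unitmx -> Ad g 1%:M = 1%:M.
Proof. by move=> ug; rewrite /Ad mulmx1 mulmxV. Qed.

Lemma invmxM g h : g \in unitmx -> h \in unitmx ->
  invmx (g *m h) = invmx h *m invmx g.
Proof.
move=> ug uh; have ugh : g *m h \in unitmx by rewrite unitmx_mul ug.
apply: (@row_full_inj _ _ _ _ (g *m h)); first by rewrite row_full_unit.
by rewrite mulmxV // mulmxA mulmxK // mulmxV.
Qed.

Lemma Ad_mul g h X : g \in unitmx -> h \in unitmx -> Ad (g *m h) X = Ad g (Ad h X).
Proof. by move=> ug uh; rewrite /Ad invmxM // !mulmxA. Qed.

Lemma AdK g : g \in unitmx -> cancel (Ad g) (Ad (invmx g)).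
Proof. by move=> ug X; rewrite -Ad_mul ?unitmx_inv // mulVmx // /Ad invmx1 mul1mx mulmx1. Qed.

Lemma AdKV g : g \in unitmx -> cancel (Ad (invmx g)) (Ad g).
Proof. by move=> ug X; rewrite -Ad_mul ?unitmx_inv // mulmxV // /Ad invmx1 mul1mx mulmx1. Qed.

Lemma Ad_det g X : g \in unitmx -> \det (Ad g X) = \det X.
Proof. by move=> ug; rewrite /Ad !det_mulmx mulrAC -det_mulmx mulmxV // det1 mul1r. Qed.

Lemma Ad_unit g X : g \in unitmx -> (Ad g X \in unitmx) = (X \in unitmx).
Proof. by move=> ug; rewrite !unitmxE Ad_det. Qed.

Lemma Ad_tr g X : g \in unitmx -> \tr (Ad g X) = \tr X.
Proof. by move=> ug; rewrite /Ad mxtrace_mulC mulmxA mulVmx // mul1mx. Qed.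

Lemma Ad_inv g X : g \in unitmx -> X \in unitmx -> Ad g (invmx X) = invmx (Ad g X).
Proof. by move=> ug uX; rewrite /Ad !invmxM ?unitmx_mul ?unitmx_inv ?ug // invmxK mulmxA. Qed.

Lemma Ad_bracket g X Y : g \in unitmx -> Ad g (bracket X Y) = bracket (Ad g X) (Ad g Y).
Proof. by move=> ug; rewrite /bracket AdB !AdM. Qed.

Lemma polymap_Ad m m' g (f : 'M[F]_(m, m') -> 'M[F]_n) :
  polymap f -> polymap (fun A => Ad g (f A)).
Proof. by move=> pf; apply: (polymapM (polymapM (polymapC _) pf) (polymapC _)). Qed.

End AdjointAction.

Section Masks.
Variables (F : fieldType) (n : nat).
Implicit Types (e : rel 'I_n) (p : pred 'I_n) (A B : 'M[F]_n).

(** For a preorder [e] this is an incidence algebra. The group is obtained from the full relation,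
    the Borel subgroup from [up], the torus from equality and the Levi subgroup from
    [same_eigen]. *)
Definition masked e A := forall i j, ~~ e i j -> A i j = 0.

Definition dg p : 'M[F]_n := diag_mx (\row_j (p j)%:R).

Lemma dgE p i j : dg p i j = (p i && (i == j))%:R.
Proof. by rewrite !mxE andbC; case: (i == j); rewrite ?mulr1n ?mulr0n. Qed.

Lemma mul_dg m p (A : 'M[F]_(n, m)) i j : (dg p *m A) i j = if p i then A i j else 0.
Proof. by rewrite mul_diag_mx !mxE; case: (p i); rewrite ?mul1r ?mul0r. Qed.

Lemma mul_mx_dg m p (A : 'M[F]_(m, n)) i j : (A *m dg p) i j = if p j then A i j else 0.
Proof. by rewrite mul_mx_diag !mxE; case: (p j); rewrite ?mulr1 ?mulr0. Qed.

Lemma masked1 e : reflexive e -> masked e 1%:M.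
Proof. by move=> re i j; rewrite mxE; case: eqP => // ->; rewrite re. Qed.

Lemma maskedD e A B : masked e A -> masked e B -> masked e (A + B).
Proof. by move=> eA eB i j eij; rewrite mxE eA // eB // addr0. Qed.

Lemma maskedZ e a A : masked e A -> masked e (a *: A).
Proof. by move=> eA i j eij; rewrite mxE eA // mulr0. Qed.

Lemma maskedN e A : masked e A -> masked e (- A).
Proof. by move=> eA i j eij; rewrite mxE eA // oppr0. Qed.

Lemma maskedM e A B : transitive e -> masked e A -> masked e B -> masked e (A *m B).
Proof.
move=> te eA eB i j eij; rewrite mxE big1 // => k _.
have [eik|/eA->] := boolP (e i k); last by rewrite mul0r.
have [ekj|/eB->] := boolP (e k j); last by rewrite mulr0.
by rewrite (te _ _ _ eik ekj) in eij.
Qed.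

(** The span of the [e_j] with [e i j] is mapped into itself, hence onto itself
    by dimension, so its complement is not reached by the inverse either. *)
Lemma masked_inv e A : reflexive e -> transitive e -> A \in unitmx ->
  masked e A -> masked e (invmx A).
Proof.
move=> re te uA eA i j eij; pose D := dg (e i).
have DA : D *m A = D *m A *m D.
  apply/matrixP => k l; rewrite mul_mx_dg !mul_dg.
  case: ifP => eik; case: ifP => eil //; rewrite eA //.
  by apply: contraFN eil; apply: te.
have [X XE] : exists X, D = X *m (D *m A).
  apply/submxP; rewrite -(geq_leqif (mxrank_leqif_sup _)); last by rewrite DA submxMl.
  by rewrite mxrankMfree // row_free_unit.
have -> : invmx A i j = (D *m invmx A) i j by rewrite mul_dg re.
rewrite XE mulmxA mulmxK // -[X *m D]/(X *m dg (e i)).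
by rewrite mul_mx_dg (negPf eij).
Qed.

End Masks.

Section SameEigenvalue.
Variables (T : eqType) (n : nat) (sigma : 'I_n -> T).

Definition same_eigen : rel 'I_n := fun i j => sigma i == sigma j.

Lemma same_eigen_refl : reflexive same_eigen. Proof. by move=> i; apply: eqxx. Qed.

Lemma same_eigen_trans : transitive same_eigen.
Proof. by move=> j i k /eqP E; rewrite /same_eigen E. Qed.

End SameEigenvalue.

(** * Polynomial curves of matrices and the differential of the determinant *)

Section PolynomialIdentities.
Variables (F : numFieldType) (n : nat).

Lemma poly_nonroot (p : {poly F}) : p != 0 -> exists t, p.[t] != 0.
Proof.
move=> p0; apply: contrapT => rp.
suff : (size [seq (i%:R : F) | i <- iota 0 (size p)] < size p)%N.
  by rewrite size_map size_iota ltnn.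
apply: max_poly_roots => //; last by rewrite map_inj_uniq ?iota_uniq //; apply: (mulrIn (oner_neq0 F)).
by apply/allP => t _; apply: contrapT => /negP pt; apply: rp; exists t.
Qed.

Lemma poly_ext (p q : {poly F}) : (forall t, p.[t] = q.[t]) -> p = q.
Proof.
move=> pq; apply/eqP; rewrite -subr_eq0; apply: contraT => /poly_nonroot[t].
by rewrite hornerD hornerN pq subrr eqxx.
Qed.

Lemma evmx_det (x : 'M[{poly F}]_n) t : \det (evmx x t) = (\det x).[t].
Proof. by rewrite det_map_mx. Qed.

Lemma evmxM m k (x : 'M[{poly F}]_(n, m)) (y : 'M_(m, k)) t :
  evmx (x *m y) t = evmx x t *m evmx y t.
Proof. exact: map_mxM. Qed.

Definition dermx m k (x : 'M[{poly F}]_(m, k)) := map_mx (@deriv F) x.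

Lemma dermxM m k (x : 'M[{poly F}]_(n, m)) (y : 'M_(m, k)) :
  dermx (x *m y) = dermx x *m y + x *m dermx y.
Proof.
apply/matrixP => i j; rewrite !mxE raddf_sum -big_split.
by apply: eq_bigr => l _; rewrite /= derivM !mxE.
Qed.

Definition line (A B : 'M[F]_n) : 'M[{poly F}]_n := map_mx polyC A + 'X *: map_mx polyC B.

Lemma evmx_line A B t : evmx (line A B) t = A + t *: B.
Proof. by apply/matrixP => i j; rewrite evmxE !mxE !(hornerE, hornerMX). Qed.

Lemma dermx_line A B : dermx (line A B) = map_mx polyC B.
Proof.
by apply/matrixP => i j; rewrite !mxE derivD derivC derivM derivX derivC mulr0 mul1r add0r addr0.
Qed.

(** With c the characteristic polynomial of -X, det(1 + tX) = t^n c(1/t); the coefficient of t is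
    therefore that of degree n - 1 in c, a trace. *)
Lemma deriv_det1 (X : 'M[F]_n) : (0 < n)%N -> (\det (line 1%:M X))^`().[0] = \tr X.
Proof.
move=> n0; pose c := char_poly (- X).
have sc : size c = n.+1 by rewrite size_char_poly.
pose r : {poly F} := \sum_(k < n.+1) c`_k *: 'X^(n - k).
have -> : \det (line 1%:M X) = r.
  have X0 : ('X : {poly F}) != 0 by rewrite -size_poly_gt0 size_polyX.
  (* The factor [X] settles t = 0, where the substitution of 1/t is meaningless. *)
  apply: (mulIf X0); apply: poly_ext => t; rewrite !hornerM hornerX.
  have [->|t0] := eqVneq t 0; first by rewrite !mulr0.
  congr (_ * _); rewrite -evmx_det evmx_line.
  have -> : 1%:M + t *: X = t *: (t^-1%:M - - X).
    by rewrite opprK scalerDr scale_scalar_mx mulfV.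
  rewrite detZ.
  have -> : t^-1%:M - - X = evmx (char_poly_mx (- X)) t^-1.
    by apply/matrixP => i j; rewrite evmxE !mxE !(hornerE, hornerMn).
  rewrite evmx_det -/(char_poly _) -/c horner_coef sc horner_sum mulr_sumr.
  apply: eq_bigr => k _; rewrite hornerZ hornerXn mulrCA; congr (_ * _).
  have tk : t ^+ k != 0 by rewrite expf_neq0.
  by apply: (mulIf tk); rewrite exprVn mulfVK // -exprD subnK // -ltnS.
rewrite horner_coef0 coef_deriv mulr1n coef_sum.
have n1 : (n.-1 < n.+1)%N by rewrite ltnS leq_pred.
rewrite (bigD1 (Ordinal n1)) //= big1 ?addr0 => [|k kn].
  rewrite coefZ coefXn (_ : (n - n.-1 = 1)%N) ?mulr1; last by lia.
  by rewrite char_poly_trace // raddfN opprK.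
rewrite coefZ coefXn; case: eqP => [E|]; last by rewrite mulr0.
by case/eqP: kn; apply: val_inj => /=; lia.
Qed.

End PolynomialIdentities.

(** * Connectedness and Lie algebras of the groups of masked matrices *)

Section MaskedGroups.
Variables (F : numFieldType) (n : nat) (i0 : 'I_n) (sl : bool) (P : 'M[F]_n).
Hypothesis uP : P \in unitmx.
Local Notation cj := (Ad (invmx P)).
Implicit Types (e : rel 'I_n) (g X : 'M[F]_n).

(** [sl] selects the special linear group. *)
Definition grp : set 'M[F]_n := [set g | g \in unitmx /\ (sl -> \det g = 1)].

Definition mgroup e : set 'M[F]_n := [set g | grp g /\ masked e (cj g)].

Let uPV : invmx P \in unitmx. Proof. by rewrite unitmx_inv. Qed.

Lemma grp_subgroup : subgroup grp.
Proof.
split.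
- by move=> g [].
- by split; rewrite ?unitmx1 ?det1.
- by move=> a b [ua da] [ub db]; split=> [|s]; rewrite ?unitmx_mul ?ua // det_mulmx da // db // mulr1.
- by move=> a [ua da]; split=> [|s]; rewrite ?unitmx_inv // det_inv da // invr1.
Qed.

Lemma mgroup_subgroup e : reflexive e -> transitive e -> subgroup (mgroup e).
Proof.
move=> re te; have [G1 G2 G3 G4] := grp_subgroup; split.
- by move=> g [[]].
- by split=> //; rewrite Ad1 //; apply: masked1.
- by move=> a b [Ga ea] [Gb eb]; split; [apply: G3|rewrite AdM //; apply: maskedM].
- move=> a [Ga ea]; have ua := G1 _ Ga; split; first exact: G4.
  by rewrite Ad_inv //; apply: masked_inv; rewrite ?Ad_unit.
Qed.

Definition affine_closed (Z : set 'M[F]_n) := zclosed (Z : set (affine_mx F n n)).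

Lemma zeros_closed (I : set ('M[F]_n -> F)) : (forall f, I f -> polyf f) ->
  affine_closed [set A | forall f, I f -> f A = 0].
Proof.
move=> pI; exists [set q | exists2 f, I f & forall A, f A = peval q A].
rewrite predeqE => A; split=> [/existsNP[f /not_implyP[If /eqP fA]]|[q [f If fE] qA] fI].
  by have [q qE] := pI _ If; exists q; rewrite -?qE //; exists f.
by move: qA; rewrite -fE fI // eqxx.
Qed.

Lemma mgroup_closed e : exists2 Z, affine_closed Z & mgroup e = grp `&` Z.
Proof.
exists [set A | forall f, [set f | exists i j, ~~ e i j /\ f = fun A => cj A i j] f -> f A = 0].
  apply: zeros_closed => _ [i [j [_ ->]]].
  exact: polymap_Ad polymap_id i j.
rewrite predeqE => A; split=> [[GA eA]|[GA eA]]; split=> //.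
  by move=> _ [i [j [eij ->]]]; apply: eA.
by move=> i j eij; apply: (eA (fun A => cj A i j)); exists i, j.
Qed.

(** Two nonempty open sets contain points g and h. On a curve from g to h a polynomial defining
    either set is nonzero at one end, so some parameter avoids the zeros of both and of the
    denominator, and gives a common point. *)
Lemma curve_connected (K : set 'M[F]_n) :
  (forall g h, K g -> K h -> exists (a : 'M[{poly F}]_n) (q : {poly F}),
     [/\ q.[0] != 0, q.[1] != 0, q.[0]^-1 *: evmx a 0 = g, q.[1]^-1 *: evmx a 1 = h
       & forall t, q.[t] != 0 -> K (q.[t]^-1 *: evmx a t)]) ->
  zconnected (@induced F (affine_mx F n n) K).
Proof.
move=> Kc U V [_ [I ->] UE] [_ [J ->] VE] _ [g Ug] [h Vh].
move: Ug Vh; rewrite UE VE => -[p Ip pg] [r Jr rh].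
have [a [q [q0 q1 ag ah aK]]] := Kc _ _ (set_valP g) (set_valP h).
have [N [p' [pE _]]] := peval_curve p a q.
have [N' [r' [rE _]]] := peval_curve r a q.
have [t] : exists t, (q * p' * r').[t] != 0.
  apply: poly_nonroot; rewrite !mulf_neq0 //.
  - by apply: contraNneq q0 => ->; rewrite horner0.
  - apply: contra_eq_neq (pE _ q0) => ->; rewrite horner0 eq_sym ag.
    by rewrite mulf_neq0 // expf_neq0.
  - apply: contra_eq_neq (rE _ q1) => ->; rewrite horner0 eq_sym ah.
    by rewrite mulf_neq0 // expf_neq0.
rewrite !hornerM !mulf_eq0 !negb_or -andbA => /and3P[qt pt rt].
exists (SigSub (mem_set (aK _ qt))); split=> /=.
  by exists p => //; move: pt; rewrite pE // mulf_eq0 negb_or => /andP[].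
by exists r => //; move: rt; rewrite rE // mulf_eq0 negb_or => /andP[].
Qed.

(** Rescaling one basis vector by the inverse of the determinant pushes a curve
    of invertible matrices into the special linear group. *)
Lemma mgroup_curve e (x : 'M[{poly F}]_n) : reflexive e -> transitive e ->
  (forall t, masked e (cj (evmx x t))) ->
  let q := \det x in
  exists a : 'M[{poly F}]_n,
  [/\ forall t, q.[t] != 0 -> mgroup e (q.[t]^-1 *: evmx a t),
      forall t, q.[t] != 0 -> (sl -> q.[t] = 1) -> q.[t]^-1 *: evmx a t = evmx x t
    & evmx x 0 = 1%:M -> (sl -> q^`().[0] = 0) ->
      evmx (dermx a) 0 - q^`().[0] *: evmx a 0 = evmx (dermx x) 0].
Proof.
move=> re te xe q.
(* Divided by q, this diagonal is the rescaling by 1/q at [i0] when [sl] holds and the identity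
   otherwise; the factor q keeps the entries polynomial. *)
pose d : 'rV[{poly F}]_n := \row_j (if sl && (j == i0) then 1 else q).
pose C := map_mx polyC P *m diag_mx d *m map_mx polyC (invmx P).
have evC t : evmx C t = Ad P (diag_mx (\row_j (if sl && (j == i0) then 1 else q.[t]))).
  rewrite /C /Ad !evmxM; congr (_ *m _ *m _); apply/matrixP => i j.
  - by rewrite evmxE mxE hornerC.
  - rewrite evmxE !mxE; case: (i == j); rewrite ?mulr1n ?mulr0n ?horner0 //.
    by case: ifP => _; rewrite ?hornerC.
  - by rewrite evmxE mxE hornerC.
have evC1 t : q.[t] = 1 -> evmx C t = 1%:M.
  move=> qt; rewrite evC -(Ad1 uP); congr (Ad P _); apply/matrixP => i j.
  by rewrite !mxE qt if_same.
exists (x *m C); split=> [t qt|t qt sq|x0 sq].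
- pose D : 'M[F]_n := diag_mx (\row_j (if sl && (j == i0) then q.[t]^-1 else 1)).
  have E : q.[t]^-1 *: evmx (x *m C) t = evmx x t *m Ad P D.
    rewrite evmxM evC scalemxAr -AdZ; congr (_ *m Ad P _).
    apply/matrixP => i j; rewrite !mxE; case: (i == j); rewrite ?mulr1n ?mulr0n ?mulr0 //.
    by case: ifP => _; rewrite ?mulr1 ?mulVf.
  have dE : \det (evmx x t *m Ad P D) = if sl then 1 else q.[t].
    rewrite det_mulmx Ad_det // evmx_det -/q det_diag.
    case: (boolP sl) => [s|/negPf s]; last first.
      by rewrite big1 ?mulr1 // => i _; rewrite mxE.
    rewrite (bigD1 i0) //= mxE eqxx big1 ?mulr1 ?mulfV // => i /negPf ii.
    by rewrite mxE ii.
  rewrite E; split.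
    split; last by move=> s; rewrite dE s.
    by rewrite unitmxE unitfE dE; case: sl; rewrite ?oner_eq0.
  rewrite AdM // AdK //; apply: maskedM => // i j eij; rewrite !mxE.
  by case: (eqVneq i j) eij => [->|_ _]; rewrite ?re ?mulr0n.
- rewrite evmxM; case: (boolP sl) => s; first by rewrite evC1 ?sq // invr1 scale1r mulmx1.
  rewrite evC scalemxAr -AdZ (_ : _ *: _ = 1%:M) ?Ad1 ?mulmx1 //.
  by apply/matrixP => i j; rewrite !mxE (negPf s) /=; case: (i == j); rewrite ?mulr1n ?mulr0n ?mulVf ?mulr0.
have q0 : q.[0] = 1 by rewrite /q -evmx_det x0 det1.
rewrite -[evmx (dermx _) 0]/(evmx (dermx (x *m C)) 0) dermxM.
have -> : evmx (dermx x *m C + x *m dermx C) 0 =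
  evmx (dermx x) 0 *m evmx C 0 + evmx x 0 *m evmx (dermx C) 0.
  by rewrite -!evmxM; apply/matrixP => i j; rewrite !evmxE !mxE hornerD.
rewrite evmxM !evC1 // x0 mulmx1 !mul1mx -addrA; set Y := _ - _.
suff -> : Y = 0 by rewrite addr0.
rewrite /Y {Y}.
have -> : dermx C = map_mx polyC P *m dermx (diag_mx d) *m map_mx polyC (invmx P).
  have dC (A : 'M[F]_n) : dermx (map_mx polyC A) = 0.
    by apply/matrixP => i j; rewrite !mxE derivC.
  by rewrite /C !dermxM !dC mul0mx mulmx0 add0r addr0.
rewrite !evmxM.
have evP (A : 'M[F]_n) : evmx (map_mx polyC A) 0 = A.
  by apply/matrixP => i j; rewrite evmxE mxE hornerC.
rewrite !evP -[X in X - _]/(Ad P (evmx (dermx (diag_mx d)) 0)).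
rewrite -(Ad1 uP) -AdZ -AdB.
suff -> : evmx (dermx (diag_mx d)) 0 - q^`().[0] *: 1%:M = 0 by rewrite Ad0.
apply/matrixP => i j; rewrite !mxE /horner_eval.
case: (i == j); rewrite ?mulr1n ?mulr0n ?mulr0 ?mulr1; last by rewrite -polyC0 derivC horner0 subrr.
case: ifP => [/andP[s _]|_]; last by rewrite subrr.
by rewrite sq // -polyC1 derivC horner0 subrr.
Qed.

Lemma mgroup_connected e : reflexive e -> transitive e ->
  zconnected (@induced F (affine_mx F n n) (mgroup e)).
Proof.
move=> re te; apply: curve_connected => g h Kg Kh.
have [[ug sg] eg] := Kg; have [[uh sh] eh] := Kh.
have xe t : masked e (cj (evmx (line g (h - g)) t)).
  rewrite evmx_line AdD AdZ AdB; apply: maskedD => //; apply: maskedZ.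
  by apply: maskedD => //; apply: maskedN.
have [a [aK aE _]] := mgroup_curve re te xe.
exists a, (\det (line g (h - g))).
have q0 : (\det (line g (h - g))).[0] = \det g by rewrite -evmx_det evmx_line scale0r addr0.
have q1 : (\det (line g (h - g))).[1] = \det h.
  by rewrite -evmx_det evmx_line scale1r addrC subrK.
have n0 : (\det (line g (h - g))).[0] != 0 by rewrite q0 -unitfE -unitmxE.
have n1 : (\det (line g (h - g))).[1] != 0 by rewrite q1 -unitfE -unitmxE.
split=> //; rewrite aE // ?q0 ?q1 // evmx_line ?scale0r ?addr0 //.
by rewrite scale1r addrC subrK.
Qed.

Lemma mgroup_cc e : reflexive e -> transitive e -> closed_connected_subgroup grp (mgroup e).
Proof.
move=> re te; split; [exact: mgroup_subgroup|by move=> g []|exact: mgroup_closed|].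
exact: mgroup_connected.
Qed.

Lemma lie_tangent (K : set 'M[F]_n) X (p : {mpoly F[(n * n)%N]}) (r : {poly F}) :
  lie_algebra K X -> (forall g, K g -> peval p g = 0) ->
  (forall t, r.[t] = peval p (1%:M + t *: X)) -> r^`().[0] = 0.
Proof.
move=> KX Kp rE; have [N [r' [r'E dr']]] := peval_curve p (line 1%:M X) 1.
have -> : r = r'.
  apply: poly_ext => t; rewrite rE r'E hornerC ?oner_eq0 //.
  by rewrite expr1n mul1r invr1 scale1r evmx_line.
rewrite dr' ?hornerC // -polyC1 derivC horner0 mulr0 mul0r add0r scale0r subr0.
rewrite -/(dermx _) dermx_line evmx_line scale0r addr0 -[RHS](KX p Kp).
apply: eq_bigr => i _; congr (_ * mxvec _ _ _).
by apply/matrixP => k l; rewrite evmxE mxE hornerC.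
Qed.

Lemma lie_mgroup e X : reflexive e -> transitive e ->
  lie_algebra (mgroup e) X <-> masked e (cj X) /\ (sl -> \tr X = 0).
Proof.
have n0 : (0 < n)%N by apply: leq_ltn_trans (ltn_ord i0).
move=> re te; split=> [KX|[eX sX] p Kp].
  split=> [i j eij|s].
    have [p pE] : polyf (fun A => cj A i j) by apply: polymap_Ad polymap_id i j.
    have := @lie_tangent _ X p (cj X i j *: 'X) KX.
    rewrite derivZ derivX hornerZ hornerC mulr1; apply=> [g [_ eg]|t].
      by rewrite -pE eg.
    rewrite -pE AdD AdZ Ad1 // !mxE hornerZ hornerX mulrC.
    by case: eqP eij => [->|_]; rewrite ?re // add0r.
  have [p pE] : polyf (fun A : 'M[F]_n => \det A - 1).
    by apply: polyfB; [apply: polyf_det polymap_id|apply: polyfC].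
  have := @lie_tangent _ X p (\det (line 1%:M X) - 1) KX.
  rewrite derivB -polyC1 derivC subr0 deriv_det1 //; apply=> [g [[_ dg] _]|t].
    by rewrite -pE dg // subrr.
  by rewrite -pE hornerD hornerN hornerC -evmx_det evmx_line.
have xe t : masked e (cj (evmx (line 1%:M X) t)).
  by rewrite evmx_line AdD AdZ Ad1 //; apply: maskedD; [apply: masked1|apply: maskedZ].
have x0 : evmx (line 1%:M X) 0 = 1%:M by rewrite evmx_line scale0r addr0.
have [a [aK aE da]] := mgroup_curve re te xe.
have q0 : (\det (line 1%:M X)).[0] = 1 by rewrite -evmx_det x0 det1.
have [N [r [rE dr]]] := peval_curve p a (\det (line 1%:M X)).
have r0 : r = 0.
  apply: (@mulIf _ (\det (line 1%:M X))).
    by apply: contra_eq_neq q0 => ->; rewrite horner0 eq_sym oner_eq0.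
  apply: poly_ext => t; rewrite mul0r horner0 hornerM.
  have [->|qt] := eqVneq (\det (line 1%:M X)).[t] 0; first by rewrite mulr0.
  by rewrite rE // Kp ?mulr0 ?mul0r //; apply: aK.
have a0 : evmx a 0 = 1%:M.
  by have := aE 0; rewrite q0 invr1 scale1r x0; apply => //; rewrite oner_eq0.
have [_ G1 _ _] := mgroup_subgroup re te.
have := dr q0; rewrite r0 -polyC0 derivC horner0 -/(dermx _) da // => [|s]; last first.
  by rewrite deriv_det1 // sX.
rewrite a0 Kp // mulr0 add0r dermx_line => /esym dp; rewrite -[RHS]dp.
apply: eq_bigr => i _; congr (_ * mxvec _ _ _).
by apply/matrixP => k l; rewrite evmxE mxE hornerC.
Qed.

End MaskedGroups.

(** * Triangular and monomial matrices *)

Section Triangular.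
Variables (F : fieldType) (n : nat).
Implicit Types (A B u v : 'M[F]_n) (p : {perm 'I_n}) (t : 'I_n -> F).

Definition up : rel 'I_n := fun i j => (i <= j)%N.

Lemma up_refl : reflexive up. Proof. by move=> i; apply: leqnn. Qed.
Lemma up_trans : transitive up. Proof. by move=> j i k; apply: leq_trans. Qed.
Local Hint Resolve up_refl up_trans : core.

(** The filtration by superdiagonals. Levels add under products ([levM]), which drives both
    nilpotency and the length of the derived series. *)
Definition lev k A := forall i j : 'I_n, (j < i + k)%N -> A i j = 0.

Lemma lev0 A : lev 0 A <-> masked up A.
Proof.
by split=> uA i j ij; apply: uA; move: ij; rewrite /up -ltnNge addn0.
Qed.

Lemma levW k l A : (k <= l)%N -> lev l A -> lev k A.
Proof. by move=> kl lA i j ij; apply: lA; apply: leq_trans ij _; rewrite leq_add2l. Qed.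

Lemma levM k l A B : lev k A -> lev l B -> lev (k + l) (A *m B).
Proof.
move=> kA lB i j ij; rewrite mxE big1 // => m _.
have [mi|im] := ltnP m (i + k); first by rewrite kA // mul0r.
by rewrite lB ?mulr0 //; apply: leq_trans ij _; rewrite addnA leq_add2r.
Qed.

Lemma levD k A B : lev k A -> lev k B -> lev k (A + B).
Proof. by move=> kA kB i j ij; rewrite mxE kA // kB // addr0. Qed.

Lemma levN k A : lev k A -> lev k (- A).
Proof. by move=> kA i j ij; rewrite mxE kA // oppr0. Qed.

Lemma levZ k a A : lev k A -> lev k (a *: A).
Proof. by move=> kA i j ij; rewrite mxE kA // mulr0. Qed.

Lemma lev_eq0 k A : (n <= k)%N -> lev k A -> A = 0.
Proof.
move=> nk kA; apply/matrixP => i j; rewrite mxE kA //.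
by apply: leq_trans (ltn_ord j) _; apply: leq_trans nk _; rewrite leq_addl.
Qed.

Lemma det_up A : masked up A -> \det A = \prod_i A i i.
Proof.
move=> uA; rewrite -det_tr det_trig; first by apply: eq_bigr => i _; rewrite mxE.
by apply/is_trig_mxP => i j ij; rewrite mxE uA // /up -ltnNge.
Qed.

Lemma up_unit A : masked up A -> (A \in unitmx) = [forall i, A i i != 0].
Proof.
move=> uA; rewrite unitmxE unitfE det_up //.
apply/idP/forallP => [|A0]; last exact/prodf_neq0.
by move=> /prodf_neq0 A0 i; apply: A0.
Qed.

Lemma mulmx_up_diag A B i : masked up A -> masked up B -> (A *m B) i i = A i i * B i i.
Proof.
move=> uA uB; rewrite mxE (bigD1 i) //= big1 ?addr0 // => k ki.
have [/uA->|] := boolP (~~ up i k); first by rewrite mul0r.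
rewrite negbK /up => ik; rewrite uB ?mulr0 // /up -ltnNge ltn_neqAle ik andbT.
by rewrite eq_sym.
Qed.

Definition unitri A := lev 1 (A - 1%:M).

Lemma unitriP A : unitri A <-> masked up A /\ forall i, A i i = 1.
Proof.
split=> [uA|[uA A1] i j].
  split=> [i j|i].
    rewrite /up -ltnNge => ji; have := uA i j; rewrite !mxE -val_eqE /= gtn_eqF // subr0.
    by apply; rewrite addn1 ltnS ltnW.
  have := uA i i; rewrite !mxE eqxx addn1 => /(_ (ltnSn _)) /eqP.
  by rewrite subr_eq0 => /eqP.
rewrite addn1 ltnS leq_eqVlt => /orP[/eqP/val_inj->|ji].
  by rewrite !mxE A1 eqxx subrr.
by rewrite !mxE uA -?val_eqE /= ?gtn_eqF ?subr0 // /up -ltnNge.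
Qed.

Lemma unitri_det A : unitri A -> \det A = 1.
Proof. by move=> /unitriP[uA A1]; rewrite det_up // big1. Qed.

Lemma unitri_unit A : unitri A -> A \in unitmx.
Proof. by move=> uA; rewrite unitmxE unitri_det // unitr1. Qed.

Lemma lev_inv k A : (0 < k)%N -> lev k (A - 1%:M) -> lev k (invmx A - 1%:M).
Proof.
move=> k0 kA; have uA : unitri A by apply: levW kA.
have nA := unitri_unit uA.
have -> : invmx A - 1%:M = - (invmx A *m (A - 1%:M)).
  by rewrite mulmxBr mulVmx // mulmx1 opprB.
apply: levN; rewrite -[k]add0n; apply: levM => //; apply/lev0.
by apply: masked_inv => //; case/unitriP: uA.
Qed.

Lemma unitri_inv A : unitri A -> unitri (invmx A).
Proof. exact: lev_inv. Qed.

Lemma lev_mul1 k A B : (0 < k)%N -> lev k (A - 1%:M) -> lev k (B - 1%:M) -> lev k (A *m B - 1%:M).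
Proof.
move=> k0 kA kB.
have -> : A *m B - 1%:M = (A - 1%:M) + A *m (B - 1%:M).
  by rewrite mulmxBr mulmx1 [RHS]addrC addrA subrK.
apply: levD => //; rewrite -[k]add0n; apply: levM => //; apply/lev0.
by have /unitriP[] : unitri A by apply: levW kA.
Qed.

Lemma unitriM A B : unitri A -> unitri B -> unitri (A *m B).
Proof. exact: lev_mul1. Qed.

Definition mono p t : 'M[F]_n := \matrix_(i, j) if i == p j then t j else 0.

Lemma mul_mx_mono m (A : 'M[F]_(m, n)) p t i j : (A *m mono p t) i j = A i (p j) * t j.
Proof.
rewrite mxE (bigD1 (p j)) //= mxE eqxx big1 ?addr0 // => k kj.
by rewrite mxE (negPf kj) mulr0.
Qed.

Lemma mul_mono_mx m (A : 'M[F]_(n, m)) p t i j : (mono p t *m A) (p i) j = t i * A i j.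
Proof.
rewrite mxE (bigD1 i) //= mxE eqxx big1 ?addr0 // => k ki.
by rewrite mxE (inj_eq perm_inj) eq_sym (negPf ki) mul0r.
Qed.

(** Permutations compose from left to right and matrices from right to left, whence [(q * p)%g]. *)
Lemma mono_mul p t q r : mono p t *m mono q r = mono (q * p)%g (fun j => t (q j) * r j).
Proof.
apply/matrixP => i j; rewrite mul_mx_mono !mxE permM.
by case: eqP; rewrite ?mul0r.
Qed.

Lemma mono1 : mono 1%g (fun=> 1) = 1%:M.
Proof. by apply/matrixP => i j; rewrite !mxE perm1; case: eqP. Qed.

Lemma mono_unit p t : (forall j, t j != 0) -> mono p t \in unitmx.
Proof.
move=> t0; have /mulmx1_unit[] // :
  mono p t *m mono (p^-1)%g (fun j => (t ((p^-1)%g j))^-1) = 1%:M.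
by rewrite mono_mul mulVg -mono1; apply/matrixP => i j; rewrite !mxE mulfV.
Qed.

Lemma mono_inv p t : (forall j, t j != 0) ->
  invmx (mono p t) = mono (p^-1)%g (fun j => (t ((p^-1)%g j))^-1).
Proof.
move=> t0; apply: (@row_full_inj _ _ _ _ (mono p t)); first by rewrite row_full_unit mono_unit.
rewrite mulmxV ?mono_unit // mono_mul mulVg -mono1.
by apply/matrixP => i j; rewrite !mxE mulfV.
Qed.

Lemma mono_det_neq0 p t : mono p t \in unitmx -> forall j, t j != 0.
Proof.
move=> um j; apply: contraTneq um => tj.
rewrite unitmxE (expand_det_col _ j) big1 ?unitr0 // => k _.
by rewrite mxE tj if_same mul0r.
Qed.

Lemma Ad_mono p t A i j : (forall j, t j != 0) ->
  Ad (invmx (mono p t)) A i j = (t i)^-1 * A (p i) (p j) * t j.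
Proof.
move=> t0; rewrite /Ad invmxK mul_mx_mono mono_inv //.
by rewrite -{1}[ i](permK p) mul_mono_mx permK.
Qed.

(** Among the vectors [A c] with [c] equal to [e_j] modulo earlier basis vectors,
    one whose last nonzero coordinate comes first; these positions are distinct
    for distinct [j]. *)
Lemma bruhat_exists A : A \in unitmx ->
  exists p t b1 b2, [/\ forall j, t j != 0, unitri b1, unitri b2 & A = b1 *m mono p t *m b2].
Proof.
move=> uA.
pose shape (j : 'I_n) (c : 'cV[F]_n) := c j 0 = 1 /\ forall k : 'I_n, (j < k)%N -> c k 0 = 0.
have shape_neq0 j c : shape j c -> A *m c != 0.
  move=> [cj _]; apply/eqP => Ac; have : c = 0 by rewrite -(mulKmx uA c) Ac mulmx0.
  by move=> c0; move/eqP: cj; rewrite c0 mxE eq_sym oner_eq0.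
have minpos (j : 'I_n) : exists pc : 'I_n * 'cV[F]_n,
    [/\ shape j pc.2, forall i : 'I_n, (pc.1 < i)%N -> (A *m pc.2) i 0 = 0, (A *m pc.2) pc.1 0 != 0
      & forall c', shape j c' -> exists2 i : 'I_n, (pc.1 <= i)%N & (A *m c') i 0 != 0].
  pose Q m := `[< exists2 c, shape j c & forall i : 'I_n, (m <= i)%N -> (A *m c) i 0 = 0 >].
  have exQ : exists m, Q m.
    exists n; apply/asboolP; exists (delta_mx j 0).
      by split=> [|k jk]; rewrite mxE ?eqxx // andbT -val_eqE gtn_eqF.
    by move=> i; rewrite leqNgt ltn_ord.
  case: (ex_minnP exQ) => m /asboolP[c cj cm] mmin.
  have m0 : (0 < m)%N.
    rewrite lt0n; apply: contra_neq (shape_neq0 _ _ cj) => m0.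
    by apply/matrixP => i k; rewrite ord1 cm ?m0 // mxE.
  have minm c' : shape j c' -> exists2 i : 'I_n, (m.-1 <= i)%N & (A *m c') i 0 != 0.
    move=> sc'; apply: contrapT => nex; have : (m <= m.-1)%N.
      apply: mmin; apply/asboolP; exists c' => // i mi; apply: contrapT => /eqP ci.
      by apply: nex; exists i.
    by rewrite leqNgt prednK // leqnn.
  have [i mi ci] := minm _ cj.
  have ii : i = m.-1 :> nat.
    apply/eqP; rewrite eqn_leq mi andbT -ltnS prednK // ltnNge.
    by apply: contra ci => /cm->.
  exists (i, c); split=> //=; last by rewrite ii.
  by move=> k; rewrite ii prednK // => mk; apply: cm.
have [f fP] := choice minpos.
(* If j < k shared their last position, subtracting a multiple of the vector of j from that of k
   would keep the shape k and move the last nonzero coordinate earlier, against minimality. *)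
have finj : injective (fun j => (f j).1).
  move=> j k; wlog jk : j k / (j < k)%N.
    move=> wl jk; have [jk'|jk'|/val_inj//] := ltngtP j k; first exact: wl.
    by apply/esym; apply: wl.
  move=> /= E; have [sj ltj nj _] := fP j; have [sk ltk nk mk] := fP k.
  pose c := (f k).2 - ((A *m (f k).2) (f k).1 0 / (A *m (f j).2) (f j).1 0) *: (f j).2.
  have [|i ki] := mk c.
    split=> [|l kl]; rewrite !mxE.
      by rewrite sk.1 sj.2 // mulr0 subr0.
    by rewrite sk.2 // sj.2 ?mulr0 ?subr0 // (ltn_trans jk).
  rewrite /c mulmxBr -scalemxAr mxE [X in _ + X]mxE [X in _ - X]mxE.
  move: ki; rewrite leq_eqVlt => /orP[/eqP/val_inj<-|ki].
    by rewrite E divfK ?subrr ?eqxx // -E.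
  by rewrite (ltk i ki) (ltj i) ?E // mulr0 subr0 eqxx.
pose p := perm finj; pose b := \matrix_(i, j) (f j).2 i 0.
have Ab i j : (A *m b) i j = (A *m (f j).2) i 0.
  by rewrite !mxE; apply: eq_bigr => k _; rewrite mxE.
have ub : unitri b.
  apply/unitriP; split=> [i j|i]; rewrite mxE; have [[s1 s2] _ _ _] := fP i.
    by rewrite /up -ltnNge => ji; have [[_ s3] _ _ _] := fP j; apply: s3.
  by [].
pose t j := (A *m (f j).2) (p j) 0.
have t0 j : t j != 0 by rewrite /t permE; have [] := fP j.
(* The columns of [A b], moved to their last positions and scaled to have 1 there. *)
pose b1 := \matrix_(i, k) ((A *m b) i ((p^-1)%g k) / t ((p^-1)%g k)).
exists p, t, b1, (invmx b); split=> //; last 2 first.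
- exact: unitri_inv.
- apply: (canRL (mulmxK (unitri_unit ub))); apply/matrixP => i j.
  by rewrite mul_mx_mono [b1 _ _]mxE permK divfK.
apply/unitriP; split=> [i k|i]; rewrite mxE.
  rewrite /up -ltnNge => ki; rewrite Ab; have [_ l _ _] := fP ((p^-1)%g k).
  have E : (f ((p^-1)%g k)).1 = k by rewrite -[RHS](permKV p) [RHS]permE.
  by rewrite l ?mul0r // E.
by have := t0 ((p^-1)%g i); rewrite Ab /t permKV => ?; rewrite divff.
Qed.

(** Without inversions both [p] and its inverse are strictly increasing, hence both satisfy j <= q
    j; together these bounds force the identity. *)
Lemma perm_inversion p : p <> 1%g -> exists i j : 'I_n, (i < j)%N /\ (p j < p i)%N.
Proof.
move=> p1; apply: contrapT => nex; apply: p1; apply/permP => i; rewrite perm1.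
have pmono (j k : 'I_n) : (j < k)%N -> (p j < p k)%N.
  move=> jk; rewrite ltnNge leq_eqVlt; apply/negP => /orP[/eqP/val_inj/perm_inj E|kj].
    by rewrite E ltnn in jk.
  by apply: nex; exists j, k.
have ge (q : {perm 'I_n}) : (forall j k : 'I_n, (j < k)%N -> (q j < q k)%N) ->
    forall m (j : 'I_n), val j = m -> (m <= q j)%N.
  move=> qm; elim=> // m IHm j jm.
  have mn : (m < n)%N by rewrite -ltnS -jm ltnS ltnW ?ltn_ord.
  by apply: leq_ltn_trans (IHm (Ordinal mn) erefl) _; apply: qm; rewrite /= jm.
apply/eqP; rewrite -val_eqE eqn_leq ge // andbT /=.
rewrite -{2}[ i](permK p).
apply: (ge (p^-1)%g) => // j k jk; rewrite ltnNge; apply/negP => kj.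
move: kj; rewrite leq_eqVlt => /orP[/eqP/val_inj/perm_inj E|/pmono].
  by rewrite E ltnn in jk.
by rewrite !permKV ltnNge (ltnW jk).
Qed.

End Triangular.

#[export] Hint Resolve up_refl up_trans : core.

(** * Borel subgroups *)

Section DerivedGroups.
Variables (F : fieldType) (n : nat).
Implicit Types K S : set 'M[F]_n.

Lemma gen_subgroup_min (A S : set 'M[F]_n) : subgroup S -> A `<=` S -> gen_subgroup A `<=` S.
Proof. by move=> sS AS g; apply. Qed.

Lemma sub_gen_subgroup (A : set 'M[F]_n) : A `<=` gen_subgroup A.
Proof. by move=> g Ag K _; apply. Qed.

(** [S] makes the intersection run over a nonempty family, so that its elements are invertible. *)
Lemma gen_subgroup_is_subgroup (A S : set 'M[F]_n) :
  subgroup S -> A `<=` S -> subgroup (gen_subgroup A).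
Proof.
move=> sS AS; split.
- by apply: subset_trans (gen_subgroup_min sS AS) _; case: sS.
- by move=> K [_ K1 _ _].
- by move=> a b ga gb K sK AK; have [_ _ + _] := sK; apply; [apply: ga|apply: gb].
- by move=> a ga K sK AK; have [_ _ _] := sK; apply; apply: ga.
Qed.

Lemma commutators_sub K : subgroup K ->
  [set c | exists a b, [/\ K a, K b & c = a *m b *m invmx a *m invmx b]] `<=` K.
Proof.
by move=> [_ _ KM KV] _ [a [b [Ka Kb ->]]]; apply: (KM _ _ (KM _ _ (KM _ _ Ka Kb) (KV _ Ka)) (KV _ Kb)).
Qed.

Lemma derived_subgroup K : subgroup K -> subgroup (derived_group K).
Proof. by move=> sK; apply: gen_subgroup_is_subgroup (commutators_sub sK). Qed.

Lemma derived_min K S : subgroup S ->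
  (forall a b, K a -> K b -> S (a *m b *m invmx a *m invmx b)) -> derived_group K `<=` S.
Proof. by move=> sS KS; apply: gen_subgroup_min => // _ [a [b [Ka Kb ->]]]; apply: KS. Qed.

Lemma iter_derived_subgroup K m : subgroup K -> subgroup (iter m (@derived_group F n) K).
Proof. by move=> sK; elim: m => //= m; apply: derived_subgroup. Qed.

End DerivedGroups.

(** * A copy of SL_2 on two basis vectors *)

Section SL2.
Variables (F : numFieldType) (n : nat) (P : 'M[F]_n) (k l : 'I_n).
Hypotheses (uP : P \in unitmx) (kl : k != l).

Definition mx2 (a b c d : F) : 'M[F]_2 :=
  \matrix_(i, j) if i == 0 then (if j == 0 then a else b) else (if j == 0 then c else d).

Lemma mx2M a b c d a' b' c' d' : mx2 a b c d *m mx2 a' b' c' d' =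
  mx2 (a * a' + b * c') (a * b' + b * d') (c * a' + d * c') (c * b' + d * d').
Proof.
apply/matrixP => i j; rewrite !mxE !big_ord_recl big_ord0 !mxE /= addr0.
by case: ifP; case: ifP.
Qed.

Lemma mx2_1 : mx2 1 0 0 1 = 1%:M.
Proof. by apply/matrixP => -[[|[|]] // ?] [[|[|]] // ?]; rewrite !mxE. Qed.

Let R : 'M[F]_(n, 2) := \matrix_(i, j) (i == if j == 0 then k else l)%:R.

Let RR : R^T *m R = 1%:M.
Proof.
apply/matrixP => i j; rewrite !mxE (bigD1 (if i == 0 then k else l)) //= !mxE eqxx mul1r.
rewrite big1 ?addr0 => [|m /negPf mi]; last by rewrite !mxE mi mul0r.
case: i j => [[|[|]] // ?] [[|[|]] // ?] /=; rewrite ?eqxx //; last by rewrite eq_sym (negPf kl).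
by rewrite (negPf kl).
Qed.

(** In the basis [P], [S] acts on the plane of the vectors [k] and [l] and the other basis vectors
    are fixed. In this form multiplicativity reduces to the identity [RR]. *)
Definition emb2 (S : 'M[F]_2) : 'M[F]_n := Ad P (1%:M + R *m (S - 1%:M) *m R^T).

Lemma emb2M S T : emb2 (S *m T) = emb2 S *m emb2 T.
Proof.
rewrite /emb2 -AdM //; congr (Ad P _); set U := S - 1%:M; set V := T - 1%:M.
have -> : S *m T - 1%:M = U *m V + (U + V).
  rewrite /U /V mulmxBl mul1mx mulmxBr mulmx1.
  by apply/matrixP => i j; rewrite !mxE; ring.
have -> : R *m (U *m V + (U + V)) *m R^T =
    R *m U *m R^T *m (R *m V *m R^T) + (R *m U *m R^T + R *m V *m R^T).
  rewrite 2!mulmxDr 2!mulmxDl; congr (_ + _).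
  by rewrite !mulmxA -[R *m U *m R^T *m R]mulmxA RR mulmx1.
move: (R *m U *m R^T) (R *m V *m R^T) => X Y.
rewrite mulmxDl mul1mx mulmxDr mulmx1.
by apply/matrixP => i j; rewrite !mxE; ring.
Qed.

Lemma emb2_1 : emb2 1%:M = 1%:M.
Proof. by rewrite /emb2 subrr mulmx0 mul0mx addr0 Ad1. Qed.

Lemma emb2V S T : S *m T = 1%:M -> invmx (emb2 S) = emb2 T.
Proof.
move=> ST; have E : emb2 S *m emb2 T = 1%:M by rewrite -emb2M ST emb2_1.
have [uS _] := mulmx1_unit E.
by rewrite -[RHS](mulKmx uS) E mulmx1.
Qed.

Lemma emb2_up a : emb2 (mx2 1 a 0 1) = Ad P (1%:M + a *: delta_mx k l).
Proof.
congr (Ad P (_ + _)); apply/matrixP => i j; rewrite -mx2_1.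
rewrite !mxE !big_ord_recl big_ord0 !mxE !big_ord_recl !big_ord0 !mxE /= !subrr.
by rewrite !(mulr0, mul0r, addr0, add0r, subr0) -mulnb natrM; ring.
Qed.

Lemma emb2_low a : emb2 (mx2 1 0 a 1) = Ad P (1%:M + a *: delta_mx l k).
Proof.
congr (Ad P (_ + _)); apply/matrixP => i j; rewrite -mx2_1.
rewrite !mxE !big_ord_recl big_ord0 !mxE !big_ord_recl !big_ord0 !mxE /= !subrr.
by rewrite !(mulr0, mul0r, addr0, add0r, subr0) -mulnb natrM; ring.
Qed.

(** The special linear group of rank one is perfect. *)
Lemma sl2_not_solvable (K : set 'M[F]_n) : subgroup K ->
  (forall a, K (emb2 (mx2 1 a 0 1))) -> (forall a, K (emb2 (mx2 1 0 a 1))) ->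
  ~ solvable_group K.
Proof.
move=> sK Ku Kl [m Km].
suff [Ku' _] : (forall a, iter m (@derived_group F n) K (emb2 (mx2 1 a 0 1))) /\
  (forall a, iter m (@derived_group F n) K (emb2 (mx2 1 0 a 1))).
  have := Ku' 1; rewrite Km emb2_up scale1r => /(congr1 (Ad (invmx P))).
  rewrite AdK // Ad1 ?unitmx_inv // => /matrixP/(_ k l); rewrite !mxE (negPf kl) !eqxx add0r.
  by apply/eqP; rewrite oner_eq0.
elim: m {Km} => [|m [IHu IHl]] //.
set D := iter m _ K in IHu IHl; rewrite iterS -/D.
have sD : subgroup D by apply: iter_derived_subgroup.
(* The commutator of diag(2, 1/2) with a transvection multiplies the parameter by 4 - 1 = 3 above
   the diagonal and by 1/4 - 1 = -3/4 below; hence the parameters a / 3 and -4a / 3. *)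
have Dd : D (emb2 (mx2 2 0 0 2^-1)).
  have -> : mx2 2 0 0 2^-1 = mx2 1 1 0 1 *m mx2 1 0 1 1 *m mx2 1 (- 2^-1) 0 1 *m mx2 1 0 (- 2) 1.
    by rewrite !mx2M; congr mx2; field.
  by rewrite !emb2M; have [_ _ DM _] := sD; apply: (DM _ _ (DM _ _ (DM _ _ _ _) _) _).
have comm S S' T T' : S *m S' = 1%:M -> T *m T' = 1%:M ->
    emb2 S *m emb2 T *m invmx (emb2 S) *m invmx (emb2 T) = emb2 (S *m T *m S' *m T').
  by move=> SS TT; rewrite (emb2V SS) (emb2V TT) 3!emb2M.
have dd : mx2 2 0 0 2^-1 *m mx2 2^-1 0 0 2 = 1%:M.
  by rewrite mx2M -mx2_1; congr mx2; field.
split=> a; apply: sub_gen_subgroup.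
- exists (emb2 (mx2 2 0 0 2^-1)), (emb2 (mx2 1 (a / 3) 0 1)); split=> //.
  rewrite (comm _ _ _ (mx2 1 (- (a / 3)) 0 1) dd).
    by congr emb2; rewrite 3!mx2M; congr mx2; field.
  by rewrite mx2M -mx2_1; congr mx2; ring.
- exists (emb2 (mx2 2 0 0 2^-1)), (emb2 (mx2 1 0 (- (4 * a / 3)) 1)); split=> //.
  rewrite (comm _ _ _ (mx2 1 0 (4 * a / 3) 1) dd).
    by congr emb2; rewrite 3!mx2M; congr mx2; field.
  by rewrite mx2M -mx2_1; congr mx2; ring.
Qed.

End SL2.

(** * The upper triangular group and its unipotent radical *)

Section Borel.
Variables (F : numFieldType) (n : nat) (i0 : 'I_n) (sl : bool) (P : 'M[F]_n).
Hypothesis uP : P \in unitmx.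
Local Notation cj := (Ad (invmx P)).
Local Notation G := (@grp F n sl).

Definition borel : set 'M[F]_n := mgroup sl P (@up n).

Definition unip k : set 'M[F]_n := [set g | G g /\ lev k (cj g - 1%:M)].

Let uPV : invmx P \in unitmx. Proof. by rewrite unitmx_inv. Qed.

Lemma grp_unitri (u : 'M[F]_n) : unitri u -> G (Ad P u).
Proof.
move=> uu; split=> [|_]; first by rewrite Ad_unit // unitri_unit.
by rewrite Ad_det // unitri_det.
Qed.

Lemma unip_subgroup k : (0 < k)%N -> subgroup (unip k).
Proof.
move=> k0; have [G1 G2 G3 G4] := @grp_subgroup F n sl; split.
- by move=> g [[]].
- by split=> //; rewrite Ad1 // subrr => i j _; rewrite mxE.
- by move=> a b [Ga ea] [Gb eb]; split; [apply: G3|rewrite AdM //; apply: lev_mul1].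
- move=> a [Ga ea]; have ua := G1 _ Ga; split; first exact: G4.
  by rewrite Ad_inv //; apply: lev_inv.
Qed.

Lemma unip_borel k : (0 < k)%N -> unip k `<=` borel.
Proof.
move=> k0 g [Gg kg]; split=> //; have : unitri (cj g) by apply: levW kg.
by case/unitriP.
Qed.

(** Bounds the level of a group commutator by that of an additive one, the last factor being upper
    triangular in the applications. *)
Lemma commutator_sub1 (A B : 'M[F]_n) : A \in unitmx -> B \in unitmx ->
  A *m B *m invmx A *m invmx B - 1%:M = (A *m B - B *m A) *m (invmx A *m invmx B).
Proof.
move=> uA uB; rewrite mulmxBl !mulmxA; congr (_ - _).
by rewrite mulmxK // mulmxV.
Qed.

Lemma borel_derived : derived_group borel `<=` unip 1.
Proof.
have sB : subgroup borel by apply: mgroup_subgroup.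
have [_ _ G3 G4] := @grp_subgroup F n sl.
apply: derived_min; first exact: unip_subgroup.
move=> a b [Ga ua] [Gb ub]; split; first exact: (G3 _ _ (G3 _ _ (G3 _ _ Ga Gb) (G4 _ Ga)) (G4 _ Gb)).
have [na nb] := (Ga.1, Gb.1).
rewrite !AdM // !Ad_inv // commutator_sub1 ?Ad_unit // -[1%N]addn0; apply: levM.
  move=> i j; rewrite addn1 ltnS leq_eqVlt => /orP[/eqP/val_inj->|ji].
    rewrite [LHS]mxE [X in _ + X]mxE (mulmx_up_diag _ ua ub) (mulmx_up_diag _ ub ua).
    by rewrite mulrC subrr.
  have uM A B : masked (@up n) A -> masked (@up n) B -> (A *m B : 'M[F]_n) i j = 0.
    by move=> uA uB; have := maskedM (@up_trans n) uA uB; apply; rewrite /up -ltnNge.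
  by rewrite [LHS]mxE [X in _ + X]mxE !uM // subr0.
by apply/lev0/maskedM => //; apply: masked_inv; rewrite ?Ad_unit.
Qed.

(** Subtracting 1 from both matrices does not change their additive commutator, which therefore has
    level k + k >= k + 1. *)
Lemma unip_derived k (K : set 'M[F]_n) : (0 < k)%N -> K `<=` unip k -> derived_group K `<=` unip k.+1.
Proof.
move=> k0 KU; have [_ _ G3 G4] := @grp_subgroup F n sl.
apply: derived_min; first exact: unip_subgroup.
move=> a b /KU[Ga ua] /KU[Gb ub]; split; first exact: (G3 _ _ (G3 _ _ (G3 _ _ Ga Gb) (G4 _ Ga)) (G4 _ Gb)).
have [na nb] := (Ga.1, Gb.1).
have triv A : A \in unitmx -> lev k (A - 1%:M) -> masked (@up n) (invmx A : 'M[F]_n).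
  move=> uA kA; apply: masked_inv => //.
  by have /unitriP[] : unitri A by apply: levW kA.
rewrite !AdM // !Ad_inv // commutator_sub1 ?Ad_unit // -[k.+1]addn0; apply: levM.
  have -> : cj a *m cj b - cj b *m cj a =
      (cj a - 1%:M) *m (cj b - 1%:M) - (cj b - 1%:M) *m (cj a - 1%:M).
    rewrite !mulmxBl !mulmxBr !mul1mx !mulmx1; set x := _ *m _; set y := _ *m _.
    by apply/matrixP => i j; rewrite !mxE; ring.
  have kk : (k.+1 <= k + k)%N by rewrite -addn1 leq_add2l.
  by apply: levD; [|apply: levN]; apply: (levW kk); apply: levM.
by apply/lev0/maskedM => //; apply: triv; rewrite ?Ad_unit.
Qed.

Lemma unip_trivial : unip n `<=` [set 1%:M].
Proof.
move=> g [Gg /lev_eq0-/(_ (leqnn n)) /eqP]; rewrite subr_eq0 => /eqP E.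
by rewrite /= -[g](AdKV uP) E Ad1.
Qed.

Lemma borel_solvable : solvable_group borel.
Proof.
have sB : subgroup borel by apply: mgroup_subgroup.
have iterU m : iter m.+1 (@derived_group F n) borel `<=` unip m.+1.
  elim: m => [|m IHm]; first exact: borel_derived.
  by rewrite iterS; apply: unip_derived.
have nE : n.-1.+1 = n by rewrite prednK // (leq_ltn_trans _ (ltn_ord i0)).
exists n; rewrite eqEsubset; split.
  by have := iterU n.-1; rewrite nE => nU; apply: subset_trans nU unip_trivial.
by move=> _ ->; have [] := iter_derived_subgroup n sB.
Qed.

(** A group containing the Borel subgroup properly contains a monomial matrix of
    nontrivial permutation, hence two opposite root subgroups, hence a copy of
    [SL_2]. *)
Lemma borel_maximal (K : set 'M[F]_n) : subgroup K -> K `<=` G -> solvable_group K ->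
  borel `<=` K -> K = borel.
Proof.
move=> sK KG solK BK; rewrite eqEsubset; split=> // g Kg.
have [_ _ KM KV] := sK; have [ug dg] := KG _ Kg.
have ucg : cj g \in unitmx by rewrite Ad_unit.
have [p [t [b1 [b2 [t0 ub1 ub2 gE]]]]] := bruhat_exists ucg.
have uniB b : unitri b -> borel (Ad P b).
  by move=> ub; split; [apply: grp_unitri|rewrite AdK //; case/unitriP: ub].
have nb1 := unitri_unit ub1; have nb2 := unitri_unit ub2.
have Km : K (Ad P (mono p t)).
  have -> : mono p t = invmx b1 *m cj g *m invmx b2.
    by rewrite gE !mulmxA mulVmx // mul1mx mulmxK.
  rewrite 2?AdM // AdKV //; apply: (KM _ _ (KM _ _ _ Kg)); apply/BK/uniB.
    exact: unitri_inv.
  exact: unitri_inv.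
have [p1|/eqP p1] := eqVneq p 1%g.
  split; first exact: KG.
  rewrite gE; have [v1 _] := (unitriP b1).1 ub1; have [v2 _] := (unitriP b2).1 ub2.
  do 2?apply: maskedM => //; rewrite p1 => i j; rewrite mxE perm1.
  by case: eqP => // ->; rewrite up_refl.
have [i [j [ij pji]]] := perm_inversion p1.
have nij : p j != p i by rewrite -val_eqE neq_ltn pji.
have Kup (k l : 'I_n) a : (k < l)%N -> K (Ad P (1%:M + a *: delta_mx k l)).
  move=> kl; apply/BK/uniB => i' j' ij'; rewrite addrC addKr !mxE.
  case: andP; rewrite ?mulr0 // => -[/eqP Ei /eqP Ej].
  by move: ij' kl; rewrite Ei Ej addn1 ltnS leqNgt => /negPf->.
exfalso; apply: (sl2_not_solvable uP nij sK) solK => a; first by rewrite emb2_up; apply: Kup.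
rewrite emb2_low.
(* Conjugation by [mono p t] carries the root subgroup of (i, j), above the diagonal, to that of (p
   i, p j), below it; the parameter absorbs the two scalars. *)
have -> : 1%:M + a *: delta_mx (p i) (p j) =
    mono p t *m (1%:M + (t i)^-1 * a * t j *: delta_mx i j) *m invmx (mono p t).
  apply: (canRL (mulmxK (mono_unit p t0))).
  rewrite mulmxDl mul1mx mulmxDr mulmx1; congr (_ + _); apply/matrixP => k l.
  rewrite mul_mx_mono -[k](permKV p) mul_mono_mx permKV !mxE.
  rewrite (inj_eq perm_inj) -{1}[k](permKV p) (inj_eq perm_inj).
  case: eqP => [->|] /=; last by rewrite !mulr0 mul0r.
  by case: eqP => [->|]; rewrite ?mulr0 ?mul0r // !mulr1; field.
have um := mono_unit p t0.
by rewrite 2?AdM // Ad_inv //; apply: (KM _ _ (KM _ _ Km _) (KV _ Km)); apply: Kup.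
Qed.

Lemma borel_borel : borel_subgroup G borel.
Proof.
split; first exact: mgroup_cc.
  exact: borel_solvable.
by move=> K [sK KG _ _] solK BK; apply: borel_maximal.
Qed.

Lemma nilpotent_up_diag (A : 'M[F]_n) i : masked (@up n) A -> nilpotent_mx A -> A i i = 0.
Proof.
move=> uA [m Am]; have /eqP : (A ^+ m) i i = 0 by rewrite Am mxE.
suff [_ ->] : masked (@up n) (A ^+ m) /\ (A ^+ m) i i = A i i ^+ m.
  by rewrite expf_eq0 => /andP[_ /eqP].
elim: m {Am} => [|m [uAm IHm]].
  by rewrite !expr0; split; [apply: masked1|rewrite mxE eqxx].
rewrite !exprS -mulmxE; split; first exact: maskedM.
by rewrite mulmx_up_diag // IHm.
Qed.

Lemma lev1_nilpotent (A : 'M[F]_n) : lev 1 A -> nilpotent_mx A.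
Proof.
move=> lA; suff lm m : lev m (A ^+ m) by exists n; apply: lev_eq0 (lm n).
elim: m => [|m IHm]; last by rewrite exprS -mulmxE -add1n; apply: levM.
by rewrite expr0; apply/lev0/masked1.
Qed.

Lemma nilpotent_Ad (A Q : 'M[F]_n) : Q \in unitmx -> nilpotent_mx A -> nilpotent_mx (Ad Q A).
Proof.
move=> uQ [m Am]; exists m.
suff -> : Ad Q A ^+ m = Ad Q (A ^+ m) by rewrite Am Ad0.
elim: m {Am} => [|m IHm]; first by rewrite !expr0 Ad1.
by rewrite !exprS -mulmxE IHm -AdM.
Qed.

(** A unipotent upper triangular matrix has unit diagonal, which bounds every candidate; [unip 1] is
    itself one, being connected because it contains the segment between any two of its points. *)
Lemma unipotent_radical_borel : unipotent_radical borel = unip 1.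
Proof.
rewrite eqEsubset; split=> [u [N [[_ NB _ _] _ Nn Nu]]|u Uu].
  have [Gu uu] := NB _ Nu; split=> //; apply/unitriP; split=> // i.
  have /(nilpotent_Ad uPV) := Nn _ Nu; rewrite AdB Ad1 // => nu.
  have := @nilpotent_up_diag _ i _ nu; rewrite !mxE eqxx => /(_ _)/eqP.
  rewrite subr_eq0 => E; apply/eqP/E.
  by apply: maskedD => //; apply: maskedN; apply: masked1.
exists (unip 1); split=> //.
- have sU := @unip_subgroup 1 isT; split=> //; first exact: unip_borel.
    exists [set A | forall f, [set f | exists i, f = fun A => cj A i i - 1] f -> f A = 0].
      apply: zeros_closed => _ [i ->]; apply: polyfB; last exact: polyfC.
      exact: (@polymap_Ad _ _ _ _ (invmx P) _ polymap_id i i).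
    rewrite predeqE => g; split=> [Ug|[[Gg ug] dg]].
      split; first exact: unip_borel Ug.
      move=> _ [i ->]; have /unitriP[_ ->] := Ug.2.
      by rewrite subrr.
    split=> //; apply/unitriP; split=> // i.
    by apply/eqP; rewrite -subr_eq0; apply/eqP/(dg (fun A => cj A i i - 1)); exists i.
  apply: curve_connected => g h [Gg Ug] [Gh Uh].
  exists (line g (h - g)), 1; rewrite !hornerC !evmx_line scale0r addr0 invr1 !scale1r oner_eq0.
  split=> //; first by rewrite addrC subrK.
  move=> t _; rewrite hornerC invr1 scale1r evmx_line.
  have Ut : unitri (cj (g + t *: (h - g))).
    rewrite /unitri AdD AdZ AdB.
    have -> : cj g + t *: (cj h - cj g) - 1%:M =
        (cj g - 1%:M) + t *: ((cj h - 1%:M) - (cj g - 1%:M)).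
      by move: (cj g) (cj h) => A C; apply/matrixP => i j; rewrite !mxE; ring.
    by apply: levD => //; apply: levZ; apply: levD => //; apply: levN.
  split=> //; split=> [|_]; first by rewrite -(Ad_unit _ uPV) unitri_unit.
  by rewrite -(Ad_det _ uPV) unitri_det.
- move=> b v [Gb ub] [Gv uv]; have [_ _ G3 G4] := @grp_subgroup F n sl.
  split; first exact: (G3 _ _ (G3 _ _ Gb Gv) (G4 _ Gb)).
  have nb := Gb.1; have ncb : cj b \in unitmx by rewrite Ad_unit.
  have -> : cj (Ad b v) - 1%:M = cj b *m (cj v - 1%:M) *m invmx (cj b).
    by rewrite mulmxBr mulmxBl mulmx1 mulmxV // -Ad_inv // -!AdM.
  rewrite -[1%N]addn0; apply: levM; last by apply/lev0/masked_inv.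
  by rewrite -[1%N]add0n; apply: levM => //; apply/lev0.
- move=> v [_ lv]; rewrite -[v - _](AdKV uP); apply: nilpotent_Ad => //.
  by apply: lev1_nilpotent; rewrite AdB Ad1.
Qed.

End Borel.

(** * Schubert cells *)

Section CornerRanks.
Variables (F : fieldType) (n : nat).
Implicit Types (A B : 'M[F]_n) (p q : {perm 'I_n}).

(** Constant on double cosets of the upper triangular group, and bounded by a
    given rank on closed sets. *)
Definition corner_rank i j A :=
  \rank (dg F (fun k : 'I_n => i <= k)%N *m A *m dg F (fun k : 'I_n => k < j)%N).

Lemma dg_idem (a : pred 'I_n) : dg F a *m dg F a = dg F a.
Proof. by apply/matrixP => k l; rewrite mul_dg dgE; case: (a k). Qed.

Lemma corner_rank_upl i j A B : masked (@up n) B ->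
  (corner_rank i j (B *m A) <= corner_rank i j A)%N.
Proof.
move=> uB; rewrite /corner_rank; set D := dg F _; set D' := dg F _.
have -> : D *m (B *m A) *m D' = D *m B *m (D *m A *m D').
  rewrite !mulmxA; congr (_ *m _ *m _); apply/matrixP => k l.
  rewrite mul_mx_dg mul_dg; case: ifP => // ik; case: ifP => // il.
  by rewrite uB // /up; apply: contraFN il; apply: leq_trans.
exact: mxrankM_maxr.
Qed.

Lemma corner_rank_upr i j A B : masked (@up n) B ->
  (corner_rank i j (A *m B) <= corner_rank i j A)%N.
Proof.
move=> uB; rewrite /corner_rank; set D := dg F _; set D' := dg F _.
have BD : B *m D' = D' *m B *m D'.
  apply/matrixP => k l; rewrite !mul_mx_dg mul_dg; case: ifP => // il; case: ifP => // ik.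
  by rewrite uB // /up; apply: contraFN ik => /leq_ltn_trans; apply.
have -> : D *m (A *m B) *m D' = D *m A *m D' *m (B *m D').
  by rewrite !mulmxA -[LHS]mulmxA BD !mulmxA.
exact: mxrankM_maxl.
Qed.

Lemma corner_rank_up i j A B B' : masked (@up n) B -> masked (@up n) B' ->
  B \in unitmx -> B' \in unitmx -> corner_rank i j (B *m A *m B') = corner_rank i j A.
Proof.
move=> uB uB' nB nB'; apply/eqP; rewrite eqn_leq; apply/andP; split.
  exact: leq_trans (corner_rank_upr _ _ _ uB') (corner_rank_upl _ _ _ uB).
have {1}-> : A = invmx B *m (B *m A *m B' *m invmx B') by rewrite mulmxK // mulKmx.
apply: leq_trans (corner_rank_upl _ _ _ _) (corner_rank_upr _ _ _ _);
  exact: masked_inv.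
Qed.

(** The upper bound is a sum of ranks one. Applied also to the complement, whose projector adds up
    with this one to 1, it forces equality. *)
Lemma rank_dg (a : pred 'I_n) : \rank (dg F a) = #|a|.
Proof.
have le (b : pred 'I_n) : (\rank (dg F b) <= #|b|)%N.
  have -> : dg F b = \sum_(k | b k) delta_mx k k.
    apply/matrixP => k l; rewrite dgE summxE.
    under eq_bigr do rewrite mxE.
    case: (boolP (b k)) => bk /=.
      rewrite (bigD1 k) //= eqxx eq_sym big1 ?addr0 // => m /andP[_ mk].
      by rewrite eq_sym (negPf mk).
    rewrite big1 // => m bm; case: eqP => // E; by rewrite E bm in bk.
  rewrite -sum1_card; elim/big_rec2: _ => [|m r A bm rA]; first by rewrite mxrank0.
  by apply: leq_trans (mxrank_add _ _) _; rewrite mxrank_delta leq_add2l.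
apply/eqP; rewrite eqn_leq le /= -(leq_add2r #|predC a|) cardC card_ord.
apply: leq_trans (leq_add (leqnn _) (le (predC a))).
apply: leq_trans (mxrank_add _ _); rewrite -[X in (X <= _)%N](mxrank1 F n).
suff -> : dg F a + dg F (predC a) = 1%:M by [].
by apply/matrixP => k l; rewrite mxE !dgE mxE /=; case: (a k); rewrite ?addr0 ?add0r.
Qed.

Definition perm_rank i j p := #|[pred k : 'I_n | (i <= p k)%N && (k < j)%N]|.

Lemma corner_rank_mono i j p (t : 'I_n -> F) : (forall k, t k != 0) ->
  corner_rank i j (mono p t) = perm_rank i j p.
Proof.
move=> t0; rewrite /corner_rank.
have -> : dg F (fun k : 'I_n => i <= k)%N *m mono p t *m dg F (fun k : 'I_n => k < j)%N =
  mono p t *m dg F [pred k : 'I_n | (i <= p k)%N && (k < j)%N].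
  apply/matrixP => k l; rewrite !mul_mx_dg mul_dg mxE /=.
  by case: eqP => [->|_]; case: (l < j)%N; rewrite ?andbT ?andbF ?if_same.
by rewrite eqmxMfull ?row_full_unit ?mono_unit // rank_dg.
Qed.

(** Increasing [j] past k changes the rank by the truth value of i <= p k, and these values for all
    i determine p k. *)
Lemma perm_rank_inj p q : (forall i j, perm_rank i j p = perm_rank i j q) -> p = q.
Proof.
move=> pq.
have step i (k : 'I_n) r : perm_rank i k.+1 r = (perm_rank i k r + (i <= r k))%N.
  rewrite /perm_rank (cardD1 k) !inE ltnSn andbT addnC; congr (_ + _)%N.
  apply: eq_card => l; rewrite !inE ltnS andbCA; congr (_ && _).
  by rewrite ltn_neqAle.
have pqk i k : (i <= p k)%N = (i <= q k)%N.
  have := step i k p; rewrite pq step pq => /addnI.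
  by case: (i <= p k)%N; case: (i <= q k)%N.
apply/permP => k; apply/eqP; rewrite -val_eqE eqn_leq.
by rewrite -pqk leqnn pqk leqnn.
Qed.

(** A nonzero minor, with arbitrary matrices in place of a choice of rows and columns: it exhibits a
    lower bound on the rank as an open condition. *)
Lemma rank_witness m (A : 'M[F]_m) r :
  (r <= \rank A)%N <-> exists k (X : 'M[F]_(k, m)) (Y : 'M[F]_(m, k)),
    (r <= k)%N /\ \det (X *m A *m Y) != 0.
Proof.
split=> [rA|[k [X [Y [rk XY]]]]].
  have /row_fullP[X XA] := col_base_full A; have /row_freeP[Y AY] := row_base_free A.
  exists (\rank A), X, Y; split=> //.
  have -> : X *m A = row_base A by rewrite -[RHS]mul1mx -XA -mulmxA mulmx_base.
  by rewrite AY det1 oner_eq0.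
apply: leq_trans rk _; have uXY : X *m A *m Y \in unitmx by rewrite unitmxE unitfE.
rewrite -(mxrank_unit uXY); apply: leq_trans (mxrankM_maxl _ _) _.
exact: mxrankM_maxr.
Qed.

End CornerRanks.

Section Cosets.
Variables (F : fieldType) (n : nat) (G B : set 'M[F]_n).

Lemma left_coset_eq (g g' : 'M[F]_n) : subgroup B -> g \in unitmx ->
  (left_coset g B = left_coset g' B <-> exists2 b, B b & g' = g *m b).
Proof.
move=> [BG B1 BM BV] ug; split=> [E|[b Bb ->]].
  have : left_coset g' B g' by exists 1%:M => //; rewrite mulmx1.
  by rewrite -E => -[b Bb <-]; exists b.
have ub := BG _ Bb; rewrite eqEsubset; split=> _ [c Bc <-].
  exists (invmx b *m c); first exact: BM (BV _ Bb) Bc.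
  by rewrite !mulmxA mulmxK.
by exists (b *m c); [exact: BM|rewrite mulmxA].
Qed.

Lemma affine_openI (U V : set 'M[F]_n) :
  @zopen _ (affine_mx F n n) U -> @zopen _ (affine_mx F n n) V ->
  @zopen _ (affine_mx F n n) (U `&` V).
Proof.
move=> [I ->] [J ->]; exists [set r | exists p q, [/\ I p, J q & r = p * q]].
rewrite predeqE => A; split=> [[[p Ip pA] [q Jq qA]]|[_ [p [q [Ip Jq ->]]]]].
  by exists (p * q); [exists p, q|rewrite /peval mevalM mulf_neq0].
by rewrite /peval mevalM mulf_eq0 negb_or => /andP[pA qA]; split; [exists p|exists q].
Qed.

Lemma flag_closed_union (I : eqType) (r : seq I) (Z : I -> set (flag_variety G B)) :
  (forall i, zclosed (Z i)) -> zclosed [set C | exists2 i, i \in r & Z i C].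
Proof.
move=> cZ; elim: r => [|i r [V oV VE]].
  exists setT; last by rewrite predeqE => x; split=> // _ [].
  exists [set 1]; rewrite predeqE => A; split=> // _.
  by exists 1 => //; rewrite /peval meval1 oner_eq0.
have [V' oV' VE'] := cZ i; exists (V `&` V'); first exact: affine_openI.
move: VE VE'; rewrite !predeqE => VE VE' x; split=> [nZ|[Vx V'x] [j]].
  split; first by apply/VE => -[j jr Zj]; apply: nZ; exists j; rewrite // inE jr orbT.
  by apply/VE' => Zi; apply: nZ; exists i; rewrite // inE eqxx.
rewrite inE => /orP[/eqP->|jr Zj]; first by have := (VE' x).2 V'x.
by have := (VE x).2 Vx; apply; exists j.
Qed.

End Cosets.

(** * Cells described by corner ranks, and the order of the paving *)

Section SchubertCells.
Variables (F : numFieldType) (n : nat) (i0 : 'I_n) (sl : bool) (P : 'M[F]_n).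
Hypothesis uP : P \in unitmx.
Local Notation cj := (Ad (invmx P)).
Local Notation G := (@grp F n sl).
Local Notation B := (borel sl P).
Implicit Types (p q : {perm 'I_n}) (C : flag_variety G B).

Let uPV : invmx P \in unitmx. Proof. by rewrite unitmx_inv. Qed.
Let sB : subgroup B. Proof. exact: mgroup_subgroup. Qed.
Let ub b : B b -> cj b \in unitmx. Proof. by move=> [[ub _] _]; rewrite Ad_unit. Qed.

(** Corner ranks make the disjointness of the cells immediate; [schubert_cellE] identifies this set
    with the double coset of any representative of [p]. *)
Definition schubert p : set (flag_variety G B) := [set C | exists g,
  [/\ G g, val C = left_coset g B & forall i j, corner_rank i j (cj g) = perm_rank i j p]].

(** A closed set containing the cell of [p]; among the cells of [perm_weight] at least that of [p],
    it meets only this one. *)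
Definition schubert_closure p : set (flag_variety G B) := [set C | exists g,
  [/\ G g, val C = left_coset g B
    & forall i j, (corner_rank i j (cj g) <= perm_rank i j p)%N]].

Lemma coset_rep C : exists2 g, G g & val C = left_coset g B.
Proof. by have [g Gg gC] := set_mem (valP C); exists g. Qed.

Lemma coset_corner_rank i j (g h : 'M[F]_n) : G g -> left_coset g B = left_coset h B ->
  corner_rank i j (cj h) = corner_rank i j (cj g).
Proof.
move=> [ug _] /(left_coset_eq _ sB ug)[b Bb ->]; rewrite AdM // -[cj g]mul1mx.
by rewrite corner_rank_up ?unitmx1 ?ub ?Bb.2 // ?mul1mx //; [apply: masked1|case: Bb].
Qed.

Lemma schubertE C g p : G g -> val C = left_coset g B ->
  (schubert p C <-> forall i j, corner_rank i j (cj g) = perm_rank i j p).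
Proof.
move=> Gg gC; split=> [[h [Gh hC hp]] i j|gp]; last by exists g.
by rewrite -hp; apply: coset_corner_rank => //; rewrite -hC.
Qed.

Lemma schubert_closureE C g p : G g -> val C = left_coset g B ->
  (schubert_closure p C <-> forall i j, (corner_rank i j (cj g) <= perm_rank i j p)%N).
Proof.
move=> Gg gC; split=> [[h [Gh hC hp]] i j|gp]; last by exists g.
by apply: leq_trans (hp i j); rewrite (coset_corner_rank i j Gh) // -hC.
Qed.

Lemma schubert_inj C p q : schubert p C -> schubert q C -> p = q.
Proof.
have [g Gg gC] := coset_rep C; move=> /(schubertE _ Gg gC) gp /(schubertE _ Gg gC) gq.
by apply: perm_rank_inj => i j; rewrite -gp.
Qed.

Lemma schubert_cover C : exists p, schubert p C.
Proof.
have [g Gg gC] := coset_rep C.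
have ucg : cj g \in unitmx by rewrite Ad_unit //; case: Gg.
have [p [t [b1 [b2 [t0 ub1 ub2 gE]]]]] := bruhat_exists ucg.
exists p; apply/(schubertE _ Gg gC) => i j; rewrite gE.
have [v1 _] := (unitriP b1).1 ub1; have [v2 _] := (unitriP b2).1 ub2.
by rewrite corner_rank_up ?unitri_unit // corner_rank_mono.
Qed.

(** An element with the corner ranks of [p] has a Bruhat decomposition, whose permutation is [p] by
    [perm_rank_inj]; its scalars differ from those of [w] by a diagonal matrix, absorbed by the
    right factor. *)
Lemma schubert_cellE w p (t : 'I_n -> F) : G w -> cj w = mono p t ->
  schubert_cell G B w = schubert p.
Proof.
move=> Gw wE; have [G1 _ GM GV] := @grp_subgroup F n sl.
have t0 : forall j, t j != 0.
  by apply: (@mono_det_neq0 _ _ p); rewrite -wE Ad_unit //; case: Gw.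
rewrite predeqE => C; split=> [[b Bb bC]|Cp].
  have Gbw : G (b *m w) by apply: GM => //; case: Bb.
  apply/(schubertE _ Gbw bC) => i j; rewrite AdM // wE -[_ *m mono _ _]mulmx1.
  by rewrite corner_rank_up ?unitmx1 ?ub // ?corner_rank_mono //; [case: Bb|apply: masked1].
have [g Gg gC] := coset_rep C; have := (schubertE _ Gg gC).1 Cp => gp.
have ucg : cj g \in unitmx by rewrite Ad_unit //; case: Gg.
have [q [r [b1 [b2 [r0 ub1 ub2 gE]]]]] := bruhat_exists ucg.
have [v1 _] := (unitriP b1).1 ub1; have [v2 _] := (unitriP b2).1 ub2.
have pq : q = p.
  apply: perm_rank_inj => i j; rewrite -gp gE.
  by rewrite corner_rank_up ?unitri_unit // corner_rank_mono.
have uniB b : unitri b -> B (Ad P b).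
  by move=> u; split; [apply: grp_unitri|rewrite AdK //; case/unitriP: u].
exists (Ad P b1); first exact: uniB.
rewrite gC; apply/esym/left_coset_eq => //.
  by apply: G1; apply: GM => //; case: (uniB _ ub1).
pose d := mono 1%g (fun k => (t k)^-1 * r k).
have gE' : g = Ad P b1 *m w *m (Ad P d *m Ad P b2).
  have mE : mono q r = mono p t *m d.
    rewrite pq mono_mul mul1g; apply/matrixP => k l; rewrite !mxE perm1.
    by rewrite mulVKf.
  by rewrite -[LHS](AdKV uP) gE mE -[in RHS](AdKV uP w) wE -!AdM // !mulmxA.
exists (Ad P d *m Ad P b2) => //; split.
  have -> : Ad P d *m Ad P b2 = invmx (Ad P b1 *m w) *m g.
    by rewrite gE' mulKmx //; apply: (G1 _ (GM _ _ (grp_unitri sl uP ub1) Gw)).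
  exact: (GM _ _ (GV _ (GM _ _ (grp_unitri sl uP ub1) Gw)) Gg).
rewrite -AdM // AdK //; apply: maskedM => // i j; rewrite mxE perm1.
by case: eqP => // ->; rewrite up_refl.
Qed.

Lemma schubert_closed p : zclosed (schubert_closure p).
Proof.
pose W := [set A | exists i j k (X : 'M[F]_(k, n)) (Y : 'M[F]_(n, k)),
  (perm_rank i j p < k)%N /\ \det (X *m (dg F (fun m : 'I_n => i <= m)%N *m cj A *m
     dg F (fun m : 'I_n => m < j)%N) *m Y) != 0].
exists W.
  exists [set q | exists i j k (X : 'M[F]_(k, n)) (Y : 'M[F]_(n, k)), (perm_rank i j p < k)%N /\
    forall A, \det (X *m (dg F (fun m : 'I_n => i <= m)%N *m cj A *m
     dg F (fun m : 'I_n => m < j)%N) *m Y) = peval q A].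
  rewrite predeqE => A; split=> [[i [j [k [X [Y [jk XY]]]]]]|[q [i [j [k [X [Y [jk qE]]]]]] qA]].
    have [q qE] : polyf (fun A => \det (X *m (dg F (fun m : 'I_n => i <= m)%N *m cj A *m
     dg F (fun m : 'I_n => m < j)%N) *m Y)).
      apply: polyf_det; apply: polymapM (polymapC _); apply: (polymapM (polymapC _)).
      apply: polymapM (polymapC _); apply: (polymapM (polymapC _)).
      exact: (polymap_Ad _ polymap_id).
    by exists q; [exists i, j, k, X, Y|rewrite -qE].
  by exists i, j, k, X, Y; rewrite qE.
rewrite predeqE => g; have gG : G (val g) by apply: set_valP.
split=> [nC|[i [j [k [X [Y [jk XY]]]]]]].
  have /existsNP[i /existsNP[j /negP]] : ~ forall i j,
      (corner_rank i j (cj (val g)) <= perm_rank i j p)%N.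
    by move=> le; apply: nC; exists (val g).
  rewrite -ltnNge => /rank_witness[k [X [Y XY]]].
  by exists i, j, k, X, Y.
move=> /(@schubert_closureE (coset_map B g) _ _ gG erefl)/(_ i j); rewrite leqNgt => /negP.
apply.
by apply/rank_witness; exists k, X, Y.
Qed.

(** Strictly increasing for the partial order by corner ranks, so sorting by it refines that order.
    Indices up to n suffice, larger ones repeating the value at n. *)
Definition perm_weight p := (\sum_(ij : 'I_n.+1 * 'I_n.+1) perm_rank ij.1 ij.2 p)%N.

Lemma perm_rank_le p q : (forall i j, perm_rank i j p <= perm_rank i j q)%N ->
  (perm_weight q <= perm_weight p)%N -> p = q.
Proof.
move=> pq qp; apply: perm_rank_inj => i j.
have trunc (r : {perm 'I_n}) : perm_rank i j r = perm_rank (minn i n) (minn j n) r.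
  apply: eq_card => k; rewrite !inE geq_min leq_min [(n <= r k)%N]leqNgt.
  by rewrite (ltn_ord (r k)) (ltn_ord k) orbF andbT.
have le (ij : 'I_n.+1 * 'I_n.+1) : true -> (perm_rank ij.1 ij.2 p <= perm_rank ij.1 ij.2 q
    ?= iff (perm_rank ij.1 ij.2 p == perm_rank ij.1 ij.2 q))%N.
  by move=> _; split.
have := geq_leqif (leqif_sum le); rewrite -/(perm_weight p) -/(perm_weight q) qp.
move=> /esym/forallP eqr; rewrite !trunc.
have lt m : (minn m n < n.+1)%N by rewrite ltnS geq_minr.
by have /eqP := eqr (Ordinal (lt i), Ordinal (lt j)).
Qed.

(** The union of the first cells is cut out of [X] by the union of their [schubert_closure]: a point
    of a later cell in one of these closed sets would have corner ranks at most, and weight at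
    least, those of an earlier permutation, so the two would coincide by [perm_rank_le]. *)
Lemma schubert_paving (X : set (flag_variety G B)) :
  (forall p, (schubert p `&` X) !=set0 ->
     exists d, isomorphic (induced (schubert p `&` X)) (affine_space F d)) ->
  exists m (Q : 'I_m -> set (flag_variety G B)), paving_by_affines X Q /\
    range Q = [set C | C !=set0 /\ exists p, C = schubert p `&` X].
Proof.
move=> affX; pose cell p := schubert p `&` X.
pose le p q := (perm_weight p <= perm_weight q)%N.
pose s := sort le [seq p <- enum {: {perm 'I_n}} | `[< cell p !=set0 >]].
have memS p : p \in s = `[< cell p !=set0 >] by rewrite mem_sort mem_filter mem_enum inE andbT.
have us : uniq s by rewrite sort_uniq filter_uniq ?enum_uniq.
have ss : sorted le s by apply: sort_sorted => p q; apply: leq_total.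
have le_tr : transitive le by move=> p q r; apply: leq_trans.
have le_nth j k : (j <= k < size s)%N -> le (nth 1%g s j) (nth 1%g s k).
  move=> /andP[jk ks]; apply: (sorted_leq_nth le_tr (fun _ => leqnn _) 1%g ss) => //.
  by rewrite inE (leq_ltn_trans jk).
have cellX C : X C -> exists2 i : 'I_(size s), schubert (nth 1%g s i) C & X C.
  move=> XC; have [p pC] := schubert_cover C.
  have ps : p \in s by rewrite memS; apply/asboolP; exists C.
  have pi : (index p s < size s)%N by rewrite index_mem.
  by exists (Ordinal pi); rewrite //= nth_index.
exists (size s), (fun i => cell (nth 1%g s i)); split; first split.
- rewrite predeqE => C; split=> [[i _ []]//|XC].
  by have [i pC _] := cellX C XC; exists i.
- move=> i j _ _ [C [[iC _] [jC _]]]; apply: val_inj.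
  have := schubert_inj iC jC => /eqP; rewrite nth_uniq // => /eqP.
  exact.
- move=> i; exists [set C | exists2 p, p \in take i.+1 s & schubert_closure p C].
    by apply: flag_closed_union => p; apply: schubert_closed.
  rewrite predeqE => C; split=> [[j /= ji [pC XC]]|[XC [p ps pC]]].
    split=> //; exists (nth 1%g s j).
      by rewrite in_take ?mem_nth // index_uniq // ltnS.
    have [g Gg gC] := coset_rep C; apply/(schubert_closureE _ Gg gC) => k l.
    by rewrite ((schubertE _ Gg gC).1 pC).
  have [j jC _] := cellX C XC; exists j => //=.
  have [k kE kp] : exists2 k, (k < i.+1)%N & nth 1%g s k = p.
    have pS := mem_take ps; exists (index p s); last exact: nth_index.
    by rewrite -(in_take _ pS).
  rewrite leqNgt; apply/negP => ij.
  have kj : (k <= j)%N by apply: leq_trans (ltnW ij); rewrite -ltnS.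
  have E : nth 1%g s j = nth 1%g s k.
    apply: perm_rank_le; last by apply: le_nth; rewrite kj ltn_ord.
    move=> a b; have [g Gg gC] := coset_rep C; rewrite kp.
    by rewrite -((schubertE _ Gg gC).1 jC) ((schubert_closureE _ Gg gC).1 pC).
  move/eqP: E; rewrite nth_uniq // ?(leq_ltn_trans kj) // => /eqP jk.
  by move: kE; rewrite -jk ltnS leqNgt ij.
- move=> i; apply: affX; have := mem_nth 1%g (ltn_ord i).
  by rewrite memS => /asboolP.
rewrite predeqE => Y; split=> [[i _ <-]|[Y0 [p Yp]]].
  split; last by exists (nth 1%g s i).
  by have := mem_nth 1%g (ltn_ord i); rewrite memS => /asboolP.
have ps : p \in s by rewrite memS -/(cell p) /cell -Yp; apply/asboolP.
have pi : (index p s < size s)%N by rewrite index_mem.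
by exists (Ordinal pi); rewrite //= nth_index // Yp.
Qed.

End SchubertCells.

(** * Roots *)

Lemma linear_linfunE (K : fieldType) (aT rT : vectType K) (f : aT -> rT) :
  linear f -> linfun f =1 f.
Proof.
move=> lf; pose g : {linear aT -> rT} := HB.pack f (GRing.isLinear.Build _ _ _ _ f lf).
exact: (lfunE g).
Qed.

(** [mxE] would unfold [Ad]; these do not. *)
Lemma addmxE (V : nmodType) m n (A B : 'M[V]_(m, n)) i j : (A + B) i j = A i j + B i j.
Proof. exact: mxE. Qed.

Lemma oppmxE (V : zmodType) m n (A : 'M[V]_(m, n)) i j : (- A) i j = - A i j.
Proof. exact: mxE. Qed.

Lemma scalemxE (K : pzRingType) m n (a : K) (A : 'M[K]_(m, n)) i j : (a *: A) i j = a * A i j.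
Proof. exact: mxE. Qed.

Definition entE := (addmxE, oppmxE, scalemxE).

Lemma trace_delta (K : pzRingType) n (i j : 'I_n) : \tr (delta_mx i j : 'M[K]_n) = (i == j)%:R.
Proof.
rewrite /mxtrace (bigD1 i) //= big1 ?addr0 => [|k ki]; rewrite mxE ?eqxx //=.
by rewrite (negPf ki).
Qed.

Section Roots.
Variables (F : numFieldType) (n : nat) (i0 : 'I_n) (sl : bool) (P : 'M[F]_n).
Hypothesis uP : P \in unitmx.
Local Notation cj := (Ad (invmx P)).
Local Notation G := (@grp F n sl).
Local Notation B := (borel sl P).
Implicit Types (X Y : 'M[F]_n) (r e : rel 'I_n) (i j k l : 'I_n).

Let uPV : invmx P \in unitmx. Proof. by rewrite unitmx_inv. Qed.

Definition diag_rel : rel 'I_n := fun i j => i == j.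

Lemma grp_mgroup : G = mgroup sl P (fun _ _ => true).
Proof. by rewrite predeqE => g; split=> [|[]//] Gg; split=> // i j. Qed.

Lemma lie_grp X : lie_algebra G X <-> (sl -> \tr X = 0).
Proof. by rewrite grp_mgroup lie_mgroup //; split=> [[]//|]; split=> // i j. Qed.

Lemma lie_borel X : lie_algebra B X <-> masked (@up n) (cj X) /\ (sl -> \tr X = 0).
Proof. by rewrite lie_mgroup. Qed.

(** Presents the subalgebra as a kernel: the off-diagonal entries are the equations of diagonality,
    and the free diagonal places carry the trace condition of the special linear case. *)
Definition cartan_eqs X : 'M[F]_n :=
  \matrix_(i, j) if i == j then (if sl then \tr X else 0) else cj X i j.

Definition cartan : {vspace 'M[F]_n} := lker (linfun cartan_eqs).
Local Notation h := cartan.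

Lemma mem_cartan X : X \in h <-> masked diag_rel (cj X) /\ (sl -> \tr X = 0).
Proof.
rewrite memv_ker linear_linfunE; last first.
  move=> a Y Z; apply/matrixP => i j; rewrite [LHS]mxE !entE ![cartan_eqs _ _ _]mxE.
  case: eqP => _; last by rewrite AdD AdZ !entE.
  by case: (sl); rewrite ?mulr0 ?addr0 // raddfD /= mxtraceZ.
split=> [/eqP/matrixP E|[dX tX]].
  split=> [i j|s].
    by rewrite /diag_rel => /negPf ij; have := E i j; rewrite [LHS]mxE [RHS]mxE ij.
  by have := E i0 i0; rewrite [LHS]mxE [RHS]mxE eqxx s.
apply/eqP/matrixP => i j; rewrite [LHS]mxE [RHS]mxE; case: eqP => [_|/eqP ij]; last exact: dX.
by case: (boolP sl) => // /tX.
Qed.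

Lemma cartan_lie X : X \in h -> lie_algebra G X.
Proof. by move=> /mem_cartan[_ tX]; apply/lie_grp. Qed.

Lemma cartan_borel X : X \in h -> lie_algebra B X.
Proof.
move=> /mem_cartan[dX tX]; apply/lie_borel; split=> // i j ij; apply: dX.
by apply: contraNN ij => /eqP->; apply: up_refl.
Qed.

(** Traceless, hence available for both groups; it is the element on which roots and matrix entries
    are tested. *)
Definition coroot i j : 'M[F]_n := Ad P (delta_mx i i - delta_mx j j).

Lemma coroot_cartan i j : coroot i j \in h.
Proof.
apply/mem_cartan; rewrite AdK //; split=> [k l|_].
  rewrite /diag_rel => kl; rewrite !mxE; case: (eqVneq k i) => [<-|_] /=; case: (eqVneq k j) => [<-|_] /=;
    by rewrite ?[l == k]eq_sym ?(negPf kl) subrr.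
by rewrite Ad_tr // raddfB /= !trace_delta ?eqxx subrr.
Qed.

Lemma cj_coroot i j k : cj (coroot i j) k k = (k == i)%:R - (k == j)%:R.
Proof. by rewrite AdK // !mxE !andbb. Qed.

Lemma bracket_cartan X Y i j : Y \in h ->
  cj (bracket Y X) i j = (cj Y i i - cj Y j j) * cj X i j.
Proof.
move=> /mem_cartan[+ _]; rewrite Ad_bracket //; move: (cj X) (cj Y) => A D dD.
rewrite /bracket !mxE.
rewrite (bigD1 i) //= big1 ?addr0 => [|k ki]; last by rewrite dD ?mul0r // /diag_rel eq_sym.
rewrite (bigD1 j) //= big1 ?addr0 => [|k ki]; last by rewrite dD ?mulr0.
by rewrite mulrBl [X in _ - X]mulrC.
Qed.

Lemma cj_inj X Y : cj X = cj Y -> X = Y.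
Proof. by move=> E; rewrite -[X](AdKV uP) E AdKV. Qed.

(** The algebra is abelian. It is its own normaliser because the bracket with [coroot i j]
    multiplies the entry (i, j) by 2, up to sign, and has to be diagonal. *)
Lemma cartan_cartan : cartan_subalgebra G h.
Proof.
have h0 : (lie_prod h h <= 0)%VS.
  apply/span_subvP => _ /allpairsP[[X Y] /= [/vbasis_mem Xh /vbasis_mem Yh ->]].
  rewrite memv0; apply/eqP/cj_inj/matrixP => i j; rewrite bracket_cartan // Ad0 [RHS]mxE.
  have [dY _] := (mem_cartan Y).1 Yh.
  by have [->|ij] := eqVneq i j; rewrite ?subrr ?mul0r // dY ?mulr0.
split.
- exact: cartan_lie.
- exact: subv_trans h0 (sub0v _).
- by exists 1%N; apply/eqP; rewrite -subv0.
move=> X gX Xh; apply/mem_cartan; split; last by apply/lie_grp.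
move=> i j; rewrite /diag_rel => ij; have := Xh _ (coroot_cartan i j) => /mem_cartan[/(_ i j ij) + _].
have -> : bracket X (coroot i j) = - bracket (coroot i j) X by rewrite /bracket opprB.
rewrite AdN entE bracket_cartan ?coroot_cartan // !cj_coroot !eqxx (negPf ij) [j == i]eq_sym.
rewrite (negPf ij) subr0 sub0r opprK => /eqP; rewrite oppr_eq0 mulf_eq0 => /orP[|/eqP//].
by rewrite -(natrD _ 1 1) pnatr_eq0.
Qed.

Local Notation dual := 'Hom(subvs_of h, F^o).
Implicit Types (a b : dual).

(** The root usually written e_i - e_j; it is zero for i = j. *)
Definition rt i j : dual :=
  linfun (fun Y : subvs_of h => cj (vsval Y) i i - cj (vsval Y) j j : F^o).

Lemma rtE i j (Y : subvs_of h) : rt i j Y = cj (vsval Y) i i - cj (vsval Y) j j.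
Proof.
rewrite linear_linfunE // => c Y1 Y2; rewrite linearP AdD AdZ !entE /=.
by rewrite -[c *: _]/(c * _); ring.
Qed.

Lemma rt_val i j Y : Y \in h -> rt i j (vsproj h Y) = cj Y i i - cj Y j j.
Proof. by move=> Yh; rewrite rtE vsprojK. Qed.

Lemma rt_self i : rt i i = 0.
Proof. by apply/lfunP => Y; rewrite rtE subrr lfunE. Qed.

Lemma rt_opp i j : - rt i j = rt j i.
Proof. by apply/lfunP => Y; rewrite opp_lfunE !rtE opprB. Qed.

Lemma rt_add i j k : rt i j + rt j k = rt i k.
Proof. by apply/lfunP => Y; rewrite add_lfunE !rtE addrA subrK. Qed.

(** At [coroot i j] the left side is 2 and the right side at most 1 unless (k, l) = (i, j). The
    numerals 1 to 4 are the possible differences, nonzero in characteristic zero. *)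
Lemma rt_inj i j k l : i != j -> rt i j = rt k l -> i = k /\ j = l.
Proof.
move=> ij E; have := congr1 (fun a : dual => a (vsproj h (coroot i j))) E.
rewrite !rt_val ?coroot_cartan // !cj_coroot !eqxx (negPf ij) [j == i]eq_sym (negPf ij).
have n20 : (2 : F) != 0 by rewrite pnatr_eq0.
have n10 : (1 : F) != 0 by rewrite oner_eq0.
have n30 : (3 : F) != 0 by rewrite pnatr_eq0.
have n40 : (4 : F) != 0 by rewrite pnatr_eq0.
case: (eqVneq k i) => [->|ki]; case: (eqVneq l j) => [->//|lj].
- rewrite (negPf ij); case: (l == i) => /=; move/eqP; rewrite -subr_eq0 => /eqP E1.
    by case/eqP: n20; rewrite -[RHS]E1; ring.
  by case/eqP: n10; rewrite -[RHS]E1; ring.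
- rewrite [j == i]eq_sym (negPf ij); case: (k == j) => /=; move/eqP; rewrite -subr_eq0 => /eqP E1.
    by case/eqP: n20; rewrite -[RHS]E1; ring.
  by case/eqP: n10; rewrite -[RHS]E1; ring.
- case: (k == j); case: (l == i) => /=; move/eqP; rewrite -subr_eq0 => /eqP E1.
  + by case/eqP: n40; rewrite -[RHS]E1; ring.
  + by case/eqP: n30; rewrite -[RHS]E1; ring.
  + by case/eqP: n30; rewrite -[RHS]E1; ring.
  + by case/eqP: n20; rewrite -[RHS]E1; ring.
Qed.

Lemma rt_neq0 i j : i != j -> rt i j != 0.
Proof. by move=> ij; apply/eqP; rewrite -(rt_self i) => /(rt_inj ij)[_ E]; rewrite E eqxx in ij. Qed.

Lemma root_spaceE a X : root_space G a X <->
  (sl -> \tr X = 0) /\ forall i j, cj X i j != 0 -> rt i j = a.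
Proof.
split=> [[/lie_grp gX aX]|[gX aX]]; split=> //.
- move=> i j Xij; apply/lfunP => Y; rewrite rtE; apply: (mulIf Xij).
  by rewrite -bracket_cartan ?subvsP // aX AdZ entE.
- exact/lie_grp.
move=> Y; apply/cj_inj/matrixP => i j; rewrite bracket_cartan ?subvsP // AdZ entE -rtE.
by have [->|/aX->] := eqVneq (cj X i j) 0; rewrite ?mulr0.
Qed.

Definition rvec i j : 'M[F]_n := Ad P (delta_mx i j).

Lemma cj_rvec i j : cj (rvec i j) = delta_mx i j. Proof. by rewrite AdK. Qed.

Lemma rvec_tr i j : i != j -> \tr (rvec i j) = 0.
Proof. by move=> ij; rewrite Ad_tr // trace_delta (negPf ij). Qed.

Lemma root_space_rvec c i j : i != j -> root_space G (rt i j) (c *: rvec i j).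
Proof.
move=> ij; apply/root_spaceE; split=> [_|k l]; first by rewrite mxtraceZ rvec_tr // mulr0.
rewrite AdZ cj_rvec !mxE; case: (eqVneq k i) => [->|_]; last by rewrite mulr0 eqxx.
by case: (eqVneq l j) => [->//|_]; rewrite mulr0 eqxx.
Qed.

Lemma root_space_line i j X : i != j -> root_space G (rt i j) X -> X = cj X i j *: rvec i j.
Proof.
move=> ij /root_spaceE[_ aX]; apply/cj_inj/matrixP => k l; rewrite AdZ cj_rvec entE [delta_mx _ _ _ _]mxE.
have [E|/aX/esym/(rt_inj ij)[<- <-]] := eqVneq (cj X k l) 0; last by rewrite !eqxx mulr1.
case: andP => [[/eqP ki /eqP lj]|_]; last by rewrite E mulr0.
by rewrite -ki -lj mulr1.
Qed.

(** By [rt_inj] only the off-diagonal part of [r] matters and is determined, so operations on sets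
    of roots become boolean operations and their cardinals count pairs. *)
Definition roots_of (r : rel 'I_n) : set dual :=
  [set rt ij.1 ij.2 | ij in [set` [pred ij : 'I_n * 'I_n | (ij.1 != ij.2) && r ij.1 ij.2]]].

Lemma roots_ofP r a : roots_of r a <-> exists i j, [/\ i != j, r i j & a = rt i j].
Proof.
split=> [[[i j] /andP[/= ij rij] <-]|[i [j [ij rij ->]]]]; first by exists i, j.
by exists (i, j) => //=; apply/andP.
Qed.

Lemma roots_of_rt r i j : i != j -> roots_of r (rt i j) <-> r i j.
Proof.
move=> ij; split=> [/roots_ofP[k [l [_ rkl /(rt_inj ij)[-> ->]]]]//|rij].
by apply/roots_ofP; exists i, j.
Qed.

Lemma eq_roots_of r e : (forall i j, i != j -> r i j = e i j) -> roots_of r = roots_of e.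
Proof.
move=> re; rewrite predeqE => a.
by split=> /roots_ofP[i [j [ij rij ->]]]; apply/(roots_of_rt _ ij); move: rij; rewrite re.
Qed.

Lemma root_set_rt : root_set G = roots_of (fun _ _ => true).
Proof.
rewrite predeqE => a; split=> [[a0 [X /root_spaceE[_ aX] X0]]|/roots_ofP[i [j [ij _ ->]]]].
  have [i [j Xij]] : exists i j, cj X i j != 0.
    apply: contrapT => nX; case/eqP: X0; apply/cj_inj/matrixP => i j; rewrite Ad0 [RHS]mxE.
    by apply/eqP; apply: contrapT => /negP Xij; apply: nX; exists i, j.
  apply/roots_ofP; exists i, j; rewrite (aX _ _ Xij); split=> //.
  by apply: contra_neq a0 => ij; rewrite -(aX _ _ Xij) ij rt_self.
split; first exact: rt_neq0.
exists (rvec i j); first by rewrite -[rvec i j]scale1r; apply: root_space_rvec.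
apply/eqP => /(congr1 cj); rewrite cj_rvec Ad0 => /matrixP/(_ i j); rewrite !mxE !eqxx.
by apply/eqP; rewrite oner_eq0.
Qed.

Lemma roots_in_rt (S : set 'M[F]_n) r :
  (forall i j, i != j -> (forall c, S (c *: rvec i j)) <-> r i j) -> roots_in G S = roots_of r.
Proof.
move=> Sr; rewrite predeqE => a; split.
  move=> [+ aS]; rewrite root_set_rt => /roots_ofP[i [j [ij _ aE]]].
  apply/roots_ofP; exists i, j; split=> //; apply/(Sr i j ij) => c; apply: aS.
  by rewrite aE; apply: root_space_rvec.
move=> /roots_ofP[i [j [ij /(Sr i j ij) rij ->]]]; split; first by rewrite root_set_rt roots_of_rt.
by move=> X /(root_space_line ij)->; apply: rij.
Qed.

Lemma pos_rootsE : pos_roots G B = roots_of (fun i j => i < j)%N.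
Proof.
apply: roots_in_rt => i j ij; split=> [/(_ 1)/lie_borel[]|lij c].
  rewrite scale1r cj_rvec => /(_ i j); rewrite mxE !eqxx ltn_neqAle val_eqE ij /=.
  by case: (boolP (up i j)) => // _ /(_ isT)/eqP; rewrite oner_eq0.
apply/lie_borel; split; last by rewrite mxtraceZ rvec_tr // mulr0.
move=> k l; rewrite AdZ cj_rvec !mxE /up => kl.
case: eqP => [E|]; last by rewrite mulr0.
by case: eqP => [E'|]; rewrite ?mulr0 //; move: kl; rewrite E E' ltnW.
Qed.

Lemma neg_rootsE : neg_roots G B = roots_of (fun i j => j < i)%N.
Proof.
rewrite /neg_roots pos_rootsE predeqE => a; split.
  move=> [_ /roots_ofP[i [j [ij lij ->]]] <-]; apply/roots_ofP.
  by exists j, i; rewrite rt_opp eq_sym.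
move=> /roots_ofP[i [j [ij lij ->]]]; exists (rt j i); last by rewrite rt_opp.
by apply/roots_ofP; exists j, i; rewrite eq_sym.
Qed.

Lemma roots_of_finite r : finite_set (roots_of r).
Proof. exact: finite_image. Qed.

Lemma roots_ofI r e : roots_of r `&` roots_of e = roots_of (fun i j => r i j && e i j).
Proof.
rewrite predeqE => a; split=> [[/roots_ofP[i [j [ij rij ->]]] /(roots_of_rt _ ij) eij]|].
  by apply/roots_of_rt => //; rewrite rij.
by move=> /roots_ofP[i [j [ij /andP[rij eij] ->]]]; split; apply/roots_of_rt.
Qed.

Lemma roots_ofD r e : roots_of r `\` roots_of e = roots_of (fun i j => r i j && ~~ e i j).
Proof.
rewrite predeqE => a; split=> [[/roots_ofP[i [j [ij rij ->]]] /(roots_of_rt _ ij)/negP eij]|].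
  by apply/roots_of_rt => //; rewrite rij.
move=> /roots_ofP[i [j [ij /andP[rij eij] ->]]]; split; first exact/roots_of_rt.
by move=> /(roots_of_rt _ ij); apply/negP.
Qed.

Lemma card_roots_of r :
  #|` fset_set (roots_of r)|%fset = #|[pred ij : 'I_n * 'I_n | (ij.1 != ij.2) && r ij.1 ij.2]|.
Proof.
rewrite fset_set_image // card_in_imfset /=; last first.
  move=> [i j] [k l]; rewrite !in_fset_set // !mem_setE !inE /= => /andP[ij _] _.
  by move=> /(rt_inj ij)[-> ->].
rewrite cardE; apply/perm_size/uniq_perm; rewrite ?fset_uniq ?enum_uniq //.
by move=> ij; rewrite in_fset_set // mem_enum mem_setE.
Qed.

Lemma Ad_sum (I : Type) (r : seq I) (Q : pred I) (X : I -> 'M[F]_n) (g : 'M[F]_n) :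
  Ad g (\sum_(i <- r | Q i) X i) = \sum_(i <- r | Q i) Ad g (X i).
Proof. exact: (big_morph _ (AdD g) (Ad0 g)). Qed.

Lemma sum_root_vectors r (Y : dual -> 'M[F]_n) k l :
  (forall a, roots_of r a -> root_space G a (Y a)) ->
  cj (\sum_(a \in roots_of r) Y a) k l =
  if (k != l) && r k l then cj (Y (rt k l)) k l else 0.
Proof.
move=> aY; rewrite fsbig_finite; last exact: roots_of_finite.
 rewrite Ad_sum summxE.
have z a : roots_of r a -> rt k l != a -> cj (Y a) k l = 0.
  move=> /aY/root_spaceE[_ /(_ k l)] H; case: (eqVneq (cj (Y a) k l) 0) => // /H->.
  by rewrite eqxx.
have mem a : (a \in fset_set (roots_of r)) = (a \in roots_of r).
  by rewrite in_fset_set //; apply: roots_of_finite.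
have [/andP[kl rkl]|nkl] := boolP ((k != l) && r k l).
  rewrite (bigD1_seq (rt k l)) ?fset_uniq //=; last first.
    by rewrite mem; apply/mem_set/roots_of_rt.
  rewrite big_seq_cond big1 ?addr0 // => a /andP[]; rewrite mem => /set_mem aR.
  by rewrite eq_sym => /(z _ aR).
rewrite big_seq big1 // => a; rewrite mem => /set_mem aR; apply: z => //.
apply: contraNneq nkl => E; have /roots_ofP[i [j [ij rij aE]]] := aR.
by have [<- <-] := rt_inj ij (etrans (esym aE) (esym E)); rewrite ij.
Qed.

Lemma root_sumE r X : (forall i, ~~ r i i) ->
  root_sum G (roots_of r) X <-> masked r (cj X).
Proof.
move=> rii; split=> [[Y [aY ->]] i j rij|rX].
  by rewrite sum_root_vectors // (negPf rij) andbF.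
pose Y a := Ad P (\matrix_(i, j) if rt i j == a then cj X i j else 0).
have aY a : roots_of r a -> root_space G a (Y a).
  move=> _; apply/root_spaceE; rewrite AdK //; split=> [_|i j].
    by rewrite Ad_tr // /mxtrace big1 // => i _; rewrite mxE rX // if_same.
  by rewrite mxE; case: (rt i j =P a) => // _; rewrite eqxx.
exists Y; split=> //; apply/cj_inj/matrixP => i j; rewrite sum_root_vectors //.
case: ifP => [_|/negbT]; first by rewrite AdK // [RHS]mxE eqxx.
rewrite negb_and negbK => /orP[/eqP<-|]; exact: rX.
Qed.

Definition diag_part X : 'M[F]_n := Ad P (\matrix_(i, j) if i == j then cj X i j else 0).

Lemma diag_part_cartan X : lie_algebra G X -> diag_part X \in h.
Proof.
move=> /lie_grp gX; apply/mem_cartan; rewrite AdK //; split.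
  by move=> i j; rewrite /diag_rel => ij; rewrite mxE (negPf ij).
move=> /gX <-; rewrite Ad_tr // -[RHS](Ad_tr _ uPV); apply: eq_bigr => i _.
by rewrite [LHS]mxE eqxx.
Qed.

Lemma cj_off_diag X i j : cj (X - diag_part X) i j = if i == j then 0 else cj X i j.
Proof.
by rewrite AdB AdK //; move: (cj X) => A; rewrite !mxE; case: ifP; rewrite ?subrr ?subr0.
Qed.

Lemma root_supportE X : lie_algebra G X ->
  root_support G X = roots_of (fun i j => cj X i j != 0).
Proof.
move=> gX; rewrite /root_support root_set_rt predeqE => a; split.
  move=> [/roots_ofP[i [j [ij _ ->]]] [X0 [Y [X0h aY XE Ya]]]].
  apply/roots_of_rt => //; apply: contra_neq Ya => Xij.
  have [d0 _] := (mem_cartan X0).1 X0h.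
  have := congr1 (fun Z : 'M_n => cj Z i j) XE; rewrite Xij AdD entE d0 // add0r.
  rewrite sum_root_vectors // ij /= => E; rewrite (root_space_line ij (aY _ _)) -?E ?scale0r //.
  by apply/roots_of_rt.
move=> /roots_ofP[i [j [ij Xij ->]]]; split; first exact/roots_of_rt.
have : root_sum G (roots_of (fun i j => i != j)) (X - diag_part X).
  apply/root_sumE => [k|k l]; first by rewrite eqxx.
  by rewrite negbK cj_off_diag => ->.
rewrite (@eq_roots_of _ (fun _ _ => true)); last by move=> ? ? ->.
move=> [Y [aY YE]]; exists (diag_part X), Y; split=> //.
- exact: diag_part_cartan.
- by rewrite -YE addrC subrK.
apply: contra_neq Xij => Y0.
have := congr1 (fun Z : 'M_n => cj Z i j) YE.
by rewrite cj_off_diag (negPf ij) sum_root_vectors // ij /= Y0 Ad0 => ->; rewrite mxE.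
Qed.

Lemma root_supports_eq (S : set 'M[F]_n) r : (forall X, S X -> lie_algebra G X) ->
  (forall i j, i != j -> (exists2 X, S X & cj X i j != 0) <-> r i j) ->
  root_supports h G S = roots_of r.
Proof.
move=> SG Sr; rewrite predeqE => a; split.
  move=> [X SX]; rewrite root_supportE; last exact: SG.
  by move=> /roots_ofP[i [j [ij Xij ->]]]; apply/roots_of_rt => //; apply/Sr => //; exists X.
move=> /roots_ofP[i [j [ij /(Sr i j ij)[X SX Xij] ->]]]; exists X => //.
by rewrite root_supportE; [apply/roots_of_rt|exact: SG].
Qed.

(** * The Levi subalgebra and the nilradical attached to the eigenvalues of [s] *)

Section Levi.
Variables (s : 'M[F]_n) (sigma : 'I_n -> F).
Hypotheses (sh : s \in h) (sE : forall i, cj s i i = sigma i).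
Hypothesis sigma_convex :
  forall i j k : 'I_n, (i <= j <= k)%N -> sigma i = sigma k -> sigma i = sigma j.

(** [rt i j] takes the value [j - i] on it, so that the roots [rt i i.+1] are
    indecomposable; the mean value makes the trace vanish. *)
Definition height_elt : 'M[F]_n :=
  Ad P (diag_mx (\row_k ((\sum_(m < n) (m%:R : F)) / n%:R - k%:R))).

Lemma cj_height k : cj height_elt k k = (\sum_(m < n) (m%:R : F)) / n%:R - k%:R.
Proof. by rewrite AdK // !mxE eqxx. Qed.

Lemma height_cartan : height_elt \in h.
Proof.
apply/mem_cartan; rewrite AdK //; split=> [i j|_]; first by rewrite !mxE /diag_rel => /negPf->.
rewrite Ad_tr // mxtrace_diag; under eq_bigr do rewrite mxE.
rewrite sumrB sumr_const card_ord -[X in X - _]mulr_natr divfK ?subrr // pnatr_eq0.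
by rewrite -lt0n (leq_ltn_trans _ (ltn_ord i0)).
Qed.

Lemma rt_height i j : rt i j (vsproj h height_elt) = j%:R - i%:R.
Proof. by rewrite rt_val ?height_cartan // !cj_height; ring. Qed.

Lemma simple_rt i j : j = i.+1 :> nat -> simple_roots G B (rt i j).
Proof.
move=> ji; have ij : i != j by rewrite -val_eqE /= ji neq_ltn leqnn.
rewrite /simple_roots pos_rootsE; split; first by apply/roots_of_rt; rewrite // ji.
move=> [b [c [/roots_ofP[k [l [_ kl ->]]] /roots_ofP[k' [l' [_ kl' ->]]] E]]].
have := congr1 (fun a : dual => a (vsproj h height_elt)) E.
rewrite add_lfunE !rt_height -!natrB ?ji // ?(ltnW kl) ?(ltnW kl') // -natrD.
move=> /eqP; rewrite eqr_nat => /eqP; lia.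
Qed.

Let S : set dual := [set b | simple_roots G B b /\ b (vsproj h s) = 0].

Let Sfin : finite_set S.
Proof.
apply: (sub_finite_set _ (roots_of_finite (fun i j => i < j)%N)).
by move=> b [[+ _] _]; rewrite pos_rootsE.
Qed.

Let comb a := exists c : dual -> int, a = \sum_(b \in S) b *~ c b.

Let combD a b : comb a -> comb b -> comb (a + b).
Proof.
move=> [c ->] [d ->]; exists (fun b => c b + d b); rewrite -fsbig_split //=.
by apply: eq_fsbigr => x _; rewrite mulrzDr.
Qed.

Let combN a : comb a -> comb (- a).
Proof.
move=> [c ->]; exists (fun b => - c b); rewrite !fsbig_finite //= -sumrN.
by apply: eq_bigr => x _; rewrite mulrNz.
Qed.

Let comb1 b : S b -> comb b.
Proof.
move=> Sb; exists (fun b' => (b' == b)%:Z); rewrite fsbig_finite //=.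
rewrite (bigD1_seq b) ?fset_uniq //=; last by rewrite in_fset_set //; apply/mem_set.
by rewrite eqxx big1 ?addr0 // => x /negPf->.
Qed.

(** By convexity all indices between i and j share their eigenvalue, so the root telescopes into
    simple roots that vanish on [s]. *)
Let comb_chain m i j : j = (i + m)%N :> nat -> sigma i = sigma j -> comb (rt i j).
Proof.
elim: m j => [|m IHm] j jE ij.
  have -> : j = i by apply: val_inj; rewrite /= jE addn0.
  exists (fun=> 0); rewrite rt_self fsbig_finite //= big1 // => x _.
have mn : (i + m < n)%N by apply: leq_ltn_trans (ltn_ord j); rewrite jE leq_add2l.
pose k := Ordinal mn.
have ik : sigma i = sigma k by apply: (@sigma_convex i k j) => //; rewrite /= jE; lia.
rewrite -(rt_add i k j); apply: combD; first exact: IHm.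
apply: comb1; split; first by apply: simple_rt; rewrite jE addnS.
by rewrite rt_val // !sE -ik ij subrr.
Qed.

Lemma levi_rootsE : levi_roots s G B = roots_of (same_eigen sigma).
Proof.
rewrite predeqE => a; split.
  move=> [+ [c E]]; rewrite root_set_rt => /roots_ofP[i [j [ij _ aE]]].
  rewrite aE; apply/roots_of_rt => //; rewrite /same_eigen -subr_eq0 -!sE -rt_val // -aE E.
  rewrite fsbig_finite //= sum_lfunE big_seq big1 // => b.
  rewrite in_fset_set // => /set_mem[_ bs].
  have zE (x : dual) (z : int) (Y : subvs_of h) : x Y = 0 -> (x *~ z) Y = 0.
    move=> xY; have nE m : (x *+ m) Y = 0.
      by elim: m => [|m IHm]; rewrite ?mulr0n ?lfunE // mulrS add_lfunE xY IHm addr0.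
    by case: z => m; rewrite ?nE // NegzE mulrNz opp_lfunE nE oppr0.
  exact: zE.
move=> /roots_ofP[i [j [ij /eqP sij ->]]]; split; first by rewrite root_set_rt roots_of_rt.
have [lij|lji] := leqP i j; first by apply: (comb_chain (m := j - i)) => //; rewrite subnKC.
rewrite -rt_opp; apply: combN; apply: (comb_chain (m := i - j)) => //.
by rewrite subnKC // ltnW.
Qed.

Lemma levi_subalgebraE : levi_subalgebra h s G B =
  [set X | masked (same_eigen sigma) (cj X) /\ (sl -> \tr X = 0)].
Proof.
have E : roots_of (same_eigen sigma) = roots_of (fun i j => (i != j) && same_eigen sigma i j).
  by apply: eq_roots_of => i j ->.
rewrite predeqE /levi_subalgebra levi_rootsE E => X; split.
  move=> [X0 [X1 [/mem_cartan[d0 t0] /root_sumE m1 ->]]].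
  have {}m1 := m1 (fun i => _ : ~~ ((i != i) && same_eigen sigma i i)).
  have {}m1 : masked (fun i j => (i != j) && same_eigen sigma i j) (cj X1).
    by apply: m1 => k; rewrite eqxx.
  split=> [i j ij|sL].
    rewrite AdD entE m1 ?(negPf ij) ?andbF // addr0; apply: d0.
    by apply: contraNN ij => /eqP->; apply: same_eigen_refl.
  rewrite raddfD /= t0 // add0r -(Ad_tr _ uPV) /mxtrace big1 // => k _.
  by rewrite m1 // eqxx.
move=> [mX tX]; exists (diag_part X), (X - diag_part X); split; last by rewrite addrC subrK.
  by apply/diag_part_cartan/lie_grp.
apply/root_sumE => [k|k l]; first by rewrite eqxx.
by rewrite negb_and negbK cj_off_diag; case: eqP => //= _ /mX.
Qed.

Lemma nilradicalE : nilradical h s G B =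
  [set X | masked (fun i j => (i < j)%N && ~~ same_eigen sigma i j) (cj X)].
Proof.
rewrite predeqE /nilradical levi_rootsE pos_rootsE roots_ofD => X.
by rewrite root_sumE // => k; rewrite ltnn.
Qed.

Lemma nilradical_supports :
  root_supports h G (nilradical h s G B) = roots_of (fun i j => (i < j)%N && ~~ same_eigen sigma i j).
Proof.
rewrite nilradicalE; apply: root_supports_eq => [X mX|i j ij].
  apply/lie_grp => _; rewrite -(Ad_tr _ uPV) /mxtrace big1 // => k _.
  by rewrite mX // ltnn.
split=> [[X mX]|rij]; first by apply: contraNT => /mX->.
exists (rvec i j); rewrite ?cj_rvec ?mxE ?eqxx ?oner_eq0 //.
move=> k l /=; rewrite cj_rvec mxE; case: eqP => //= ->; case: eqP => // ->.
by rewrite rij.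
Qed.

Definition levi : set 'M[F]_n := mgroup sl P (same_eigen sigma).

Lemma levi_levi_subgroup : levi_subgroup h s G B levi.
Proof.
split; first by apply: mgroup_cc => //; [apply: same_eigen_refl|apply: same_eigen_trans].
rewrite levi_subalgebraE predeqE => X; apply: lie_mgroup => //.
  exact: same_eigen_refl.
exact: same_eigen_trans.
Qed.

End Levi.

(** * The torus, its normaliser and the action of the Weyl group *)

Lemma torusE : torus h G = mgroup sl P diag_rel.
Proof.
rewrite predeqE => t; split=> [[Gt ct]|[Gt dt]]; split=> //.
  move=> i j; rewrite /diag_rel => ij.
  have : cj (bracket (coroot i j) t) i j = 0.
    by rewrite /bracket ct ?coroot_cartan // subrr Ad0 mxE.
  rewrite bracket_cartan ?coroot_cartan // !cj_coroot !eqxx (negPf ij) [j == i]eq_sym.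
  rewrite (negPf ij) subr0 sub0r opprK => /eqP; rewrite mulf_eq0 => /orP[|/eqP//].
  by rewrite -(natrD _ 1 1) pnatr_eq0.
move=> X Xh; apply/esym/eqP; rewrite -subr_eq0 -/(bracket X t); apply/eqP/cj_inj.
apply/matrixP => i j; rewrite bracket_cartan // Ad0 [RHS]mxE.
by have [->|ij] := eqVneq i j; rewrite ?subrr ?mul0r // dt ?mulr0.
Qed.

Lemma cj_Ad w X : w \in unitmx -> cj (Ad w X) = Ad (cj w) (cj X).
Proof.
by move=> uw; rewrite -[RHS]/(cj w *m cj X *m invmx (cj w)) -Ad_inv // -2?AdM.
Qed.

Lemma diag_mono (p : {perm 'I_n}) (t : 'I_n -> F) (A : 'M[F]_n) : (forall j, t j != 0) ->
  masked diag_rel A -> masked diag_rel (Ad (invmx (mono p t)) A).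
Proof.
move=> t0 dA i j ij; rewrite Ad_mono // dA ?mulr0 ?mul0r //.
by rewrite /diag_rel (inj_eq perm_inj).
Qed.

(** If row i had nonzero entries in columns j and j', conjugating the diagonal matrix of determinant
    1 with entries 2 at j and 1/2 at j' to a diagonal one would force 2 = 1/2. So each row has a
    single nonzero entry, and invertibility puts these in distinct columns. *)
Lemma normalizer_mono w : G w -> (forall t, mgroup sl P diag_rel t -> mgroup sl P diag_rel (Ad w t)) ->
  exists p t, cj w = mono p t.
Proof.
move=> [uw dw] Tw; set W := cj w; have uW : W \in unitmx by rewrite Ad_unit.
have row1 i j j' : W i j != 0 -> W i j' != 0 -> j = j'.
  move=> Wj Wj'; apply/eqP; apply: contraT => jj'.
  pose d : 'rV[F]_n := \row_k (if k == j then 2 else if k == j' then 2^-1 else 1).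
  have n2 : (2 : F) != 0 by rewrite pnatr_eq0.
  have dd : \det (diag_mx d) = 1.
    rewrite det_diag (bigD1 j) //= (bigD1 j') 1?eq_sym //= !mxE eqxx eq_sym (negPf jj') eqxx.
    rewrite big1 ?mulr1 ?mulfV // => k /andP[/negPf kj /negPf kj'].
    by rewrite mxE kj kj'.
  have Td : mgroup sl P diag_rel (Ad P (diag_mx d)).
    split; last by rewrite AdK // => k l /negPf kl; rewrite !mxE -/(diag_rel k l) kl.
    by split=> [|_]; rewrite ?Ad_det // Ad_unit // unitmxE dd unitr1.
  have [_] := Tw _ Td; rewrite cj_Ad // AdK // -/W; set D := Ad W _ => dD.
  have E : W *m diag_mx d = D *m W by rewrite /D /Ad mulmxKV.
  have Ek k : W i k != 0 -> d 0 k = D i i.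
    move=> Wk; have := congr1 (fun A : 'M_n => A i k) E.
    rewrite mul_mx_diag mxE [RHS]mxE (bigD1 i) //= big1 ?addr0 => [|l li].
      by rewrite mulrC => /(mulIf Wk).
    by rewrite dD ?mul0r // /diag_rel eq_sym.
  have := etrans (Ek _ Wj) (esym (Ek _ Wj')); rewrite !mxE eqxx [j' == j]eq_sym (negPf jj') eqxx.
  move/(congr1 (fun x => x * 2)); rewrite mulVf // => /eqP.
  by rewrite -(natrM _ 2 2) (eqr_nat _ 4 1).
have exq i : exists j, W i j != 0.
  apply: contrapT => nW; move: uW; rewrite -row_free_unit => /row_free_inj inj; have := inj 1%N.
  move=> /(_ (delta_mx 0 i) 0); rewrite -rowE mul0mx => H.
  have /matrixP/(_ 0 i) : delta_mx 0 i = 0 :> 'rV[F]_n.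
    apply: H; apply/rowP => j; rewrite [LHS]mxE [RHS]mxE; apply/eqP; apply: contraT => Wij.
    by case: nW; exists j.
  by rewrite !mxE !eqxx => /eqP; rewrite oner_eq0.
have [q qE] := choice exq.
have q0 i j : j != q i -> W i j = 0.
  move=> jq; apply/eqP; apply: contraT => Wij; case/eqP: jq; exact: row1 Wij (qE i).
have q_inj : injective q.
  move=> i i' E; apply/eqP; apply: contraT => ii'.
  move: uW; rewrite -row_free_unit => /row_free_inj inj; have := inj 1%N.
  move=> /(_ (W i' (q i) *: delta_mx 0 i) (W i (q i) *: delta_mx 0 i')).
  rewrite -!scalemxAl -!rowE => H.
  have /matrixP/(_ 0 i') : W i' (q i) *: delta_mx 0 i = W i (q i) *: delta_mx 0 i' :> 'rV[F]_n.
    apply: H; apply/rowP => j; rewrite !scalemxE ![row _ _ _ _]mxE.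
    have [->|jq] := eqVneq j (q i); first by rewrite mulrC.
    by rewrite (q0 i j) // (q0 i' j) -?E // !mulr0.
  rewrite !scalemxE ![delta_mx _ _ _ _]mxE !eqxx [i' == i]eq_sym (negPf ii') mulr0 mulr1.
  move=> /esym/eqP.
  by rewrite (negPf (qE i)).
exists ((perm q_inj)^-1)%g, (fun j => W (((perm q_inj)^-1)%g j) j).
apply/matrixP => i j; rewrite [RHS]mxE; case: eqP => [->//|/eqP ij].
by apply: q0; apply: contraNneq ij => ->; rewrite -[q i](permE q_inj) permK.
Qed.

Lemma weyl_repP w : weyl_rep h G w <-> G w /\ exists p t, cj w = mono p t.
Proof.
rewrite /weyl_rep torusE; split=> [[Gw TE]|[Gw [p [t wE]]]]; split=> //.
  apply: normalizer_mono => // t Tt; rewrite -TE; by exists t.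
have [uw _] := Gw; have [_ _ GM GV] := @grp_subgroup F n sl.
have uW : mono p t \in unitmx by rewrite -wE Ad_unit.
have t0 := mono_det_neq0 uW.
have GAd x y : G x -> G y -> G (Ad x y) by move=> Gx Gy; apply: (GM _ _ (GM _ _ Gx Gy) (GV _ Gx)).
rewrite eqEsubset; split=> [_ [x [Gx dx] <-]|x [Gx dx]].
  split; first exact: GAd.
  rewrite cj_Ad // wE -[mono p t]invmxK mono_inv //; apply: diag_mono => // j.
  by rewrite invr_neq0.
have GVx : G (Ad (invmx w) x) by apply: GAd => //; apply: GV.
exists (Ad (invmx w) x); last by rewrite AdKV.
split=> //; rewrite cj_Ad ?unitmx_inv // Ad_inv // wE; exact: diag_mono.
Qed.

Section Weyl.
Variables (w : 'M[F]_n) (p : {perm 'I_n}) (t : 'I_n -> F).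
Hypotheses (Gw : G w) (wE : cj w = mono p t).

Let uw : w \in unitmx. Proof. by case: Gw. Qed.

Lemma weyl_t_neq0 j : t j != 0.
Proof. by apply: (@mono_det_neq0 _ _ p); rewrite -wE Ad_unit. Qed.

Lemma cj_weyl X i j : cj (Ad (invmx w) X) i j = (t i)^-1 * cj X (p i) (p j) * t j.
Proof. by rewrite cj_Ad ?unitmx_inv // Ad_inv // wE Ad_mono //; apply: weyl_t_neq0. Qed.

Lemma weyl_actE i j : weyl_act w (rt i j) = rt (p i) (p j).
Proof.
apply/lfunP => Y; rewrite linear_linfunE; last first.
  by move=> c Y1 Y2; rewrite linearP AdD AdZ !linearP.
have Yh : Ad (invmx w) (vsval Y) \in h.
  have [dY tY] := (mem_cartan _).1 (subvsP Y); apply/mem_cartan; split.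
    rewrite cj_Ad ?unitmx_inv // Ad_inv // wE; apply: diag_mono => //; exact: weyl_t_neq0.
  by rewrite Ad_tr ?unitmx_inv.
rewrite rt_val // rtE !cj_weyl.
by congr (_ - _); rewrite mulrAC mulVf ?mul1r // weyl_t_neq0.
Qed.

Lemma weyl_act_roots r :
  weyl_act w @` roots_of r = roots_of (fun i j => r ((p^-1)%g i) ((p^-1)%g j)).
Proof.
rewrite predeqE => a; split.
  move=> [_ /roots_ofP[i [j [ij rij ->]]] <-]; apply/roots_ofP.
  by exists (p i), (p j); rewrite weyl_actE !permK (inj_eq perm_inj).
move=> /roots_ofP[i [j [ij rij ->]]]; exists (rt ((p^-1)%g i) ((p^-1)%g j)).
  by apply/roots_of_rt; rewrite // (inj_eq perm_inj).
by rewrite weyl_actE !permKV.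
Qed.

Lemma inversionsE :
  inversions h G B w = roots_of (fun i j => (i < j)%N && ((p^-1)%g j < (p^-1)%g i)%N).
Proof. by rewrite /inversions pos_rootsE neg_rootsE weyl_act_roots roots_ofI. Qed.

End Weyl.

(** * Hessenberg spaces as staircases of matrix positions *)

Section Hessenberg.
Variable H : {vspace 'M[F]_n}.
Hypothesis HH : hessenberg_space G B H.

(** The diagonal is put in by hand: H contains the Cartan subalgebra, but for SL_n it cannot contain
    [rvec i i], whose trace is 1. *)
Definition hess : rel 'I_n := fun i j => (i == j) || (rvec i j \in H).

Lemma roots_in_hess : roots_in G [set X | X \in H] = roots_of hess.
Proof.
apply: roots_in_rt => i j ij; rewrite /hess (negPf ij) /=; split=> [/(_ 1)|Hij c].
  by rewrite scale1r.
by rewrite /= memvZ.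
Qed.

Lemma hess_up i j : (i <= j)%N -> hess i j.
Proof.
move=> lij; rewrite /hess; have [//|ij /=] := eqVneq i j.
have [HB _ _] := HH; apply: HB; apply/lie_borel; split; last by rewrite rvec_tr.
move=> k l; rewrite cj_rvec mxE; case: eqP => //= ->; case: eqP => //= ->.
by rewrite /up lij.
Qed.

Lemma bracket_rvec i j k l : l != i -> bracket (rvec i j) (rvec k l) = if j == k then rvec i l else 0.
Proof.
move=> li; apply: cj_inj; rewrite Ad_bracket // !cj_rvec /bracket.
rewrite !mul_delta_mx_cond (negPf li) mulr0n subr0.
by case: (j == k); rewrite ?mulr1n ?mulr0n ?cj_rvec ?Ad0.
Qed.

Lemma lie_borel_rvec i j : (i < j)%N -> lie_algebra B (rvec i j).
Proof.
move=> ij; have nij : i != j by rewrite -val_eqE neq_ltn ij.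
apply/lie_borel; split; last by rewrite rvec_tr.
move=> k l; rewrite cj_rvec mxE; case: eqP => //= ->; case: eqP => //= ->.
by rewrite /up ltnW.
Qed.

(** The bracket with the root vector of (i, k) moves a position up its column; [hess_right] moves it
    along its row. *)
Lemma hess_left i k l : hess k l -> (i <= k)%N -> hess i l.
Proof.
move=> Hkl ik; have [_ _ HB] := HH.
have [->|nik] := eqVneq i k; first by [].
have lik : (i < k)%N by rewrite ltn_neqAle nik.
move: Hkl => /orP[/eqP<-|Hkl]; first exact: hess_up.
rewrite /hess; have [//|il /=] := eqVneq i l.
have := HB _ _ (lie_borel_rvec lik) Hkl.
by rewrite bracket_rvec 1?eq_sym // eqxx.
Qed.

Lemma hess_right k l j : hess k l -> (l <= j)%N -> hess k j.
Proof.
move=> Hkl lj; have [_ _ HB] := HH.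
have [<-|nlj] := eqVneq l j; first by [].
have llj : (l < j)%N by rewrite ltn_neqAle nlj.
move: Hkl => /orP[/eqP->|Hkl]; first exact: hess_up.
rewrite /hess; have [//|kj /=] := eqVneq k j.
have := HB _ _ (lie_borel_rvec llj) Hkl.
have -> : bracket (rvec l j) (rvec k l) = - bracket (rvec k l) (rvec l j) by rewrite /bracket opprB.
by rewrite bracket_rvec 1?eq_sym // eqxx rpredN.
Qed.

Lemma hess_trans i j k l : hess k l -> (i <= k)%N -> (l <= j)%N -> hess i j.
Proof. by move=> Hkl ik lj; apply: hess_right lj; apply: hess_left ik. Qed.

(** [2] is an eigenvalue of the coroot of [rt i j] on the root space of [rt i j]
    only, the others being [0], [1], [-1], [-2]. *)
Lemma mem_hess_entry X i j : X \in H -> i != j -> cj X i j != 0 -> rvec i j \in H.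
Proof.
move=> XH ij Xij; have [hB _ HB] := HH.
pose T := bracket (coroot i j).
have TH Y : Y \in H -> T Y \in H by apply: HB; apply/cartan_borel/coroot_cartan.
pose m k l : F := (k == i)%:R - (k == j)%:R - ((l == i)%:R - (l == j)%:R).
have TE Y k l : cj (T Y) k l = m k l * cj Y k l.
  by rewrite bracket_cartan ?coroot_cartan // !cj_coroot.
(* The factors T, T - 1, T + 1, T + 2 kill the unwanted eigenvalues; on the eigenvalue 2 their
   product is 2 * 1 * 3 * 4 = 24. *)
pose X1 := T X; pose X2 := T X1 - X1; pose X3 := T X2 + X2; pose X4 := T X3 + 2 *: X3.
have H1 : X1 \in H by apply: TH.
have H2 : X2 \in H by rewrite memvB ?TH.
have H3 : X3 \in H by rewrite memvD ?TH.
have H4 : X4 \in H by rewrite memvD ?TH ?memvZ.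
have n24 : (24%:R : F) != 0 by rewrite pnatr_eq0.
suff E : X4 = (24%:R * cj X i j) *: rvec i j.
  by rewrite -[rvec i j](scalerK (mulf_neq0 n24 Xij)) -E memvZ.
apply/cj_inj/matrixP => k l; rewrite AdZ cj_rvec [RHS]scalemxE [delta_mx _ _ _ _]mxE.
rewrite AdD AdZ !entE TE AdD entE TE AdB !entE TE TE.
have [->|ki] := eqVneq k i; have [->|lj] := eqVneq l j.
- by rewrite /m !eqxx (negPf ij) [j == i]eq_sym (negPf ij) /=; ring.
- rewrite /m !eqxx (negPf ij) (negPf lj) /=; case: (l == i) => /=; ring.
- rewrite /m !eqxx [j == i]eq_sym (negPf ij) (negPf ki) /=; case: (k == j) => /=; ring.
- rewrite /m (negPf ki) (negPf lj) /=; case: (k == j); case: (l == i) => /=; ring.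
Qed.

Lemma mem_hess X : X \in H <->
  lie_algebra G X /\ forall i j, cj X i j != 0 -> hess i j.
Proof.
have [HB HG _] := HH; split=> [XH|[gX Xh]].
  split; first exact: HG.
  move=> i j Xij; rewrite /hess; have [//|ij /=] := eqVneq i j.
  exact: mem_hess_entry XH ij Xij.
have -> : X = diag_part X + \sum_i \sum_(j | i != j) cj X i j *: rvec i j.
  apply/eqP; rewrite -subr_eq0 opprD addrA; apply/eqP/cj_inj/matrixP => k l.
  rewrite AdB entE entE cj_off_diag Ad0 [RHS]mxE Ad_sum summxE.
  under eq_bigr => i _.
    rewrite Ad_sum summxE.
    under eq_bigr do rewrite AdZ cj_rvec scalemxE [delta_mx _ _ _ _]mxE.
    over.
  rewrite (bigD1 k) //= [X in - (_ + X)]big1 ?addr0 => [|i ik]; last first.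
    by rewrite big1 // => j _; rewrite eq_sym (negPf ik) mulr0.
  have [->|kl] := eqVneq k l.
    by rewrite big1 ?subr0 // => j lj; rewrite [l == j](negPf lj) andbF mulr0.
  rewrite (bigD1 l) //= [X in - (_ + X)]big1 ?addr0 => [|j /andP[_ jl]].
    by rewrite !eqxx mulr1 subrr.
  by rewrite [l == j]eq_sym (negPf jl) andbF mulr0.
apply: memvD; first by apply/HB/cartan_borel/diag_part_cartan.
apply: memv_suml => i _; apply: memv_suml => j ij.
have [->|/Xh] := eqVneq (cj X i j) 0; first by rewrite scale0r mem0v.
by rewrite /hess (negPf ij) => /memvZ.
Qed.

Lemma hess_complementE w p (t : 'I_n -> F) : G w -> cj w = mono p t ->
  hessenberg_complement h G B H w =
  roots_of (fun i j => (i < j)%N && ~~ hess ((p^-1)%g i) ((p^-1)%g j)).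
Proof.
move=> Gw wE; rewrite /hessenberg_complement pos_rootsE roots_in_hess.
by rewrite (weyl_act_roots Gw wE) roots_ofD.
Qed.

Lemma mem_hess_weyl w p (t : 'I_n -> F) X : G w -> cj w = mono p t ->
  (Ad (invmx w) X \in H <->
   lie_algebra G X /\ forall i j, cj X i j != 0 -> hess ((p^-1)%g i) ((p^-1)%g j)).
Proof.
move=> Gw wE; have [uw _] := Gw; have t0 := weyl_t_neq0 Gw wE.
rewrite mem_hess !lie_grp Ad_tr ?unitmx_inv //; split=> -[gX Xh]; split=> // i j Xij.
  apply: Xh; rewrite (cj_weyl Gw wE) !permKV !mulf_neq0 ?invr_neq0 //.
rewrite -[ i](permK p) -[j](permK p); apply: Xh.
by apply: contraNneq Xij => E; rewrite (cj_weyl Gw wE) E mulr0 mul0r.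
Qed.

End Hessenberg.

End Roots.

(** * Jordan bases *)

Section NilpotentBasis.
Variables (K : fieldType) (vT : vectType K).
Implicit Types (f g : 'End(vT)) (U : {vspace vT}) (e : seq vT) (rho : nat -> option nat).

(** The second clause says at once that the vectors killed by g come first and that rho increases
    strictly on the others. *)
Definition nilpotent_form g e rho :=
  (forall i, (i < size e)%N ->
     if rho i is Some k then (k < i)%N /\ g e`_i = e`_k else g e`_i = 0) /\
  (forall i j k, (i < j < size e)%N -> rho i = Some k ->
     exists2 k', rho j = Some k' & (k < k')%N).

(** The basis of [g U] given by induction is lifted along [g]; its part inside
    the kernel is completed to a basis of the kernel, and the rest is already
    among the chosen preimages. *)
Lemma nilpotent_basis g U : (g @: U <= U)%VS ->
  (exists k, forall v, v \in U -> iter k g v = 0) ->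
  exists e rho, basis_of U e /\ nilpotent_form g e rho.
Proof.
have [m] := ubnP (\dim U); elim: m U => // m IHm U dU gU [k nk].
have [->|U0] := eqVneq U 0%VS.
  exists [::], (fun=> None); split; last by split.
  by rewrite basisEdim sub0v.
pose W := (g @: U)%VS.
have WU : (W <= U)%VS by [].
have dW : (\dim W < \dim U)%N.
  rewrite ltn_neqAle dimvS // andbT; apply: contra_neq U0 => dWU.
  have WE : W = U by apply/eqP; rewrite eqEdim WU dWU leqnn.
  have sur l v : v \in U -> exists2 u, u \in U & iter l g u = v.
    elim: l v => [|l IHl] v; first by exists v.
    rewrite -{1}WE => /memv_imgP[u /IHl[u' u'U <-] ->].
    by exists u'.
  apply/eqP; rewrite -subv0; apply/subvP => v /(sur k)[u uU <-].
  by rewrite nk // mem0v.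
have [|||e' [rho' [be' [f1 f2]]]] := IHm W.
- exact: leq_trans dW dU.
- exact: limgS.
- by exists k => v vW; apply: nk; apply: (subvP WU).
have eW i : (i < size e')%N -> e'`_i \in W by move=> im; apply: (basis_mem be'); apply: mem_nth.
(* [p] is the number of vectors of [e'] in the kernel of g; they are an initial segment. *)
pose p := find (fun i => isSome (rho' i)) (iota 0 (size e')).
have pm : (p <= size e')%N by rewrite -[X in (_ <= X)%N](size_iota 0) find_size.
have ltp i : (i < p)%N -> rho' i = None.
  move=> ip; have := before_find 0%N ip; rewrite nth_iota ?(leq_trans ip) // add0n.
  by case: (rho' i).
have gep i : (p <= i < size e')%N -> exists l, rho' i = Some l.
  move=> /andP[pi im]; have ps : (p < size e')%N by apply: leq_ltn_trans im.
  have [l lE] : exists l, rho' p = Some l.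
    have : has (fun i => isSome (rho' i)) (iota 0 (size e')) by rewrite has_find size_iota.
    move=> /(nth_find 0%N); rewrite -/p nth_iota // add0n.
    by case: (rho' p) => // l _; exists l.
  move: pi; rewrite leq_eqVlt => /orP[/eqP<-|pi]; first by exists l.
  by have [|l' l'E _] := f2 p i l _ lE; rewrite ?pi //; exists l'.
have rho'_inj i j l : (i < size e')%N -> (j < size e')%N ->
    rho' i = Some l -> rho' j = Some l -> i = j.
  move=> im jm il jl; apply/eqP; case: ltngtP => // ij.
    by have [|l'] := f2 i j l _ il; rewrite ?ij // jl => -[->]; rewrite ltnn.
  by have [|l'] := f2 j i l _ jl; rewrite ?ij // il => -[->]; rewrite ltnn.
(* When the vector l of [e'] is already the image of another vector of [e'], that one is the lift,
   so the chains of [e'] are prolonged rather than duplicated. *)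
have exh (l : nat) : exists h, (l < size e')%N -> [/\ h \in U, g h = e'`_l
    & forall i, (i < size e')%N -> rho' i = Some l -> h = e'`_i].
  have [lm|] := boolP (l < size e')%N; last by exists 0.
  have [[i im il]|ni] := pselect (exists2 i, (i < size e')%N & rho' i = Some l).
    exists e'`_i => _; split; first by apply: (subvP WU); apply: eW.
      by have := f1 i im; rewrite il => -[].
    by move=> j jm jl; rewrite (rho'_inj _ _ _ im jm il jl).
  have /memv_imgP[h hU hE] := eW l lm; exists h => _; split=> // i im il.
  by case: ni; exists i.
have [h hP] := choice exh.
pose Ker := (U :&: lker g)%VS; pose X := take p e'.
have sX : size X = p by rewrite size_takel.
have XK : {subset X <= Ker}.
  move=> x /(nthP 0)[ i]; rewrite sX => ip <-; rewrite nth_take //.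
  have im : (i < size e')%N by apply: leq_trans pm.
  rewrite memv_cap (subvP WU) ?eW // memv_ker.
  by have := f1 i im; rewrite ltp // => ->; rewrite eqxx.
pose c := X ++ vbasis (Ker :\: <<X>>)%VS.
have spanc : <<c>>%VS = Ker.
  rewrite span_cat (span_basis (vbasisP _)) addvC addv_diff.
  by apply/addv_idPl/span_subvP.
have bc : basis_of Ker c.
  rewrite /basis_of spanc eqxx /= cat_free (basis_free (vbasisP _)) (span_basis (vbasisP _)) /=.
  have -> : free X.
    have : free (X ++ drop p e') by rewrite cat_take_drop (basis_free be').
    by rewrite cat_free => /and3P[].
  by apply/directv_addP; rewrite capvC capv_diff.
pose q := size c; have pq : (p <= q)%N by rewrite /q size_cat sX leq_addr.
have cX i : (i < p)%N -> c`_i = e'`_i by move=> ip; rewrite nth_cat sX ip nth_take.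
pose e := c ++ mkseq h (size e').
have se : size e = (q + size e')%N by rewrite size_cat size_mkseq.
have eL i : (i < q)%N -> e`_i = c`_i by move=> iq; rewrite nth_cat iq.
have eR l : (l < size e')%N -> e`_(q + l) = h l.
  by move=> lm; rewrite nth_cat ltnNge leq_addr /= addKn nth_mkseq.
(* The q kernel vectors come first and the lift of [e'_l] sits at q + l. Its image [e'_l] is at
   place l of the kernel basis when l < p; otherwise it is itself the lift of [e'_(rho' l)], at
   place q + rho' l. *)
pose rho i := if (i < q)%N then None else
  if (i - q < p)%N then Some (i - q)%N else omap (addn q) (rho' (i - q)%N).
exists e, rho; split; last split.
- rewrite basisEdim se -(limg_ker_dim g U) (@vector.size_basis _ _ _ _ (in_tuple c) bc).
  rewrite (@vector.size_basis _ _ _ _ (in_tuple e') be') leqnn andbT.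
  apply/subvP => u uU.
  have guW : g u \in W by apply: memv_img.
  have guE := @coord_basis _ _ _ _ (in_tuple e') _ be' guW.
  pose a i := coord (in_tuple e') i (g u).
  pose u' := \sum_(i < size e') a i *: h i.
  have u'U : u' \in U.
    by apply: memv_suml => i _; apply: memvZ; have [] := hP i (ltn_ord i).
  have gu' : g u' = g u.
    rewrite guE linear_sum; apply: eq_bigr => i _; rewrite linearZ /=.
    by have [_ ->] := hP i (ltn_ord i).
  rewrite -[u](subrK u') span_cat; apply: memv_add.
    by rewrite spanc memv_cap memvB // memv_ker linearB /= gu' subrr eqxx.
  apply: memv_suml => i _; apply/memvZ/memv_span/mapP; exists (val i) => //.
  by rewrite mem_iota ltn_ord.
- move=> i; rewrite se => iqm; rewrite /rho; case: ltnP => iq.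
    rewrite eL //; have : c`_i \in Ker by apply: (basis_mem bc); apply: mem_nth.
    by rewrite memv_cap memv_ker => /andP[_ /eqP].
  move: (i - q)%N (subnKC iq) => l il; have lm : (l < size e')%N by rewrite -(ltn_add2l q) il.
  rewrite -il eR //; have [_ ghl _] := hP l lm; rewrite ghl; case: ltnP => lp.
    have lq := leq_trans lp pq; rewrite (eL _ lq) (cX _ lp); split=> //.
    by apply: leq_trans lq (leq_addr _ _).
  have [|k0 k0E] := gep l; first by rewrite lp.
  have := f1 l lm; rewrite k0E /= => -[k0l _]; split; first by rewrite ltn_add2l.
  have k0m := ltn_trans k0l lm; rewrite eR //.
  by have [_ _ hk] := hP k0 k0m; rewrite (hk l).
move=> i j k1; rewrite se /rho => /andP[ij jm]; case: ltnP => // iq.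
have jq : (q <= j)%N by apply: leq_trans iq (ltnW ij).
rewrite [(j < q)%N]ltnNge jq /=; have lm : (j - q < size e')%N by rewrite ltn_subLR.
have ll : (i - q < j - q)%N by rewrite ltn_sub2r // (leq_ltn_trans iq).
move: (i - q)%N (j - q)%N lm ll => l l' lm ll; case: ltnP => lp.
  move=> [<-]; case: ltnP => l'p; first by exists l'.
  have [|k0 k0E] := gep l'; first by rewrite l'p.
  by exists (q + k0)%N; rewrite ?k0E // (leq_trans lp) // (leq_trans pq) // leq_addr.
rewrite [(l' < p)%N]ltnNge (leq_trans lp (ltnW ll)) /=; case E: (rho' l) => [k0|] //= -[<-].
have [|k' -> lk'] := f2 l l' k0 _ E; first by rewrite ll.
by exists (q + k')%N; rewrite //= ltn_add2l.
Qed.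

End NilpotentBasis.

(** * Assembling nilpotent bases of the eigenspaces of a commuting operator *)

Section CommutingBasis.
Variables (K : fieldType) (vT : vectType K) (f g : 'End(vT)).
Hypotheses (fg : forall v, f (g v) = g (f v)) (gnil : exists k, forall v, iter k g v = 0).

(** The product of the f - b for b in [rs]: it kills the eigenvectors with eigenvalue in [rs] and
    scales the others by nonzero factors. *)
Let T (rs : seq K) : 'End(vT) := foldr (fun b A => (f - b *: \1) \o A)%VF \1%VF rs.

Let TE rs v a : f v = a *: v -> T rs v = (\prod_(b <- rs) (a - b)) *: v.
Proof.
move=> fv; elim: rs => [|b rs IHrs]; first by rewrite big_nil scale1r id_lfunE.
rewrite big_cons /= comp_lfunE IHrs linearZ /=.
by rewrite add_lfunE opp_lfunE scale_lfunE id_lfunE fv -scalerBl scalerA mulrC.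
Qed.

Lemma eigenvectors_disjoint (rs : seq K) a (e : seq vT) v : a \notin rs ->
  (forall u, u \in e -> exists2 b, b \in rs & f u = b *: u) ->
  v \in <<e>>%VS -> f v = a *: v -> v = 0.
Proof.
move=> ars ers ve fv.
have Te : (<<e>> <= lker (T rs))%VS.
  apply/span_subvP => u /ers[b brs fu]; rewrite memv_ker (TE _ fu).
  by rewrite (big_rem b) //= subrr mul0r scale0r.
have := subvP Te _ ve; rewrite memv_ker (TE _ fv) scaler_eq0 => /orP[|/eqP//].
rewrite prodf_seq_eq0 => /hasP[b brs]; rewrite subr_eq0 => /eqP ab.
by rewrite ab brs in ars.
Qed.

Definition block_form (e : seq vT) (tau : nat -> K) (rho : nat -> option nat) :=
  [/\ forall i, (i < size e)%N -> f e`_i = tau i *: e`_i,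
      forall i j k, (i <= j <= k)%N -> (k < size e)%N -> tau i = tau k -> tau i = tau j,
      forall i, (i < size e)%N ->
        if rho i is Some k then [/\ (k < i)%N, tau k = tau i & g e`_i = e`_k] else g e`_i = 0
    & forall i j k, (i < j < size e)%N -> tau i = tau j -> rho i = Some k ->
        exists2 k', rho j = Some k' & (k < k')%N].

(** Each new eigenvalue puts a nilpotent basis of its eigenspace in front, stable under g by
    commutation. The last clause makes the family a basis once eigenvectors for [rs] span the
    space. *)
Lemma block_basis (rs : seq K) : uniq rs ->
  exists e tau rho, [/\ free e, block_form e tau rho,
    forall i, (i < size e)%N -> tau i \in rs
    & forall v a, a \in rs -> f v = a *: v -> v \in <<e>>%VS].
Proof.
elim: rs => [_|a rs IHrs /= /andP[ars /IHrs[e2 [tau2 [rho2 [fe2 [b1 b2 b3 b4] t2 sp2]]]]]].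
  by exists [::], (fun=> 0), (fun=> None); split; rewrite ?nil_free //; split.
pose U := lker (f - a *: \1%VF).
have UE v : (v \in U) = (f v == a *: v).
  by rewrite memv_ker add_lfunE opp_lfunE scale_lfunE id_lfunE subr_eq0.
have gU : (g @: U <= U)%VS.
  apply/subvP => _ /memv_imgP[v vU ->]; move: vU; rewrite !UE => /eqP fv.
  by rewrite fg fv linearZ.
have [k nk] := gnil.
have [|e1 [rho1 [be1 [f1 f2]]]] := nilpotent_basis gU; first by exists k.
pose n1 := size e1.
have fe1 i : (i < n1)%N -> f e1`_i = a *: e1`_i.
  by move=> im; apply/eqP; rewrite -UE; apply: (basis_mem be1); apply: mem_nth.
pose tau i := if (i < n1)%N then a else tau2 (i - n1)%N.
pose rho i := if (i < n1)%N then rho1 i else omap (addn n1) (rho2 (i - n1)%N).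
have eL i : (i < n1)%N -> (e1 ++ e2)`_i = e1`_i by move=> im; rewrite nth_cat im.
have eR l : (e1 ++ e2)`_(n1 + l) = e2`_l by rewrite nth_cat ltnNge leq_addr /= addKn.
have tL i : (i < n1)%N -> tau i = a by rewrite /tau => ->.
have tR l : tau (n1 + l)%N = tau2 l by rewrite /tau ltnNge leq_addr /= addKn.
have rL i : (i < n1)%N -> rho i = rho1 i by rewrite /rho => ->.
have rR l : rho (n1 + l)%N = omap (addn n1) (rho2 l) by rewrite /rho ltnNge leq_addr /= addKn.
have se : size (e1 ++ e2) = (n1 + size e2)%N by rewrite size_cat.
have na l : (l < size e2)%N -> tau2 l != a.
  by move=> lm; apply: contraNneq ars => <-; apply: t2.
have splitP i : (i < n1)%N \/ exists l, i = (n1 + l)%N.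
  by case: (ltnP i n1) => [|/subnKC<-]; [left|right; exists (i - n1)%N].
exists (e1 ++ e2), tau, rho; split.
- rewrite cat_free (basis_free be1) fe2 /= (span_basis be1); apply/directv_addP.
  apply/eqP; rewrite -subv0; apply/subvP => v /memv_capP[]; rewrite UE memv0 => /eqP fv ve2.
  apply/eqP; apply: (eigenvectors_disjoint ars _ ve2 fv) => u /(nthP 0)[i im <-].
  by exists (tau2 i); [apply: t2|apply: b1].
- split.
  + move=> i; rewrite se; have [im _|[l ->]] := splitP i; first by rewrite eL ?tL ?fe1.
    by rewrite ltn_add2l eR tR => /b1.
  + move=> i j k0; rewrite se; have [km|[l ->]] := splitP k0.
      by move=> /andP[ij jk] _ _; rewrite !tL // (leq_ltn_trans _ km) // (leq_trans ij).
    rewrite ltn_add2l tR; have [im|[l1 ->]] := splitP i.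
      by rewrite tL // => _ lm E; have := na l lm; rewrite -E eqxx.
    have [jm|[l2 ->]] := splitP j.
      by move=> /andP[ij _]; have := leq_ltn_trans ij jm; rewrite ltnNge leq_addr.
    by rewrite !leq_add2l !tR => ijk lm; apply: b2.
  + move=> i; rewrite se; have [im _|[l ->]] := splitP i.
      rewrite rL // eL //; have := f1 i im; case: (rho1 i) => // k0 [ki gk].
      by have km := ltn_trans ki im; rewrite !tL ?eL.
    rewrite ltn_add2l rR eR tR => /b3; case: (rho2 l) => //= k0 [ki tk gk].
    by rewrite ltn_add2l tR eR.
  move=> i j k0; rewrite se; have [jm|[l ->]] := splitP j.
    move=> /andP[ij _]; have im := ltn_trans ij jm.
    by rewrite !rL // => _; apply: f2; rewrite ij.
  rewrite ltn_add2l tR rR; have [im|[l1 ->]] := splitP i.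
    by move=> /andP[_ lm]; rewrite tL // => E; have := na l lm; rewrite -E eqxx.
  rewrite ltn_add2l tR rR => ijl tt; case E: (rho2 l1) => [k1|] //= [<-].
  by have [k' -> kk] := b4 _ _ _ ijl tt E; exists (n1 + k')%N; rewrite //= ltn_add2l.
- move=> i; rewrite se inE; have [im _|[l ->]] := splitP i; first by rewrite tL ?eqxx.
  by rewrite ltn_add2l tR => /t2->; rewrite orbT.
move=> v b; rewrite inE => /orP[/eqP->|brs] fv; rewrite span_cat.
  by apply: (subvP (addvSl _ _)); rewrite (span_basis be1) UE fv eqxx.
by apply: (subvP (addvSr _ _)); apply: sp2 fv.
Qed.

End CommutingBasis.

Lemma jordan_normal_form (F : fieldType) n (M s : 'M[F]_n) : jordan_decomposition M s ->
  exists (P : 'M[F]_n) (sigma : 'I_n -> F) (r : 'I_n -> option 'I_n),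
  [/\ P \in unitmx,
      Ad (invmx P) s = diag_mx (\row_j sigma j),
      Ad (invmx P) (M - s) = \matrix_(k, l) (r l == Some k)%:R,
      forall i j k : 'I_n, (i <= j <= k)%N -> sigma i = sigma k -> sigma i = sigma j
    & (forall l k, r l = Some k -> (k < l)%N /\ sigma k = sigma l) /\
      (forall i j k : 'I_n, (i < j)%N -> sigma i = sigma j -> r i = Some k ->
         exists2 k', r j = Some k' & (k < k')%N)].
Proof.
move=> [[Q uQ /(diagonalizable_forLR uQ)[D sE]] [m Nm] sM].
have {}sE : s = invmx Q *m diag_mx D *m Q by rewrite {1}sE; apply: conjVmx.
pose V := 'cV[F]_n; set N := M - s.
have sN : s *m N = N *m s by rewrite /N mulmxBr mulmxBl sM.
pose f : 'End(V) := linfun (mulmx s); pose g : 'End(V) := linfun (mulmx N).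
have fE v : f v = s *m v by rewrite lfunE.
have gE v : g v = N *m v by rewrite lfunE.
have fg v : f (g v) = g (f v) by rewrite !fE !gE ?fE !mulmxA sN.
have gnil : exists k, forall v, iter k g v = 0.
  exists m => v; have -> : iter m g v = (N ^+ m) *m v.
    elim: m {Nm} => [|k IHk]; first by rewrite expr0 mul1mx.
    by rewrite iterS IHk gE exprS mulmxA.
  by rewrite Nm mul0mx.
have [e [tau [rho [fe [b1 b2 b3 b4] trs sp]]]] :=
  block_basis fg gnil (undup_uniq [seq D 0 i | i <- enum 'I_n]).
(* The columns of Q^-1 are eigenvectors of [s] that span the space. *)
have full : <<e>>%VS = fullv.
  apply/eqP; rewrite eqEsubv subvf /=; apply/subvP => v _.
  have -> : v = \sum_j (Q *m v) j 0 *: col j (invmx Q).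
    rewrite -{1}[v](mulKmx uQ); apply/matrixP => i k; rewrite ord1 summxE mxE.
    by apply: eq_bigr => j _; rewrite !mxE mulrC.
  apply: memv_suml => j _; apply: memvZ; apply: (sp _ (D 0 j)).
    by rewrite mem_undup; apply/mapP; exists j; rewrite // mem_enum.
  rewrite fE {1}sE !colE !mulmxA mulmxK // -mulmxA scalemxAr; congr (_ *m _).
  by apply/matrixP => i k; rewrite mul_diag_mx !mxE; case: (i =P j) => [->|]; rewrite ?mulr0.
have se : size e = n.
  by move: fe; rewrite /free full dimvf => /eqP <-; apply: muln1.
pose et : n.-tuple V := Tuple (introT eqP se).
pose P : 'M[F]_n := \matrix_(i, j) (e`_j) i 0.
have Pc (c : V) : P *m c = \sum_j c j 0 *: e`_j.
  apply/matrixP => i k; rewrite ord1 summxE mxE.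
  by apply: eq_bigr => j _; rewrite !mxE mulrC.
have uP : P \in unitmx.
  pose C : 'M[F]_n := \matrix_(k, j) coord et k (delta_mx j 0).
  have PC : P *m C = 1%:M.
    apply/matrixP => i j; have /(coord_span (X := et)) E : (delta_mx j 0 : V) \in <<et>>%VS.
      by rewrite full memvf.
    transitivity ((delta_mx j 0 : V) i 0); last by rewrite !mxE eqxx andbT.
    rewrite [RHS](congr1 (fun v : V => v i 0) E) summxE mxE.
    by apply: eq_bigr => k _; rewrite !mxE mulrC.
  by have [] := mulmx1_unit PC.
have conjE (A B : 'M[F]_n) : A *m P = P *m B -> Ad (invmx P) A = B.
  by move=> AP; rewrite /Ad invmxK -mulmxA AP mulmxA mulVmx // mul1mx.
have colP j : col j P = e`_j by apply/matrixP => i k; rewrite ord1 !mxE.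
have nE (i : 'I_n) : (i < size e)%N by rewrite se.
(* Nothing is lost in restricting [rho] to ordinals, since its values lie below their arguments
   ([rhoE]). *)
pose r (l : 'I_n) : option 'I_n := obind insub (rho l).
have rE l k : r l = Some k -> rho l = Some (val k).
  by rewrite /r; case: (rho l) => //= k'; case: insubP => //= ? _ <- [->].
have rhoE (l : 'I_n) k : rho l = Some k -> exists2 k0, r l = Some k0 & val k0 = k.
  move=> E; have := b3 l (nE l); rewrite E => -[kl _ _].
  have kn := ltn_trans kl (ltn_ord l).
  by exists (Ordinal kn); rewrite //= /r E /= insubT.
exists P, (fun i : 'I_n => tau i), r; split=> //.
- apply: conjE; apply/matrixP => i j.
  rewrite mul_mx_diag !mxE; have := congr1 (fun v : V => v i 0) (b1 j (nE j)).
  rewrite fE !mxE mulrC => <-; apply: eq_bigr => k _; by rewrite !mxE.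
- apply: conjE; apply/matrixP => i j; rewrite [RHS]mxE.
  have -> : (N *m P) i j = (g e`_j) i 0.
    by rewrite gE !mxE; apply: eq_bigr => k _; rewrite !mxE.
  have := b3 j (nE j); case rj: (rho j) => [k|].
    move=> [_ _ ->]; have [k0 rk0 kE] := rhoE _ _ rj.
    rewrite (bigD1 k0) //= big1 ?addr0 => [|l lk].
      by rewrite !mxE rk0 eqxx mulr1 kE.
    rewrite [X in _ * X]mxE rk0; case: eqP => [[E]|_]; last by rewrite mulr0.
    by rewrite E eqxx in lk.
  move=> ->; rewrite mxE big1 // => l _; rewrite [X in _ * X]mxE /r rj /= mulr0 //.
- by move=> i j k ijk; apply: b2.
split=> [l k /rE rl|i j k ij tij /rE ri].
  by have := b3 l (nE l); rewrite rl => -[].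
have [|k' /rhoE[k0 rk0 kE] kk] := b4 i j _ _ tij ri; first by rewrite ij nE.
by exists k0; rewrite // kE.
Qed.

(** * The equations of a Hessenberg variety in a Schubert cell *)

Section TriangularGraph.
Variables (F : fieldType) (n : nat) (rk : 'I_n * 'I_n -> nat) (free : pred ('I_n * 'I_n)).
Variable (Q : 'I_n * 'I_n -> 'M[F]_n -> F).
Hypotheses (rk_inj : injective rk) (Q_poly : forall j, polyf (Q j)).
Hypothesis Q_dep : forall j (x x' : 'M[F]_n), ~~ free j ->
  (forall j', (rk j' < rk j)%N -> x j'.1 j'.2 = x' j'.1 j'.2) -> Q j x = Q j x'.

Let d := #|free|.
Let coord (j : 'I_n * 'I_n) (y : 'rV[F]_d) : F := \sum_(i < d) (enum_val i == j)%:R * y 0 i.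
Let Q' j y x := if free j then coord j y else Q j x.

Let coord_val y (i : 'I_d) : coord (enum_val i) y = y 0 i.
Proof.
rewrite /coord (bigD1 i) //= eqxx mul1r big1 ?addr0 // => k /negPf ki.
by rewrite (inj_eq enum_val_inj) ki mul0r.
Qed.

Let Q'_dep j y (x x' : 'M[F]_n) :
  (forall j', (rk j' < rk j)%N -> x j'.1 j'.2 = x' j'.1 j'.2) -> Q' j y x = Q' j y x'.
Proof. by move=> xx; rewrite /Q'; case: (boolP (free j)) => // /Q_dep; apply. Qed.

(** The coordinates are found in the order of [rk]: a free one is a parameter, any other is the
    value of [Q] on coordinates already known. The stage t of the induction has polynomial formulas
    for all ranks below t. *)
Lemma graph_param : exists a : 'rV[F]_d -> 'M[F]_n, [/\ polymap a,
  forall y j, ~~ free j -> a y j.1 j.2 = Q j (a y),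
  forall y (i : 'I_d), a y (enum_val i).1 (enum_val i).2 = y 0 i
  & forall x : 'M[F]_n, (forall j, ~~ free j -> x j.1 j.2 = Q j x) -> exists y, x = a y].
Proof.
have [m mP] : exists m, forall j, (rk j < m)%N.
  exists (\max_j (rk j)).+1 => j; rewrite ltnS; exact: leq_bigmax.
have step t : exists a : 'rV[F]_d -> 'M[F]_n, polymap a /\
    forall y j, (rk j < t)%N -> a y j.1 j.2 = Q' j y (a y).
  elim: t => [|t [a [pa aE]]]; first by exists (fun=> 0); split=> //; apply: polymapC.
  have [[j jt]|nj] := pselect (exists j, rk j = t); last first.
    exists a; split=> // y j; rewrite ltnS leq_eqVlt => /orP[/eqP jt|]; last exact: aE.
    by case: nj; exists j.
  pose a' y : 'M[F]_n := \matrix_(i, k) if (i, k) == j then Q' j y (a y) else a y i k.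
  have a'E y j' : j' != j -> a' y j'.1 j'.2 = a y j'.1 j'.2.
    by rewrite mxE -surjective_pairing => /negPf->.
  have agree y j' : (rk j' <= t)%N -> Q' j' y (a' y) = Q' j' y (a y).
    move=> j't; apply: Q'_dep => j2 j2t; apply: a'E.
    by apply: contraTneq j2t => ->; rewrite jt -leqNgt.
  exists a'; split=> [i k|y j']; last first.
    rewrite ltnS => j't; rewrite agree //; have [->|nj] := eqVneq j' j.
      by rewrite mxE -surjective_pairing eqxx.
    rewrite a'E // aE // ltn_neqAle j't andbT; apply: contraNneq nj => E.
    by apply/eqP/rk_inj; rewrite E.
  have [E|nE] := eqVneq (i, k) j; last first.
    by apply: eq_polyf (pa i k) => y; rewrite mxE (negPf nE).
  apply: (@eq_polyf _ _ _ (fun y => Q' j y (a y))); first by move=> y; rewrite mxE E eqxx.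
  rewrite /Q'; case: (free j); last exact: polyf_comp (Q_poly j) pa.
  by apply: polyf_sum => l _; apply: polyfM; [apply: polyfC|apply: polyf_entry].
have [a [pa aE]] := step m.
have aE' y j : a y j.1 j.2 = Q' j y (a y) by apply: aE.
exists a; split=> //.
- by move=> y j nj; rewrite aE' /Q' (negPf nj).
- move=> y i; have fi : free (enum_val i) := enum_valP i.
  by rewrite aE' /Q' fi coord_val.
move=> x xE; pose y : 'rV[F]_d := \row_i x (enum_val i).1 (enum_val i).2.
exists y; apply/matrixP => i k; have xE' j : x j.1 j.2 = Q' j y x.
  rewrite /Q'; case: (boolP (free j)) => fj; last exact: xE.
  have -> : j = enum_val (enum_rank_in fj j) by rewrite enum_rankK_in.
  by rewrite coord_val mxE.
have {}xa t : forall j, (rk j < t)%N -> x j.1 j.2 = a y j.1 j.2.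
  elim: t => // t IHt j jt; rewrite xE' aE'; apply: Q'_dep => j' j'j.
  by apply: IHt; apply: leq_trans j'j _.
exact: (xa m (i, k)).
Qed.

End TriangularGraph.

(** * Entries of the conjugates of the Jordan form and their leading coordinates *)

Section CellEquations.
Variables (F : fieldType) (n : nat) (sigma : 'I_n -> F) (r : 'I_n -> option 'I_n).
Variables (hs : rel 'I_n) (p : {perm 'I_n}).
Hypothesis sigma_convex :
  forall i j k : 'I_n, (i <= j <= k)%N -> sigma i = sigma k -> sigma i = sigma j.
Hypothesis r_lt : forall l k, r l = Some k -> (k < l)%N /\ sigma k = sigma l.
Hypothesis r_mono : forall i j k : 'I_n, (i < j)%N -> sigma i = sigma j -> r i = Some k ->
  exists2 k', r j = Some k' & (k < k')%N.
Hypothesis hs_up : forall i j : 'I_n, (i <= j)%N -> hs i j.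
Hypothesis hs_trans : forall i j k l : 'I_n, hs k l -> (i <= k)%N -> (l <= j)%N -> hs i j.
Implicit Types (u v A X : 'M[F]_n) (i j k l m : 'I_n).

(** [r l = Some k] encodes that the nilpotent part sends the basis vector [l] to
    the basis vector [k], and [r l = None] that it kills it; [hs] is the Hessenberg
    space, and [p] the permutation of the cell. *)
Definition Smx : 'M[F]_n := diag_mx (\row_j sigma j).
Definition Nmx : 'M[F]_n := \matrix_(k, l) (r l == Some k)%:R.
Let J : 'M[F]_n := Smx + Nmx.
Local Notation ip := (p^-1)%g.

Definition inversion_pair i k := (i < k)%N && (ip k < ip i)%N.
(** The positions of the equations, that is, the roots of [hessenberg_complement]; those of
    [inversions] are given by [inversion_pair]. *)
Definition cond_pair i l := (i < l)%N && ~~ hs (ip i) (ip l).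
Local Notation C := cond_pair.
Definition inU u := forall i k, ~~ inversion_pair i k -> u i k = (i == k)%:R.

Lemma r_inj l l' m : r l = Some m -> r l' = Some m -> l = l'.
Proof.
move=> rl rl'; have [_ s1] := r_lt rl; have [_ s2] := r_lt rl'.
apply: val_inj; case: (ltngtP l l') => // ll.
  by have [|k'] := r_mono ll _ rl; rewrite -?s1 ?s2 // rl' => -[->]; rewrite ltnn.
by have [|k'] := r_mono ll _ rl'; rewrite -?s1 ?s2 // rl => -[->]; rewrite ltnn.
Qed.

Lemma inU_unitri u : inU u -> unitri u.
Proof.
move=> uU; apply/unitriP; split=> [i k|i]; last by rewrite uU ?eqxx // /inversion_pair ltnn.
rewrite /up -ltnNge => ki; rewrite uU; last by rewrite /inversion_pair ltnNge (ltnW ki).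
by rewrite -val_eqE gtn_eqF.
Qed.

Lemma J_up : masked (@up n) J.
Proof.
move=> i j; rewrite /up -ltnNge => ji; rewrite !mxE -val_eqE gtn_eqF // mulr0n add0r.
by case: eqP => // /r_lt[]; rewrite ltnNge (ltnW ji).
Qed.

Lemma J_diag i : J i i = sigma i.
Proof.
rewrite !mxE eqxx mulr1n; case: eqP => [/r_lt[]|_]; last by rewrite addr0.
by rewrite ltnn.
Qed.

(** In the columns of a block, conjugation by a unitriangular matrix of the Levi
    subgroup keeps the lowest nonzero entry of the nilpotent part. *)
Lemma pivot_conj v l : unitri v -> masked (same_eigen sigma) v ->
  (forall k, (if r l is Some m then (m < k)%N else true) -> (invmx v *m Nmx *m v) k l = 0) /\
  (forall m, r l = Some m -> (invmx v *m Nmx *m v) m l = 1).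
Proof.
move=> uv sv; have [vu v1] := (unitriP v).1 uv.
have [iu i1] := (unitriP _).1 (unitri_inv uv).
have term k m : r m = Some k -> v m l != 0 -> (m <= l)%N /\ sigma m = sigma l.
  move=> rm vml; split; first by apply: contraNT vml => /vu->.
  by apply/eqP; apply: contraNT vml => /sv->.
have X0 k : (if r l is Some m then (m < k)%N else true) -> (Nmx *m v) k l = 0.
  move=> rk; rewrite mxE big1 // => m _; rewrite mxE; case: eqP => [rm|_]; last by rewrite mul0r.
  have [->|/(term _ _ rm)[ml sm]] := eqVneq (v m l) 0; first by rewrite mulr0.
  move: ml; rewrite leq_eqVlt => /orP[/eqP/val_inj E|ml].
    by move: rk; rewrite -E rm ltnn.
  have [k' rl kk] := r_mono ml sm rm.
  by move: rk; rewrite rl ltnNge (ltnW kk).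
have X1 m : r l = Some m -> (Nmx *m v) m l = 1.
  move=> rl; rewrite mxE (bigD1 l) //= mxE rl eqxx v1 mulr1 big1 ?addr0 // => k kl.
  rewrite mxE; case: eqP => [rk|_]; last by rewrite mul0r.
  by rewrite (r_inj rk rl) eqxx in kl.
split=> [k rk|m rl]; rewrite -mulmxA mxE.
  rewrite big1 // => j _; have [kj|jk] := leqP k j.
    rewrite X0 ?mulr0 //; move: rk; case: (r l) => // m mk; exact: leq_trans mk kj.
  by rewrite iu ?mul0r // /up -ltnNge.
rewrite (bigD1 m) //= i1 X1 // mul1r big1 ?addr0 // => j jm.
have [mj|jm'] := ltnP m j; first by rewrite X0 ?mulr0 // rl.
rewrite iu ?mul0r // /up -ltnNge ltn_neqAle jm' andbT; exact: jm.
Qed.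

Definition block_part A : 'M[F]_n := \matrix_(i, j) if sigma i == sigma j then A i j else 0.

(** A nonzero term of the product runs through an index k with i <= k <= l, which by convexity stays
    in the block when i and l share it. This is the projection of a parabolic subalgebra onto its
    Levi part. *)
Lemma block_partM A X : masked (@up n) A -> masked (@up n) X ->
  block_part (A *m X) = block_part A *m block_part X.
Proof.
move=> uA uX; apply/matrixP => i l; rewrite !mxE; case: eqP => [il|/eqP il]; last first.
  rewrite big1 // => k _; rewrite !mxE; case: eqP => [ik|_]; last by rewrite mul0r.
  by case: eqP => [kl|_]; [rewrite ik kl eqxx in il|rewrite mulr0].
apply: eq_bigr => k _; rewrite !mxE.
have [->|Aik] := eqVneq (A i k) 0; first by rewrite !mul0r if_same mul0r.
have [->|Xkl] := eqVneq (X k l) 0; first by rewrite if_same !mulr0.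
have ik : (i <= k)%N by apply: contraNT Aik => /uA->.
have kl : (k <= l)%N by apply: contraNT Xkl => /uX->.
have sik : sigma i = sigma k by apply: (@sigma_convex i k l); rewrite ?ik.
by rewrite -sik il !eqxx.
Qed.

Definition conjJ u := invmx u *m J *m u.

Lemma conjJ_up u : unitri u -> masked (@up n) (conjJ u).
Proof.
move=> uu; have [mu _] := (unitriP _).1 uu; have [mi _] := (unitriP _).1 (unitri_inv uu).
by apply: maskedM => //; apply: maskedM => //; apply: J_up.
Qed.

Lemma conjJ_diag u l : unitri u -> conjJ u l l = sigma l.
Proof.
move=> uu; have [mu d1] := (unitriP _).1 uu; have [mi e1] := (unitriP _).1 (unitri_inv uu).
rewrite !mulmx_up_diag ?e1 ?d1 ?mul1r ?mulr1 ?J_diag //; try exact: J_up.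
by apply: maskedM => //; apply: J_up.
Qed.

(** The block diagonal part of the conjugate is [Smx] plus the conjugate of [Nmx] by the block
    diagonal part of [u], since [Smx] commutes with blocks; [pivot_conj] then applies. *)
Lemma conjJ_pivot u k l : unitri u -> sigma k = sigma l -> k != l ->
  ((if r l is Some m then (m < k)%N else true) -> conjJ u k l = 0) /\
  (r l = Some k -> conjJ u k l = 1).
Proof.
move=> uu skl kl; have [mu d1] := (unitriP _).1 uu; have [mi e1] := (unitriP _).1 (unitri_inv uu).
pose v := block_part u.
have uv : unitri v.
  by apply/unitriP; split=> [i j ij|i]; rewrite mxE ?eqxx ?d1 // mu // if_same.
have sv : masked (same_eigen sigma) v by move=> i j; rewrite /same_eigen mxE => /negPf->.
have nv := unitri_unit uv.
have bi : block_part (invmx u) = invmx v.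
  have E : block_part (invmx u) *m v = 1%:M.
    rewrite -block_partM // mulVmx ?unitri_unit //; apply/matrixP => i j; rewrite !mxE.
    by case: (eqVneq i j) => [->|_]; rewrite ?eqxx // if_same.
  by rewrite -[LHS](mulmxK nv) E mul1mx.
have bJ : block_part J = J.
  apply/matrixP => i j; rewrite mxE; case: eqP => // /eqP ij; rewrite !mxE.
  case: (eqVneq i j) ij => [->|_ ij]; first by rewrite eqxx.
  by rewrite mulr0n add0r; case: eqP => // /r_lt[_ E]; rewrite E eqxx in ij.
have E : block_part (conjJ u) = Smx + invmx v *m Nmx *m v.
  rewrite block_partM //; last by apply: maskedM => //; apply: J_up.
  rewrite block_partM //; last exact: J_up.
  rewrite bi bJ mulmxDr mulmxDl; congr (_ + _).
  have SE : Smx *m v = v *m Smx; last by rewrite -/v -mulmxA SE mulKmx.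
  apply/matrixP => i j; rewrite mul_diag_mx mul_mx_diag !mxE mulrC.
  by case: eqP => [->//|_]; rewrite !mul0r.
have {}E : conjJ u k l = (invmx v *m Nmx *m v) k l.
  have /matrixP/(_ k l) := E; rewrite [LHS]mxE skl eqxx => ->.
  by rewrite [LHS]mxE !mxE (negPf kl) mulr0n add0r.
have [Z0 Z1] := pivot_conj l uv sv.
by rewrite E; split=> [/Z0|/Z1].
Qed.

Lemma conjJE u : unitri u -> u *m conjJ u = J *m u.
Proof. by move=> uu; rewrite /conjJ !mulmxA mulmxV ?mul1mx // unitri_unit. Qed.

(** The projector D on the rows below i satisfies D A = D A D for upper triangular A, so these rows
    of an inverse or a product depend only on the same rows of the factors. *)
Lemma conjJ_rows i u u' : unitri u -> unitri u' ->
  (forall k l, (i < k)%N -> u k l = u' k l) ->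
  forall k l, (i < k)%N -> conjJ u k l = conjJ u' k l.
Proof.
move=> uu uu' E; pose D := dg F (fun k : 'I_n => i < k)%N.
have nu := unitri_unit uu; have nu' := unitri_unit uu'.
have DA A : masked (@up n) A -> D *m A = D *m A *m D.
  move=> uA; apply/matrixP => k l; rewrite mul_mx_dg mul_dg; case: ifP => ik; case: ifP => il //.
  by rewrite uA // /up; apply: contraFN il; apply: leq_trans.
have Du : D *m u = D *m u' by apply/matrixP => k l; rewrite !mul_dg; case: ifP => // ik; apply: E.
have [mi _] := (unitriP _).1 (unitri_inv uu).
have Di : D *m invmx u = D *m invmx u'.
  suff H : D *m invmx u *m u' = D by rewrite -[LHS](mulmxK nu') H.
  by rewrite (DA _ mi) -(mulmxA _ D) -Du mulmxA -(DA _ mi) mulmxKV.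
have [mi' _] := (unitriP _).1 (unitri_inv uu').
have DY : D *m conjJ u = D *m conjJ u'.
  rewrite /conjJ !mulmxA (DA _ mi) (DA _ mi') Di -!mulmxA; congr (_ *m (_ *m _)).
  by rewrite !mulmxA (DA _ J_up) -!mulmxA Du.
move=> k l ik; have /matrixP/(_ k l) := DY; rewrite !mul_dg ik; exact.
Qed.

(** The column of the coordinate in row [i] that is eliminated by the equation at
    [(i, l)]. *)
Definition lead i l : option 'I_n :=
  if sigma i == sigma l then
    if r l is Some m then if (i < m)%N then Some m else None else None
  else Some l.

Definition lead_coef i l : F := if sigma i == sigma l then -1 else sigma i - sigma l.

Lemma lead_coef_neq0 i l : lead_coef i l != 0.
Proof. by rewrite /lead_coef; case: ifPn => [_|]; rewrite ?oppr_eq0 ?oner_eq0 // subr_eq0. Qed.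

Lemma lead_inj i l l' k : lead i l = Some k -> lead i l' = Some k -> l = l'.
Proof.
rewrite /lead; case: eqP => [il|il]; case: eqP => [il'|il'].
- case rl: (r l) => [m|] //; case: ifP => // _ [<-].
  by case rl': (r l') => [m'|] //; case: ifP => // _ [E]; apply: r_inj rl _; rewrite rl' E.
- case rl: (r l) => [m|] //; case: ifP => // _ [<-] [E].
  by case: il'; rewrite E; have [_ ->] := r_lt rl.
- move=> [<-]; case rl: (r l') => [m|] //; case: ifP => // _ [E].
  by case: il; rewrite -E; have [_ ->] := r_lt rl.
- by move=> [->] [->].
Qed.

(** The equation at [(i, l)] is affine in the coordinate at [(i, lead i l)], with
    nonzero coefficient, modulo the coordinates in lower rows and those to the
    left in row [i]. *)
Lemma conjJ_lead u u' i l k : unitri u -> unitri u' -> (i < l)%N -> lead i l = Some k ->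
  (forall i' j, (i < i')%N -> u i' j = u' i' j) ->
  (forall j, (j < k)%N -> u i j = u' i j) ->
  conjJ u i l - conjJ u' i l = lead_coef i l * (u i k - u' i k).
Proof.
move=> uu uu' il lk rows left.
have [mu d1] := (unitriP _).1 uu; have [mu' d1'] := (unitriP _).1 uu'.
have Yrows := conjJ_rows uu uu' rows.
pose dd j := u i j - u' i j.
(* This is row i of the identity [conjJE]. Entries of [u] and of its conjugate in lower rows agree
   for u and u', so the terms from [J] above the diagonal cancel. *)
have main : conjJ u i l - conjJ u' i l = sigma i * dd l - \sum_(j : 'I_n | (i < j)%N) dd j * conjJ u j l.
  have rowE (w : 'M[F]_n) : unitri w -> conjJ w i l = sigma i * w i l +
      \sum_(j : 'I_n | (i < j)%N) (J i j * w j l - w i j * conjJ w j l).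
    move=> uw; have [mw w1] := (unitriP _).1 uw.
    have split (f : 'I_n -> F) : (forall j, (j < i)%N -> f j = 0) ->
        \sum_j f j = f i + \sum_(j : 'I_n | (i < j)%N) f j.
      move=> f0; rewrite (bigD1 i) //=; congr (_ + _).
      rewrite (bigID (fun j : 'I_n => (i < j)%N)) /= [X in _ + X]big1 ?addr0.
        by apply: eq_bigl => j; case: ltngtP => ij; rewrite ?andbT ?andbF // -val_eqE gtn_eqF.
      move=> j /andP[ji]; rewrite -leqNgt leq_eqVlt val_eqE (negPf ji) /=; exact: f0.
    have /matrixP/(_ i l) := conjJE uw; rewrite [LHS]mxE [RHS]mxE split ?[in RHS]split.
    - rewrite w1 mul1r J_diag sumrB => E.
      by rewrite addrA -E addrK.
    - by move=> j ji; rewrite J_up ?mul0r // /up -ltnNge.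
    - by move=> j ji; rewrite mw ?mul0r // /up -ltnNge.
  rewrite (rowE u) // (rowE u') // opprD addrACA -mulrBr -/(dd l); congr (_ + _).
  rewrite -sumrB -sumrN; apply: eq_bigr => j ij; rewrite rows // -Yrows // /dd; ring.
have dd0 j : (j < k)%N -> dd j = 0 by move=> /left jk; rewrite /dd jk subrr.
rewrite main; move: lk; rewrite /lead /lead_coef -/(dd k); case: eqP => [sil|/eqP sil].
  case rl: (r l) => [m|] //; case: ifP => // im [mk]; subst m.
  have [kl skl] := r_lt rl.
  have nkl : k != l by rewrite -val_eqE neq_ltn kl.
  (* The term l cancels the eigenvalue term and the pivot k contributes the coefficient -1. The
     others vanish: left of k the coordinates agree, between k and l the entry lies below the pivot,
     beyond l below the diagonal. *)
  rewrite (bigD1 l) //= (bigD1 k) ?im //= big1 => [|j /andP[/andP[ij jl] jk]].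
    have [_ ->] := conjJ_pivot uu skl nkl; last exact: rl.
    rewrite conjJ_diag // sil; ring.
  have [jk'|kj] := ltnP j k; first by rewrite dd0 ?mul0r.
  have {jk}kj : (k < j)%N by rewrite ltn_neqAle kj andbT val_eqE eq_sym.
  have [lj|lj|/val_inj E] := ltngtP l j; last by rewrite E eqxx in jl.
    by rewrite (conjJ_up uu) ?mulr0 // /up -ltnNge.
  have sjl : sigma j = sigma l.
    by rewrite -skl; apply/esym/(@sigma_convex k j l); rewrite ?(ltnW kj) ?(ltnW lj).
  by have [-> //] := conjJ_pivot uu sjl jl; rewrite ?mulr0 // rl.
move=> [lk]; subst k; rewrite (bigD1 l) //= big1 ?addr0 => [|j /andP[ij jl]].
  rewrite conjJ_diag //; ring.
have [jl'|] := ltnP j l; first by rewrite dd0 ?mul0r.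
rewrite leq_eqVlt val_eqE eq_sym (negPf jl) /= => lj.
by rewrite (conjJ_up uu) ?mulr0 // /up -ltnNge.
Qed.

Lemma cond_inv_pair i l : C i l -> inversion_pair i l.
Proof.
move=> /andP[il nh]; rewrite /inversion_pair il /=; apply: contraNT nh.
by rewrite -leqNgt; apply: hs_up.
Qed.

(** An off-diagonal nonzero entry of [J] is a pivot, equal to 1 in every unitriangular conjugate, so
    no equation can sit at its position. *)
Lemma conjJ_hs u : unitri u -> (forall i l, C i l -> conjJ u i l = 0) ->
  forall i j, J i j != 0 -> hs (ip i) (ip j).
Proof.
move=> uu Cu i j Jij; have [->|ij] := eqVneq i j; first exact: hs_up.
have rj : r j = Some i.
  by apply/eqP; apply: contraNT Jij => rj; rewrite !mxE (negPf ij) mulr0n add0r (negPf rj).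
have [lij sij] := r_lt rj.
apply: contraT => nh; have := Cu i j; rewrite /C lij nh => /(_ isT) E.
have [_ /(_ rj)] := conjJ_pivot uu sij ij.
by rewrite E => /esym/eqP; rewrite oner_eq0.
Qed.

Section Solutions.
Hypothesis J_hs : forall i j, J i j != 0 -> hs (ip i) (ip j).

(** The entry of [J] at (m, l) lies in the transported Hessenberg space; if ip i <= ip m, the
    staircase would contain (i, l) as well. *)
Lemma cond_pivot i l m : C i l -> r l = Some m -> (ip m < ip i)%N /\ m != i.
Proof.
move=> /andP[il nh] rl; have hm : hs (ip m) (ip l).
  apply: J_hs; rewrite !mxE rl eqxx; have [ml _] := r_lt rl.
  by rewrite -val_eqE ltn_eqF //= mulr0n add0r oner_eq0.
have lt : (ip m < ip i)%N.
  by rewrite ltnNge; apply: contraNN nh => im; apply: hs_trans hm im (leqnn _).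
by split=> //; apply: contraTneq lt => ->; rewrite ltnn.
Qed.

Lemma lead_inv_pair i l k : C i l -> lead i l = Some k -> inversion_pair i k.
Proof.
move=> Cil; rewrite /lead; case: eqP => [_|_ [<-]]; last exact: cond_inv_pair.
case rl: (r l) => [m|] //; case: ifP => // im [<-].
by have [lt _] := cond_pivot Cil rl; rewrite /inversion_pair im.
Qed.

Lemma lead_none u i l : unitri u -> C i l -> lead i l = None -> conjJ u i l = 0.
Proof.
move=> uu Cil; rewrite /lead; case: eqP => // sil.
have nil : i != l by have /andP[il _] := Cil; rewrite -val_eqE neq_ltn il.
have [H _] := conjJ_pivot uu sil nil.
case rl: (r l) H => [m|] H; last by move=> _; apply: H.
case: ltnP => // mi _; apply: H; rewrite ltn_neqAle mi andbT val_eqE.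
by have [_] := cond_pivot Cil rl.
Qed.

(** The equation that eliminates a given coordinate; [lead_inj] makes it unique. *)
Definition cond_at (ik : 'I_n * 'I_n) := [pick l | C ik.1 l && (lead ik.1 l == Some ik.2)].

Definition free_pair (ik : 'I_n * 'I_n) := inversion_pair ik.1 ik.2 && ~~ isSome (cond_at ik).

Definition lead_pair (il : 'I_n * 'I_n) := C il.1 il.2 && (lead il.1 il.2 != None).

(** (i, l) -> (i, lead i l) is a bijection from [lead_pair] onto the inversion pairs that are not
    free; the default value is never reached there. *)
Lemma card_free_pair : (#|free_pair| + #|lead_pair| = #|[pred ik | inversion_pair ik.1 ik.2]|)%N.
Proof.
pose f (il : 'I_n * 'I_n) := (il.1, odflt il.1 (lead il.1 il.2)).
have finj : {in lead_pair &, injective f}.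
  move=> [i l] [i' l'] /andP[/= _ n1] /andP[/= _ n2] [E]; subst i'.
  case E1: (lead i l) n1 => [k|] // _; case E2: (lead i l') n2 => [k'|] //= _ E.
  by rewrite (lead_inj E1 (etrans E2 (congr1 Some (esym E)))).
rewrite -(card_in_image finj) -[RHS](cardID [pred ik | ~~ isSome (cond_at ik)] _).
congr addn; apply: eq_card => -[i k]; apply/idP/idP.
  move=> /fintype.imageP[[i' l] /andP[/= Cil nl] [-> ->]]; case E: (lead i' l) nl => [k'|] // _ /=.
  rewrite !inE /= negbK (lead_inv_pair Cil E) andbT /cond_at; case: pickP => // /(_ l) /=.
  by rewrite Cil E eqxx.
rewrite !inE negbK /cond_at /= => /andP[+ _]; case: pickP => // l /andP[Cil /eqP E] _.
by apply/fintype.imageP; exists (i, l); rewrite ?unfold_in /lead_pair /f /= ?Cil ?E.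
Qed.

(** Lower rows first, columns from left to right: the order in which [conjJ_lead] is triangular. *)
Let rk (ik : 'I_n * 'I_n) := ((n - ik.1) * n + ik.2)%N.

Let rk_row i i' k k' : (i < i')%N -> (rk (i', k') < rk (i, k))%N.
Proof.
move=> ii; rewrite /rk /=; have := ltn_ord k'; have := ltn_ord i'.
have : (n - i' < n - i)%N by apply: ltn_sub2l => //; apply: ltn_ord.
move: (n - i')%N (n - i)%N => a b ab _ kn.
apply: (@leq_trans (a.+1 * n + k)); last by rewrite leq_add2r leq_mul2r ab orbT.
by rewrite mulSn; lia.
Qed.

Let rk_inj : injective rk.
Proof.
move=> [i k] [i' k'] E; have [ii|ii|/val_inj ii] := ltngtP i i'.
- by have := rk_row k k' ii; rewrite E ltnn.
- by have := rk_row k' k ii; rewrite E ltnn.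
by subst i'; congr (_, _); apply: val_inj; move/eqP: E; rewrite /rk /= eqn_add2l => /eqP.
Qed.

Let hat (x : 'M[F]_n) : 'M[F]_n := \matrix_(i, k) if inversion_pair i k then x i k else (i == k)%:R.

Let hatU x : inU (hat x). Proof. by move=> i k /negPf ik; rewrite mxE ik. Qed.

Let hatK u : inU u -> hat u = u.
Proof. by move=> uU; apply/matrixP => i k; rewrite mxE; case: ifPn => // /uU. Qed.

Let hat_poly : polymap hat.
Proof.
move=> i k; case E: (inversion_pair i k).
  by apply: eq_polyf (polyf_entry F i k) => x; rewrite mxE E.
by apply: eq_polyf (polyfC (i == k)%:R) => x; rewrite mxE E.
Qed.

(** The equation solved for its leading coordinate, which cancels from the right side by
    [conjJ_lead]. On [hat x], of determinant one, the adjugate is the inverse and is polynomial. *)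
Let Q ik (x : 'M[F]_n) := if cond_at ik is Some l then
  hat x ik.1 ik.2 - (lead_coef ik.1 l)^-1 * (\adj (hat x) *m J *m hat x) ik.1 l
  else (ik.1 == ik.2)%:R.

Let adjE u : inU u -> \adj u = invmx u.
Proof.
move=> /inU_unitri uu; have nu := unitri_unit uu.
by rewrite /invmx nu unitri_det // invr1 scale1r.
Qed.

(** The parametrised subset of [U_pi] cut out by the equations [C]; the free
    coordinates are those not of the form [(i, lead i l)]. *)
Lemma cell_param : exists a : 'rV[F]_#|free_pair| -> 'M[F]_n, [/\ polymap a,
  forall y, inU (a y) /\ forall i l, C i l -> conjJ (a y) i l = 0,
  forall y (i : 'I_#|free_pair|), a y (enum_val i).1 (enum_val i).2 = y 0 i
  & forall u, inU u -> (forall i l, C i l -> conjJ u i l = 0) -> exists y, u = a y].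
Proof.
have condP ik l : cond_at ik = Some l -> C ik.1 l /\ lead ik.1 l = Some ik.2.
  by rewrite /cond_at; case: pickP => // l' /andP[Cl /eqP ll] [<-].
have condE i l k : C i l -> lead i l = Some k -> cond_at (i, k) = Some l.
  move=> Cil E; rewrite /cond_at /=; case: pickP => [l' /andP[_ /eqP E']|/(_ l)].
    by rewrite (lead_inj E E').
  by rewrite Cil E eqxx.
have Q_poly ik : polyf (Q ik).
  rewrite /Q; case: (cond_at ik) => [l|]; last exact: polyfC.
  apply: polyfB; first exact: hat_poly.
  apply: polyfM; first exact: polyfC.
  exact: (polymapM (polymapM (polymap_adj hat_poly) (polymapC _)) hat_poly).
have Q_dep (j : 'I_n * 'I_n) (x x' : 'M[F]_n) : ~~ free_pair j ->
    (forall j' : 'I_n * 'I_n, (rk j' < rk j)%N -> x j'.1 j'.2 = x' j'.1 j'.2) -> Q j x = Q j x'.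
  move=> _; case: j => i k xx; rewrite /Q; case E: (cond_at _) => [l|] //=.
  have /= [Cil lk] := condP _ _ E; have il : (i < l)%N by case/andP: Cil.
  have hx (j : 'I_n * 'I_n) : (rk j < rk (i, k))%N -> hat x j.1 j.2 = hat x' j.1 j.2.
    by move=> jk; rewrite !mxE; case: ifP => // _; apply: xx.
  rewrite !adjE // -!/(conjJ _).
  have H : conjJ (hat x) i l - conjJ (hat x') i l = lead_coef i l * (hat x i k - hat x' i k).
    apply: (conjJ_lead (inU_unitri (hatU x)) (inU_unitri (hatU x')) il lk) => [i' j ii|j jk].
      by apply: (hx (i', j)); apply: rk_row.
    by apply: (hx (i, j)); rewrite /rk /= ltn_add2l.
  apply/eqP; rewrite -subr_eq0; apply/eqP.
  have -> (z z' c c' e : F) : z - e * c - (z' - e * c') = (z - z') - e * (c - c') by ring.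
  by rewrite H mulKf ?subrr // lead_coef_neq0.
have [a [pa aE a1 a2]] := graph_param rk_inj Q_poly Q_dep.
exists a; split=> //.
- move=> y; have aU : inU (a y).
    move=> i k nik; have := aE y (i, k); rewrite /free_pair /= (negPf nik) => /(_ isT) ->.
    rewrite /Q; case E: (cond_at _) => [l|] //=; have /= [Cil lk] := condP _ _ E.
    by rewrite (lead_inv_pair Cil lk) in nik.
  split=> // i l Cil; case lk: (lead i l) => [k|]; last exact: lead_none (inU_unitri aU) Cil lk.
  have := aE y (i, k); rewrite /free_pair /Q (condE i l k) //= andbF => /(_ isT).
  rewrite hatK // adjE // -/(conjJ _) => /eqP; rewrite -subr_eq0 opprB addrCA subrr addr0.
  by rewrite mulf_eq0 invr_eq0 (negPf (lead_coef_neq0 _ _)) => /eqP.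
move=> u uU Cu; apply: a2 => -[i k] /=; rewrite /free_pair /Q.
case E: (cond_at _) => [l|] /=; last by rewrite andbT => /uU.
have /= [Cil lk] := condP _ _ E => _.
by rewrite hatK // adjE // -/(conjJ _) Cu // mulr0 subr0.
Qed.

(** Conjugates by the Levi part vanish below the pivot of a column and outside the blocks.
    Conversely, with m = r l, conjugation by 1 + E_(i,m) adds row m to row i and produces the entry
    1 at (i, l). *)
Lemma orbit_support i l : C i l ->
  (exists u, [/\ inU u, masked (same_eigen sigma) u & (u *m Nmx *m invmx u) i l != 0]) <->
  sigma i = sigma l /\ lead i l != None.
Proof.
move=> Cil; have /andP[il _] := Cil; split.
  move=> [u [uU mu uN]]; have uu := inU_unitri uU; have nu := unitri_unit uu.
  have mi : masked (same_eigen sigma) (invmx u).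
    by apply: masked_inv => //; [apply: same_eigen_refl|apply: same_eigen_trans].
  have uE : u *m Nmx *m invmx u = invmx (invmx u) *m Nmx *m invmx u by rewrite invmxK.
  have mN : masked (same_eigen sigma) Nmx.
    by move=> k m km; rewrite mxE; case: eqP => // /r_lt[_ E]; rewrite /same_eigen E eqxx in km.
  have sil : sigma i = sigma l.
    apply/eqP; apply: contraNT uN => nil; apply/eqP.
    have := maskedM (@same_eigen_trans _ _ sigma) (maskedM (@same_eigen_trans _ _ sigma) mu mN) mi; exact.
  split=> //; rewrite /lead sil eqxx.
  have [Z0 _] := pivot_conj l (unitri_inv uu) mi.
  case rl: (r l) Z0 => [m|] Z0; last by move: uN; rewrite uE Z0 ?eqxx.
  case: ltnP => // mi'; move: uN; rewrite uE Z0 ?eqxx // ltn_neqAle mi' andbT val_eqE.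
  by have [_] := cond_pivot Cil rl.
move=> [sil]; case lk: (lead i l) => [m|] // _; have im := lead_inv_pair Cil lk.
move: lk; rewrite /lead sil eqxx; case rl: (r l) => [m'|] //; case: ifP => // ltim [E]; subst m'.
have [ml sml] := r_lt rl.
have nim : i != m by rewrite -val_eqE neq_ltn ltim.
have niml : l != m by rewrite -val_eqE neq_ltn ml orbT.
have dd : delta_mx i m *m delta_mx i m = 0 :> 'M[F]_n by rewrite mul_delta_mx_0 // eq_sym.
exists (1%:M + delta_mx i m); split.
- move=> j k jk; rewrite !mxE; case: andP => [[/eqP E1 /eqP E2]|_]; last by rewrite addr0.
  by move: jk; rewrite E1 E2 im.
- move=> j k jk; rewrite !mxE; case: (eqVneq j k) jk => [->|_ jk]; first by rewrite same_eigen_refl.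
  rewrite add0r; case: andP => // -[/eqP E1 /eqP E2]; move: jk.
  by rewrite /same_eigen E1 E2 sil sml eqxx.
have E1 : (1%:M + delta_mx i m) *m (1%:M - delta_mx i m) = 1%:M :> 'M[F]_n.
  by rewrite mulmxDl mul1mx mulmxBr mulmx1 dd subr0 subrK.
have [nu _] := mulmx1_unit E1.
have -> : invmx (1%:M + delta_mx i m) = 1%:M - delta_mx i m :> 'M[F]_n.
  by rewrite -[RHS](mulKmx nu) E1 mulmx1.
rewrite mulmxBr mulmx1 mxE [X in _ + X]mxE [X in - X]mxE big1 ?subr0 => [|j _]; last first.
  by rewrite [X in _ * X]mxE (negPf niml) andbF mulr0.
rewrite mulmxDl mul1mx !mxE rl (bigD1 m) //= !mxE !eqxx rl eqxx mulr1.
rewrite big1 ?addr0 => [|j jm]; last by rewrite !mxE (negPf jm) andbF mul0r.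
have -> : (Some m == Some i) = false by apply: contraNF nim => /eqP[->].
by rewrite add0r oner_eq0.
Qed.

End Solutions.

End CellEquations.

(** * Coordinates on Schubert cells *)

Section GaussDecomposition.
Variables (F : fieldType) (n : nat).
Implicit Types (x nu tau : 'M[F]_n) (p : {perm 'I_n}) (i j k : 'I_n).

Let D k : 'M[F]_n := dg F (fun j : 'I_n => j <= k)%N.

(** The leading block of size k + 1 completed by the identity, so that blocks of all sizes are
    matrices of the same type. *)
Definition lead_mx k x : 'M[F]_n := D k *m x *m D k + (1%:M - D k).
Definition lead_minor k x := \det (lead_mx k x).
(** The first factor of [x] as a product of a lower unitriangular and an upper
    triangular matrix, if the leading minors do not vanish: it only depends on the
    coset of [x] under upper triangular matrices. *)
Definition gauss_lower x : 'M[F]_n := \matrix_(i, k) (x *m invmx (lead_mx k x)) i k.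

Lemma lead_mxE k x i j :
  lead_mx k x i j = if (i <= k)%N && (j <= k)%N then x i j else ((i == j) && (k < i)%N)%:R.
Proof.
have E : (1%:M - D k) i j = (i == j)%:R - D k i j by rewrite !mxE.
rewrite mxE [X in X + _]mul_mx_dg mul_dg E dgE.
have [ik|ki] := leqP i k; have [jk|kj] := leqP j k; rewrite /= ?andbF ?andbT ?subrr ?addr0 ?add0r ?subr0 //.
Qed.

Lemma lead_mx_masked (e : rel 'I_n) k x : reflexive e -> masked e x -> masked e (lead_mx k x).
Proof.
move=> er mx i j ij; rewrite lead_mxE mx //; case: ifP => // _.
by case: (eqVneq i j) ij => // ->; rewrite er.
Qed.

Lemma dg_masked k x : masked (@up n) x -> x *m D k = D k *m x *m D k.
Proof.
move=> ux; apply/matrixP => i j; rewrite !mul_mx_dg mul_dg; case: leqP => // jk.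
by case: leqP => // ki; rewrite ux // /up -ltnNge (leq_ltn_trans jk).
Qed.

Lemma lead_mxM k nu tau : masked (@up n) tau ->
  lead_mx k (nu *m tau) = lead_mx k nu *m lead_mx k tau.
Proof.
move=> /(dg_masked k) ut; rewrite /lead_mx.
have DD : D k *m D k = D k by exact: dg_idem.
have DE : D k *m (1%:M - D k) = 0 by rewrite mulmxBr mulmx1 DD subrr.
have ED : (1%:M - D k) *m D k = 0 by rewrite mulmxBl mul1mx DD subrr.
have EE : (1%:M - D k) *m (1%:M - D k) = 1%:M - D k by rewrite mulmxBl mul1mx DE subr0.
move: (1%:M - D k) DE ED EE => E DE ED EE.
rewrite mulmxDl !mulmxDr EE -!(mulmxA _ _ E) DE !mulmx0 !(mulmxA E) ED !mul0mx addr0 add0r.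
have -> : D k *m (nu *m tau) *m D k = D k *m nu *m (tau *m D k) by rewrite !mulmxA.
by rewrite ut !mulmxA -(mulmxA _ (D k) (D k)) DD.
Qed.

Lemma lead_inv k x i : lead_minor k x != 0 -> (k < i)%N -> invmx (lead_mx k x) i k = 0.
Proof.
rewrite -unitfE -[_ \is a _]/(lead_mx k x \in unitmx) => ux ki.
have /matrixP/(_ i k) := mulmxV ux; rewrite !mxE (bigD1 i) //= lead_mxE leqNgt ki /= eqxx mul1r.
rewrite big1 ?addr0 => [->|j ji]; first by rewrite -val_eqE gtn_eqF.
by rewrite lead_mxE leqNgt ki /= eq_sym (negPf ji) mul0r.
Qed.

Lemma gauss_lower_unitri x : (forall k, lead_minor k x != 0) -> unitri (gauss_lower x)^T.
Proof.
move=> x0; have low i k : (i <= k)%N -> gauss_lower x i k = (i == k)%:R.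
  move=> ik; have ux : lead_mx k x \in unitmx by rewrite unitmxE unitfE; apply: x0.
  have /matrixP/(_ i k) := mulmxV ux; rewrite [LHS]mxE [RHS]mxE => <-; rewrite !mxE.
  apply: eq_bigr => j _; rewrite lead_mxE ik /=; case: (leqP j k) => // kj.
  by rewrite lead_inv ?mulr0 // x0.
apply/unitriP; split=> [i k|i]; rewrite mxE; last by rewrite low ?eqxx.
by rewrite /up -ltnNge => ki; rewrite low ?(ltnW ki) // -val_eqE ltn_eqF.
Qed.

Lemma gauss_lower_unit x : (forall k, lead_minor k x != 0) -> gauss_lower x \in unitmx.
Proof. by move=> /gauss_lower_unitri/unitri_unit; rewrite unitmx_tr. Qed.

(** The upper factor has as column k that of the inverse of the k-th leading block, which is zero
    below the diagonal. *)
Lemma gauss_upper x : (forall k, lead_minor k x != 0) ->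
  exists2 y : 'M[F]_n, masked (@up n) y & x *m y = gauss_lower x.
Proof.
move=> x0; exists (\matrix_(i, k) invmx (lead_mx k x) i k).
  by move=> i k; rewrite /up -ltnNge => ki; rewrite mxE lead_inv.
by apply/matrixP => i k; rewrite !mxE; apply: eq_bigr => j _; rewrite mxE.
Qed.

Lemma gauss_decomposition x : (forall k, lead_minor k x != 0) ->
  exists2 tau, masked (@up n) tau & x = gauss_lower x *m tau.
Proof.
move=> x0; have [y uy xy] := gauss_upper x0; have := gauss_lower_unit x0.
rewrite -xy unitmx_mul => /andP[_ nuy]; exists (invmx y); last by rewrite mulmxK.
by apply: masked_inv.
Qed.

Lemma unitri_lower_upper x : unitri x^T -> masked (@up n) x -> x = 1%:M.
Proof.
move=> /unitriP[lx x1] ux; apply/matrixP => i j; rewrite [RHS]mxE.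
have [ij|ji|/val_inj->] := ltngtP i j; last by have := x1 j; rewrite mxE eqxx.
  by have := lx j i; rewrite mxE /up -ltnNge ij -val_eqE ltn_eqF // => ->.
by rewrite ux /up -?ltnNge // -val_eqE gtn_eqF.
Qed.

Lemma lead_minor_lower k nu : unitri nu^T -> lead_minor k nu = 1.
Proof.
move=> /unitriP[ln n1]; rewrite /lead_minor -det_tr; apply/unitri_det/unitriP.
split=> [i j|i]; rewrite mxE lead_mxE.
  rewrite /up -ltnNge => ji; case: ifP => _; first by have := ln i j; rewrite mxE /up -ltnNge; apply.
  by rewrite -val_eqE ltn_eqF.
by rewrite andbb eqxx; case: leqP => // _; have := n1 i; rewrite mxE.
Qed.

Lemma lead_minor_upper k tau : masked (@up n) tau -> tau \in unitmx -> lead_minor k tau != 0.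
Proof.
move=> ut; rewrite up_unit // => /forallP t0; rewrite /lead_minor det_up.
  apply/prodf_neq0 => i _; rewrite lead_mxE andbb eqxx.
  by case: leqP => // _; rewrite oner_eq0.
by apply: lead_mx_masked.
Qed.

(** Uniqueness of the decomposition: two lower factors differ by a matrix both lower unitriangular
    and upper triangular. *)
Lemma gauss_lower_eq nu tau : unitri nu^T -> masked (@up n) tau -> tau \in unitmx ->
  (forall k, lead_minor k (nu *m tau) != 0) /\ gauss_lower (nu *m tau) = nu.
Proof.
move=> ln ut nt; have x0 k : lead_minor k (nu *m tau) != 0.
  rewrite /lead_minor lead_mxM // det_mulmx -!/(lead_minor _ _) lead_minor_lower // mul1r.
  exact: lead_minor_upper.
split=> //; have [y uy xy] := gauss_upper x0.
have nn : nu \in unitmx by rewrite -unitmx_tr; apply: unitri_unit.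
rewrite -xy -mulmxA (_ : tau *m y = 1%:M) ?mulmx1 //; apply: unitri_lower_upper; last exact: maskedM.
have -> : tau *m y = invmx nu *m gauss_lower (nu *m tau) by rewrite -xy -mulmxA mulKmx.
rewrite trmx_mul trmx_inv; apply: unitriM; [exact: gauss_lower_unitri|exact: unitri_inv].
Qed.

(** Matrices masked by this relation are the conjugates w^-1 b w of upper triangular ones, w being
    monomial with permutation p. *)
Definition perm_up p : rel 'I_n := fun i j => (p i <= p j)%N.

Lemma perm_up_refl p : reflexive (perm_up p). Proof. by move=> i; apply: leqnn. Qed.
Lemma perm_up_trans p : transitive (perm_up p). Proof. by move=> j i k; apply: leq_trans. Qed.

Lemma det_perm_up p x : masked (perm_up p) x -> \det x = \prod_i x i i.
Proof.
move=> mx; pose A : 'M[F]_n := \matrix_(i, j) x ((p^-1)%g i) ((p^-1)%g j).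
have t0 (j : 'I_n) : (1 : F) != 0 by rewrite oner_eq0.
have xA : x = Ad (invmx (mono p (fun=> 1))) A.
  apply/matrixP => i j; rewrite (Ad_mono _ _ _ _ t0) [A _ _]mxE !permK invr1 mul1r mulr1.
  by [].
rewrite {1}xA Ad_det ?unitmx_inv ?mono_unit // det_up.
  rewrite (reindex_inj (@perm_inj _ p)) /=; apply: eq_bigr => i _; by rewrite mxE !permK.
by move=> i j ij; rewrite mxE mx // /perm_up !permKV.
Qed.

(** The completed leading block is masked by the same relation, so its determinant is the product of
    its diagonal entries. Thus the Gauss decomposition exists on all of w^-1 B w. *)
Lemma lead_minor_perm_up p x k : masked (perm_up p) x -> x \in unitmx -> lead_minor k x != 0.
Proof.
move=> mx; rewrite unitmxE unitfE (det_perm_up mx) => /prodf_neq0 x0.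
have ml := lead_mx_masked k (@perm_up_refl p) mx.
rewrite /lead_minor (det_perm_up ml); apply/prodf_neq0 => i _; rewrite lead_mxE andbb eqxx.
by case: leqP => // _; [apply: x0|rewrite oner_eq0].
Qed.

Lemma gauss_lower_masked p x : masked (perm_up p) x -> x \in unitmx ->
  masked (perm_up p) (gauss_lower x).
Proof.
move=> mx ux i k ik; rewrite mxE.
have ml := lead_mx_masked k (@perm_up_refl p) mx.
have ul : lead_mx k x \in unitmx by rewrite unitmxE unitfE; exact: lead_minor_perm_up k mx ux.
have mi := masked_inv (@perm_up_refl p) (@perm_up_trans p) ul ml.
exact: (maskedM (@perm_up_trans p) mx mi).
Qed.

Definition gauss_den x := \prod_k lead_minor k x.
(** Each column of [gauss_lower] has its own minor as denominator; the product of the others brings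
    all to the denominator [gauss_den]. *)
Definition gauss_num x : 'M[F]_n :=
  \matrix_(i, k) ((x *m \adj (lead_mx k x)) i k * \prod_(l | l != k) lead_minor l x).

Lemma lead_mx_poly k : polymap (lead_mx k).
Proof.
exact: polymapD (polymapM (polymapM (polymapC _) polymap_id) (polymapC _)) (polymapC _).
Qed.

Lemma gauss_den_poly : polyf gauss_den.
Proof. by apply: polyf_prod => k _; apply: polyf_det; apply: lead_mx_poly. Qed.

Lemma gauss_num_poly : polymap gauss_num.
Proof.
move=> i k; apply: (@eq_polyf _ _ _ (fun x => (x *m \adj (lead_mx k x)) i k *
  \prod_(l | l != k) lead_minor l x)); first by move=> x; rewrite [RHS]mxE.
apply: polyfM; first by apply: polymapM; [apply: polymap_id|apply: polymap_adj; apply: lead_mx_poly].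
by apply: polyf_prod => l _; apply: polyf_det; apply: lead_mx_poly.
Qed.

Lemma gauss_den_neq0 x : gauss_den x != 0 <-> forall k, lead_minor k x != 0.
Proof. by split=> [/prodf_neq0 H k|H]; [apply: H|apply/prodf_neq0 => k _; apply: H]. Qed.

Lemma gauss_numE x : gauss_den x != 0 -> (gauss_den x)^-1 *: gauss_num x = gauss_lower x.
Proof.
move=> /[dup]/gauss_den_neq0 x0 q0; apply/matrixP => i k; rewrite [LHS]mxE [gauss_num _ _ _]mxE.
rewrite [RHS]mxE /invmx unitmxE unitfE x0 -scalemxAr [in RHS]mxE -/(lead_minor k x).
have -> : gauss_den x = lead_minor k x * \prod_(l | l != k) lead_minor l x.
  by rewrite /gauss_den (bigD1 k).
have : \prod_(l | l != k) lead_minor l x != 0 by apply/prodf_neq0 => l _; apply: x0.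
move: (\prod_(l | l != k) _) (x0 k) => b; move: (lead_minor k x) ((_ *m _) i k) => a c a0 b0.
by field; rewrite a0.
Qed.

End GaussDecomposition.

(** * Charts on the intersections of cells with the variety *)

Section Cells.
Variables (F : numFieldType) (n : nat) (i0 : 'I_n) (sl : bool) (P : 'M[F]_n).
Hypothesis uP : P \in unitmx.
Local Notation cj := (Ad (invmx P)).
Local Notation G := (@grp F n sl).
Local Notation B := (borel sl P).
Variables (M : 'M[F]_n) (sigma : 'I_n -> F) (r : 'I_n -> option 'I_n).
Hypotheses (ME : cj M = Smx sigma + Nmx F r) (M_tr : sl -> \tr M = 0).
Hypothesis sigma_convex :
  forall i j k : 'I_n, (i <= j <= k)%N -> sigma i = sigma k -> sigma i = sigma j.
Hypothesis r_lt : forall l k, r l = Some k -> (k < l)%N /\ sigma k = sigma l.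
Hypothesis r_mono : forall i j k : 'I_n, (i < j)%N -> sigma i = sigma j -> r i = Some k ->
  exists2 k', r j = Some k' & (k < k')%N.
Variable H : {vspace 'M[F]_n}.
Hypothesis HH : hessenberg_space G B H.
Implicit Types (C : flag_variety G B) (u X : 'M[F]_n) (i j k l : 'I_n).
Local Notation hs := (hess P H).

Let B_subgroup : subgroup B.
Proof. by apply: mgroup_subgroup. Qed.

Let B_G : B `<=` G. Proof. by move=> b []. Qed.

Lemma unitri_borel u : unitri u -> B (Ad P u).
Proof. by move=> uu; split; [apply: grp_unitri|rewrite AdK //; case/unitriP: uu]. Qed.

Lemma hess_stable b X : B b -> X \in H -> Ad (invmx b) X \in H.
Proof.
move=> [[ub db] mb] /(mem_hess i0 uP HH)[/(lie_grp i0 sl uP) trX hX].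
have ubV : invmx b \in unitmx by rewrite unitmx_inv.
have ucb : cj b \in unitmx by rewrite Ad_unit ?unitmx_inv.
apply/(mem_hess i0 uP HH); split=> [|i j].
  by apply/(lie_grp i0 sl uP); rewrite Ad_tr.
rewrite cj_Ad // Ad_inv ?unitmx_inv //; move: (cj X) hX => A hA.
have mi := masked_inv (@up_refl n) (@up_trans n) ucb mb.
move: (cj b) mb mi => b' mb mi; rewrite /Ad invmxK => nij.
apply: contraNT nij => nh; rewrite mxE big1 // => l _.
have [->|blj] := eqVneq (b' l j) 0; first by rewrite mulr0.
rewrite [X in X * _]mxE big1 ?mul0r // => k _.
have [->|Akl] := eqVneq (A k l) 0; first by rewrite mulr0.
have [->|bik] := eqVneq (invmx b' i k) 0; first by rewrite mul0r.
case/negP: nh; apply: (hess_trans i0 uP HH (hA _ _ Akl)).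
  by apply: contraNT bik => /mi->.
by apply: contraNT blj => /mb->.
Qed.

Lemma hessenberg_coset C g : G g -> val C = left_coset g B ->
  (hessenberg_variety G B M H C <-> Ad (invmx g) M \in H).
Proof.
move=> Gg gC; split=> [[g' [Gg' g'C]]|]; last by exists g.
rewrite g'C in gC; have [ug _] := Gg; have [ug' _] := Gg'.
have [b Bb ->] := (left_coset_eq g B_subgroup ug').1 gC.
have [ub _] := B_G Bb.
by rewrite invmxM // Ad_mul ?unitmx_inv //; apply: hess_stable.
Qed.

Section FixedCell.
Variables (w : 'M[F]_n) (p : {perm 'I_n}) (t : 'I_n -> F).
Hypotheses (Gw : G w) (wE : cj w = mono p t).
Local Notation C_ := (cond_pair hs p).
Let m : 'M[F]_n := mono p t.

Let uw : w \in unitmx. Proof. by case: Gw. Qed.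
Let t0 j : t j != 0. Proof. exact: (weyl_t_neq0 uP Gw wE). Qed.
Let um : m \in unitmx. Proof. exact: mono_unit. Qed.

Lemma cell_rep_grp u : inU p u -> G (Ad P u *m w).
Proof.
move=> /inU_unitri/(grp_unitri sl uP) Gu.
by have [_ _ GM _] := @grp_subgroup F n sl; apply: GM.
Qed.

Lemma cell_equations u : inU p u -> (Ad (invmx (Ad P u *m w)) M \in H <->
  forall i l, C_ i l -> conjJ sigma r u i l = 0).
Proof.
move=> /inU_unitri uu; have nu := unitri_unit uu.
have nPu : Ad P u \in unitmx by rewrite Ad_unit.
rewrite invmxM // Ad_mul ?unitmx_inv // (mem_hess_weyl i0 uP HH _ Gw wE).
have -> : cj (Ad (invmx (Ad P u)) M) = conjJ sigma r u.
  by rewrite cj_Ad ?unitmx_inv // Ad_inv ?unitmx_inv // AdK // ME /Ad invmxK.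
split=> [[_ Hij] i l /andP[il nh]|Hij].
  by apply/eqP; apply: contraNT nh; apply: Hij.
split; first by apply/(lie_grp i0 sl uP); rewrite Ad_tr ?unitmx_inv.
move=> i j; apply: contraNT => nh; apply/eqP.
have [ij|ji] := ltnP i j; first by apply: Hij; rewrite /cond_pair ij.
have [E|nij] := eqVneq i j; first by rewrite E (hess_up i0 uP HH) in nh.
apply: (conjJ_up r_lt uu); rewrite /up -ltnNge ltn_neqAle ji andbT val_eqE eq_sym; exact: nij.
Qed.

(** The definition of U_pi conjugated by w: upper triangularity of u becomes the mask [perm_up p],
    and membership of w^-1 u w in the opposite unipotent group becomes lower unitriangularity. *)
Lemma inU_lower u : inU p u <->
  unitri (Ad (invmx m) u)^T /\ masked (perm_up p) (Ad (invmx m) u).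
Proof.
have uE i j : Ad (invmx m) u i j = (t i)^-1 * u (p i) (p j) * t j by rewrite Ad_mono.
split=> [uU|[/unitriP[ml l1] mu] i k nik].
  have z i j : ~~ inversion_pair p (p i) (p j) -> i != j -> Ad (invmx m) u i j = 0.
    by move=> nij ij; rewrite uE uU // (inj_eq perm_inj) (negPf ij) mulr0 mul0r.
  split; last first.
    move=> i j nij; apply: z; last by apply: contraNneq nij => ->; apply: perm_up_refl.
    by rewrite /inversion_pair; apply: contra nij => /andP[/ltnW].
  apply/unitriP; split=> [i j|i]; rewrite mxE; last first.
    by rewrite uE uU ?eqxx ?mulr1 ?mulVf // /inversion_pair ltnn.
  rewrite /up -ltnNge => ji; apply: z; last by rewrite -val_eqE neq_ltn ji.
  by rewrite /inversion_pair !permK [(i < j)%N]ltnNge (ltnW ji) andbF.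
have [i' iE] : exists i', i = p i' by exists ((p^-1)%g i); rewrite permKV.
have [k' kE] : exists k', k = p k' by exists ((p^-1)%g k); rewrite permKV.
subst i k; have -> : u (p i') (p k') = t i' * Ad (invmx m) u i' k' * (t k')^-1.
  by rewrite uE; have := t0 i'; have := t0 k'; move=> ? ?; field; apply/andP.
rewrite (inj_eq perm_inj); have [->|ik] := eqVneq i' k'.
  by have := l1 k'; rewrite mxE => ->; rewrite mulr1 divff.
suff -> : Ad (invmx m) u i' k' = 0 by rewrite mulr0 mul0r.
move: nik; rewrite /inversion_pair !permK => /nandP[]; rewrite -leqNgt => h.
  apply: mu; rewrite /perm_up -ltnNge ltn_neqAle h andbT val_eqE (inj_eq perm_inj) eq_sym; exact: ik.
have := ml k' i'; rewrite mxE; apply.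
rewrite /up -ltnNge ltn_neqAle h andbT val_eqE; exact: ik.
Qed.

(** Writing w^-1 b w = nu tau by Gauss, u = w nu w^-1 lies in U_pi and b w = u w tau, with tau
    absorbed by the coset; det nu = 1 keeps tau in the special linear group. *)
Lemma schubert_cell_rep C : schubert_cell G B w C <->
  exists2 u, inU p u & val C = left_coset (Ad P u *m w) B.
Proof.
split=> [[b [[ub db] mb] bC]|[u uU uC]]; last first.
  by exists (Ad P u) => //; apply: unitri_borel; apply: inU_unitri uU.
have ucb : cj b \in unitmx by rewrite Ad_unit ?unitmx_inv.
pose x := Ad (invmx m) (cj b).
have mx : masked (perm_up p) x.
  by move=> i j ij; rewrite Ad_mono // mb ?mulr0 ?mul0r.
have ux : x \in unitmx by rewrite Ad_unit ?unitmx_inv.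
have x0 k : lead_minor k x != 0 by exact: lead_minor_perm_up k mx ux.
have [tau mt xt] := gauss_decomposition x0.
have ln := gauss_lower_unitri x0; have mn := gauss_lower_masked mx ux.
move: (gauss_lower x) ln mn xt => nu ln mn xt.
have unu : nu \in unitmx by rewrite -unitmx_tr unitri_unit.
exists (Ad m nu); first by apply/inU_lower; rewrite AdK.
rewrite bC; apply/esym/left_coset_eq => //.
  rewrite unitmx_mul uw andbT Ad_unit // Ad_unit //.
exists (Ad P tau); last first.
  rewrite -[b](AdKV uP) -[w](AdKV uP) wE -/m -!AdM //; congr (Ad P _).
  have -> : cj b = Ad m x by rewrite /x AdKV.
  by rewrite xt /Ad !mulmxA !mulmxKV.
split; last by rewrite AdK.
have ut : tau \in unitmx by move: ux; rewrite xt unitmx_mul => /andP[].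
split=> [|/db dt]; first by rewrite Ad_unit.
have nt1 : \det nu = 1 by rewrite -det_tr unitri_det.
have : \det x = 1 by rewrite Ad_det ?unitmx_inv // Ad_det ?unitmx_inv.
by rewrite xt det_mulmx nt1 mul1r Ad_det.
Qed.

Lemma cellE C : (schubert_cell G B w `&` hessenberg_variety G B M H) C <->
  exists u, [/\ inU p u, forall i l, C_ i l -> conjJ sigma r u i l = 0
    & val C = left_coset (Ad P u *m w) B].
Proof.
split=> [[/schubert_cell_rep[u uU uC] /(hessenberg_coset (cell_rep_grp uU) uC)]|[u [uU Cu uC]]].
  by move=> /(cell_equations uU) Cu; exists u.
split; first by apply/schubert_cell_rep; exists u.
by apply/(hessenberg_coset (cell_rep_grp uU) uC)/cell_equations.
Qed.

Lemma J_hess : Ad (invmx w) M \in H <->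
  forall i j, (Smx sigma + Nmx F r) i j != 0 -> hs ((p^-1)%g i) ((p^-1)%g j).
Proof.
rewrite (mem_hess_weyl i0 uP HH _ Gw wE) ME; split=> [[]//|hJ]; split=> //.
exact/(lie_grp i0 sl uP).
Qed.

(** The equations at any point force the entries of [J] into the transported space by [conjJ_hs];
    conversely the coset of w is itself a point. *)
Lemma cell_nonempty :
  (schubert_cell G B w `&` hessenberg_variety G B M H) !=set0 <-> Ad (invmx w) M \in H.
Proof.
split=> [[C /cellE[u [/inU_unitri uu Cu _]]]|Mw].
  by apply/J_hess => i j; apply: conjJ_hs uu Cu i j => // *; apply: (hess_up i0 uP HH).
exists (coset_map B (SigSub (mem_set Gw) : G)); split.
  by exists 1%:M; [case: B_subgroup|rewrite mul1mx].
exact/(hessenberg_coset Gw).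
Qed.

Let dim := #|free_pair sigma r hs p|.

(** For g = u w b the lower Gauss factor of w^-1 g is w^-1 u w, whatever b. Conjugating it back by w
    and reading the free entries inverts the parametrisation of [cell_param]. *)
Lemma cell_affine : Ad (invmx w) M \in H ->
  isomorphic (induced (schubert_cell G B w `&` hessenberg_variety G B M H)) (affine_space F dim).
Proof.
move=> /J_hess J_hs.
have hsu i j : (i <= j)%N -> hs i j by exact: (hess_up i0 uP HH).
have hst i j k l : hs k l -> (i <= k)%N -> (l <= j)%N -> hs i j by exact: (hess_trans i0 uP HH).
have [a [pa aU aE a_onto]] := cell_param sigma_convex r_lt r_mono hsu hst J_hs.
pose xf (A : 'M[F]_n) := cj (invmx w *m A).
have xf_poly : polymap xf by apply: polymap_Ad; apply: polymapM; [apply: polymapC|apply: polymap_id].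
have xfM A b : xf (A *m b) = xf A *m cj b by rewrite /xf mulmxA AdM ?unitmx_inv.
pose coords (u : 'M[F]_n) : 'rV[F]_dim := \row_i u (enum_val i).1 (enum_val i).2.
pose num A := coords (Ad m (gauss_num (xf A))).
pose Q A := gauss_den (xf A).
have num_poly : polymap num.
  move=> i j; apply: (@eq_polyf _ _ _ (fun A => Ad m (gauss_num (xf A)) (enum_val j).1 (enum_val j).2)).
    by move=> A; rewrite [RHS]mxE.
  exact: (polymap_Ad m (polymap_comp (@gauss_num_poly F n) xf_poly)).
have Q_poly : polyf Q by exact: polyf_comp (@gauss_den_poly F n) xf_poly.
have vE A : Q A != 0 -> (Q A)^-1 *: num A = coords (Ad m (gauss_lower (xf A))).
  move=> QA; rewrite -(gauss_numE QA) AdZ -/(Q A) /num; move: (Ad m _) (Q A) => A' q.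
  by apply/rowP => i; rewrite !mxE.
have xa y : xf (Ad P (a y) *m w) = Ad (invmx m) (a y).
  rewrite /xf mulmxA AdM ?unitmx_inv // AdM ?unitmx_inv // AdK // Ad_inv ?unitmx_inv // wE.
  by rewrite /Ad invmxK.
apply: (affine_criterion num_poly Q_poly (a := fun y => Ad P (a y) *m w)).
- by apply: polymapM; [apply: polymap_Ad|apply: polymapC].
- by move=> y; apply: cell_rep_grp; case: (aU y).
- move=> C; rewrite cellE; split=> [[u [uU Cu uC]]|[y yC]].
    by have [y yE] := a_onto u uU Cu; exists y; rewrite -yE.
  by have [uU Cu] := aU y; exists (a y).
- move=> g g' [ug _] _ /(left_coset_eq g' B_subgroup ug)[b [[ub db] mb] ->] Qg.
  have [tau mt xt] := gauss_decomposition ((gauss_den_neq0 _).1 Qg).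
  have ln := gauss_lower_unitri ((gauss_den_neq0 _).1 Qg).
  have ucb : cj b \in unitmx by rewrite Ad_unit ?unitmx_inv.
  have uxg : xf g \in unitmx by rewrite Ad_unit ?unitmx_inv // unitmx_mul unitmx_inv uw.
  have ut : tau \in unitmx by move: uxg; rewrite xt unitmx_mul => /andP[].
  have [Qgb lowE] := gauss_lower_eq ln (maskedM (@up_trans n) mt mb)
    (etrans (unitmx_mul _ _) (introT andP (conj ut ucb))).
  have E : gauss_lower (xf g) *m (tau *m cj b) = xf (g *m b) by rewrite xfM mulmxA -xt.
  rewrite E in Qgb lowE; have Qgb' : Q (g *m b) != 0 by apply/gauss_den_neq0.
  split; first exact: Qgb'.
  exact: etrans (vE _ Qg) (etrans (congr1 (coords \o Ad m) (esym lowE)) (esym (vE _ Qgb'))).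
move=> y; have [uU _] := aU y; have [ln mn] := (inU_lower _).1 uU.
have [Qa lowE] := gauss_lower_eq ln (masked1 F (@up_refl n)) (unitmx1 _ _).
rewrite mulmx1 -xa in Qa lowE.
have Qa' : Q (Ad P (a y) *m w) != 0 by apply/gauss_den_neq0.
split; first exact: Qa'.
apply: etrans (vE _ Qa') _; rewrite lowE xa AdKV //; apply/rowP => i; rewrite mxE; exact: aE.
Qed.

End FixedCell.
End Cells.

(** * The Bruhat decomposition of a Hessenberg variety *)

Section Assembly.
Variables (F : numFieldType) (n : nat) (i0 : 'I_n) (sl : bool) (P : 'M[F]_n).
Hypothesis uP : P \in unitmx.
Local Notation cj := (Ad (invmx P)).
Local Notation G := (@grp F n sl).
Local Notation B := (borel sl P).
Local Notation h := (cartan sl P).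

(** The longest element of the Weyl group: upper triangular in the reversed basis means lower
    triangular in the original one. *)
Definition rev_mx : 'M[F]_n := mono (perm (@rev_ord_inj n)) (fun=> 1).
Local Notation Bm := (borel sl (P *m rev_mx)).

Lemma rev_mx_unit : rev_mx \in unitmx.
Proof. by apply: mono_unit => j; apply: oner_neq0. Qed.

Let uPV : invmx P \in unitmx. Proof. by rewrite unitmx_inv. Qed.

Let uP' : P *m rev_mx \in unitmx. Proof. by rewrite unitmx_mul uP rev_mx_unit. Qed.

Lemma cj_rev X i j : Ad (invmx (P *m rev_mx)) X i j = cj X (rev_ord i) (rev_ord j).
Proof.
rewrite invmxM ?rev_mx_unit // Ad_mul ?unitmx_inv ?rev_mx_unit // Ad_mono => [|k]; last exact: oner_neq0.
by rewrite !permE invr1 mul1r mulr1.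
Qed.

Lemma rev_ord_lt (i j : 'I_n) : (rev_ord i < rev_ord j)%N = (j < i)%N.
Proof. rewrite /=; have := ltn_ord i; have := ltn_ord j; lia. Qed.

Lemma unitri_rev X : unitri (Ad (invmx (P *m rev_mx)) X) <-> unitri (cj X)^T.
Proof.
split=> /unitriP[m1 d1]; apply/unitriP; split=> [i j|i]; rewrite ?[_^T _ _]mxE.
- rewrite /up -ltnNge => ji; have := m1 (rev_ord j) (rev_ord i); rewrite cj_rev !rev_ordK; apply.
  by rewrite /up -ltnNge rev_ord_lt.
- by have := d1 (rev_ord i); rewrite cj_rev !rev_ordK.
- rewrite cj_rev /up -ltnNge => ji; have := m1 (rev_ord j) (rev_ord i); rewrite [_^T _ _]mxE; apply.
  by rewrite /up -ltnNge rev_ord_lt.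
- by rewrite cj_rev; have := d1 (rev_ord i); rewrite [_^T _ _]mxE.
Qed.

Lemma borel_opposite : opposite_borel h G B Bm.
Proof.
split; first exact: borel_borel.
rewrite torusE // predeqE => g; split=> [[[Gg mg] [_ mg']]|[Gg dg]].
  split=> // i j ij; have [lij|lji|/val_inj E] := ltngtP i j; last by rewrite /diag_rel E eqxx in ij.
    have := mg' (rev_ord i) (rev_ord j); rewrite cj_rev !rev_ordK; apply.
    by rewrite /up -ltnNge rev_ord_lt.
  by apply: mg; rewrite /up -ltnNge.
split; split=> // i j ij.
  by apply: dg; apply: contra ij => /eqP->; apply: up_refl.
by rewrite cj_rev; apply: dg; apply: contra ij => /eqP/rev_ord_inj->; apply: up_refl.
Qed.

Lemma weyl_exists (p : {perm 'I_n}) : exists w t, G w /\ cj w = mono p t.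
Proof.
pose d := \det (mono p (fun=> 1 : F)).
have d0 : d != 0 by rewrite -unitfE -unitmxE; apply: mono_unit => j; apply: oner_neq0.
(* The scalar at [i0] normalises the determinant to 1, so the same representative serves for
   SL_n. *)
pose t j := if j == i0 then d^-1 else 1.
have t0 j : t j != 0 by rewrite /t; case: ifP; rewrite ?invr_eq0 // oner_neq0.
exists (Ad P (mono p t)), t; split; last by rewrite AdK.
split=> [|_]; first by rewrite Ad_unit // mono_unit.
have -> : mono p t = mono p (fun=> 1) *m mono 1%g t.
  by rewrite mono_mul mul1g; congr mono; apply: funext => j; rewrite mul1r.
rewrite Ad_det // det_mulmx -/d det_up => [|i j]; last first.
  by rewrite mxE perm1; case: eqP => // ->; rewrite up_refl.
rewrite (bigD1 i0) //= big1 => [|i ii]; last by rewrite mxE perm1 eqxx /t (negPf ii).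
by rewrite mxE perm1 eqxx /t eqxx mulr1 mulfV.
Qed.

Section WeylElement.
Variables (w : 'M[F]_n) (p : {perm 'I_n}) (t : 'I_n -> F).
Hypotheses (Gw : G w) (wE : cj w = mono p t).

Lemma unipotent_cellE u : unipotent_cell B Bm w u <-> inU p (cj u).
Proof.
have [uw _] := Gw; have [_ _ GM GV] := @grp_subgroup F n sl.
have mE X : cj (Ad (invmx w) X) = Ad (invmx (mono p t)) (cj X).
  by rewrite cj_Ad ?unitmx_inv // Ad_inv ?unitmx_inv // wE.
rewrite /unipotent_cell /= !unipotent_radical_borel //; split=> [[[Gu mu] [_ /unitri_rev]]|uU].
  rewrite mE => ml; apply/(inU_lower uP Gw wE); split=> // i j ij.
  rewrite Ad_mono; last exact: (weyl_t_neq0 uP Gw wE).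
  by have [mu' _] := (unitriP _).1 mu; rewrite mu' ?mulr0 ?mul0r.
have [ml _] := (inU_lower uP Gw wE _).1 uU; have uu := inU_unitri uU.
have Gu : G u by rewrite -[u](AdKV uP); apply: grp_unitri.
split; first by split.
split; first by rewrite /Ad invmxK; apply: (GM _ _ (GM _ _ (GV _ Gw) Gu) Gw).
by apply/unitri_rev; rewrite mE.
Qed.

End WeylElement.

Variables (M s : 'M[F]_n) (sigma : 'I_n -> F) (r : 'I_n -> option 'I_n).
Hypotheses (M_lie : lie_algebra G M) (sE : cj s = Smx sigma) (NE : cj (M - s) = Nmx F r).
Hypothesis sigma_convex :
  forall i j k : 'I_n, (i <= j <= k)%N -> sigma i = sigma k -> sigma i = sigma j.
Hypothesis r_lt : forall l k, r l = Some k -> (k < l)%N /\ sigma k = sigma l.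
Hypothesis r_mono : forall i j k : 'I_n, (i < j)%N -> sigma i = sigma j -> r i = Some k ->
  exists2 k', r j = Some k' & (k < k')%N.
Local Notation L := (levi sl P sigma).

Let ME : cj M = Smx sigma + Nmx F r.
Proof. by rewrite -sE -NE -AdD addrC subrK. Qed.

Let M_tr : sl -> \tr M = 0. Proof. exact/(lie_grp i0 sl uP). Qed.

Let N_tr : \tr (M - s) = 0.
Proof.
rewrite -(Ad_tr _ uPV) NE /mxtrace big1 // => i _; rewrite mxE.
by case: eqP => // /r_lt[]; rewrite ltnn.
Qed.

Let s_tr : sl -> \tr s = 0.
Proof. by move=> /M_tr; rewrite -[M](subrK s) mxtraceD N_tr add0r. Qed.

Lemma M_borel : lie_algebra B M.
Proof.
apply/lie_borel => //; split=> // i j ij; rewrite ME; exact: (J_up r_lt ij).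
Qed.

Lemma s_cartan : s \in h.
Proof.
apply/mem_cartan => //; split=> // i j; rewrite /diag_rel sE => /negPf ij; by rewrite !mxE ij.
Qed.

Section Dimension.
Variable H : {vspace 'M[F]_n}.
Hypothesis HH : hessenberg_space G B H.
Variables (w : 'M[F]_n) (p : {perm 'I_n}) (t : 'I_n -> F).
Hypotheses (Gw : G w) (wE : cj w = mono p t) (Mw : Ad (invmx w) M \in H).
Local Notation hs := (hess P H).
Local Notation C_ := (cond_pair hs p).

Let hsu (i j : 'I_n) : (i <= j)%N -> hs i j. Proof. exact: (hess_up i0 uP HH). Qed.
Let hst (i j k l : 'I_n) : hs k l -> (i <= k)%N -> (l <= j)%N -> hs i j.
Proof. exact: (hess_trans i0 uP HH). Qed.

Lemma orbit_roots :
  root_supports h G [set Ad u (M - s) | u in unipotent_cell B Bm w `&` L] `&`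
    hessenberg_complement h G B H w =
  @roots_of F n sl P (fun i j => C_ i j && (same_eigen sigma i j && (lead sigma r i j != None))).
Proof.
have J_hs := (J_hess i0 uP ME M_tr HH Gw wE).1 Mw.
rewrite (hess_complementE i0 uP H Gw wE).
rewrite (root_supports_eq i0 uP (r := fun i j => `[< exists u,
  [/\ inU p u, masked (same_eigen sigma) u & (u *m Nmx F r *m invmx u) i j != 0] >])).
- rewrite (roots_ofI i0 sl uP); apply: (eq_roots_of i0 sl uP) => i j ij.
  have [Cij|] := boolP (C_ i j); last by rewrite /cond_pair => /negPf->; rewrite andbF.
  rewrite -/(C_ i j) Cij andbT; apply/asboolP/idP.
    by move=> /(orbit_support r_lt r_mono hsu hst J_hs Cij)[sij ->]; rewrite /same_eigen sij eqxx.
  by rewrite andTb => /andP[/eqP sij nl]; apply/(orbit_support r_lt r_mono hsu hst J_hs Cij).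
- move=> _ [u [_ [[uu _] _]] <-]; apply/(lie_grp i0 sl uP) => _.
  by rewrite Ad_tr.
move=> i j ij; split.
  move=> [_ [u [/(unipotent_cellE Gw wE) uU [[uu _] mu]] <-] Nij]; apply/asboolP.
  by exists (cj u); split=> //; move: Nij; rewrite cj_Ad // NE.
move=> /asboolP[u [uU mu Nij]]; have uu := inU_unitri uU; have nu := unitri_unit uu.
exists (Ad (Ad P u) (M - s)); last by rewrite cj_Ad ?Ad_unit // AdK // NE.
exists (Ad P u) => //; split; first by apply/(unipotent_cellE Gw wE); rewrite AdK.
by split; [apply: grp_unitri|rewrite AdK].
Qed.

Lemma nilradical_roots :
  inversions h G B w `&` root_supports h G (nilradical h s G B) `&`
    hessenberg_complement h G B H w =
  @roots_of F n sl P (fun i j => C_ i j && ~~ same_eigen sigma i j).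
Proof.
rewrite (inversionsE i0 uP Gw wE) (hess_complementE i0 uP H Gw wE).
rewrite (nilradical_supports i0 uP s_cartan _ sigma_convex) => [|i]; last by rewrite sE !mxE eqxx.
rewrite !(roots_ofI i0 sl uP); apply: (eq_roots_of i0 sl uP) => i j ij.
have [Cij|] := boolP (C_ i j); last by rewrite /cond_pair => /negPf->; rewrite andbF.
rewrite -/(C_ i j) Cij andbT -/(inversion_pair p i j) (cond_inv_pair hsu Cij) /=.
by have /andP[-> _] := Cij.
Qed.

Lemma dimension_formula :
  #|free_pair sigma r hs p|%:Z = #|` fset_set (inversions h G B w)|%fset%:Z
    - #|` fset_set (root_supports h G [set Ad u (M - s) | u in unipotent_cell B Bm w `&` L]
            `&` hessenberg_complement h G B H w)|%fset%:Z
    - #|` fset_set (inversions h G B w `&` root_supports h G (nilradical h s G B)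
            `&` hessenberg_complement h G B H w)|%fset%:Z.
Proof.
have J_hs := (J_hess i0 uP ME M_tr HH Gw wE).1 Mw.
rewrite orbit_roots nilradical_roots (inversionsE i0 uP Gw wE) !(card_roots_of i0 sl uP).
have := card_free_pair r_lt r_mono hsu hst J_hs.
have -> : #|[pred ij : 'I_n * 'I_n | (ij.1 != ij.2) &&
    ((ij.1 < ij.2)%N && ((p^-1)%g ij.2 < (p^-1)%g ij.1)%N)]| =
    #|[pred ik | inversion_pair p ik.1 ik.2]|.
  by apply: eq_card => -[i j]; rewrite !inE /inversion_pair /= -val_eqE; case: ltngtP.
(* The equations with a leading coordinate split by equality of eigenvalues; for distinct
   eigenvalues [lead] is always defined. *)
have -> : #|lead_pair sigma r hs p| =
  (#|[pred ij : 'I_n * 'I_n | (ij.1 != ij.2) && (C_ ij.1 ij.2 &&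
       (same_eigen sigma ij.1 ij.2 && (lead sigma r ij.1 ij.2 != None)))]| +
   #|[pred ij : 'I_n * 'I_n | (ij.1 != ij.2) && (C_ ij.1 ij.2 && ~~ same_eigen sigma ij.1 ij.2)]|)%N.
  rewrite -(cardID [pred ij : 'I_n * 'I_n | same_eigen sigma ij.1 ij.2] (lead_pair sigma r hs p)).
  congr (_ + _)%N; apply: eq_card => -[i j]; rewrite !inE /= /lead_pair /=.
    rewrite unfold_in /cond_pair /= -val_eqE.
    by case: ltngtP => //= _; rewrite andbAC andbA andbAC -andbA.
  rewrite unfold_in /= /lead /same_eigen /cond_pair -val_eqE.
  by case: ltngtP; case: eqP; rewrite ?andbT ?andbF.
move: #|free_pair sigma r hs p| #|_| #|_| #|_| => a b c d; lia.
Qed.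

End Dimension.

Lemma bruhat_paving (H : {vspace 'M[F]_n}) : hessenberg_space G B H ->
  let cell w := schubert_cell G B w `&` hessenberg_variety G B M H in
  exists (m : nat) (Q : 'I_m -> set (flag_variety G B)),
    paving_by_affines (hessenberg_variety G B M H) Q /\
    range Q = [set C | C !=set0 /\ exists2 w, weyl_rep h G w & C = cell w].
Proof.
move=> HH cell.
have [|m [Q [pQ rQ]]] := @schubert_paving F n sl P uP (hessenberg_variety G B M H).
  move=> p; have [w [t [Gw wE]]] := weyl_exists p.
  rewrite -(schubert_cellE uP Gw wE) => /(cell_nonempty i0 uP ME M_tr sigma_convex r_lt r_mono HH Gw wE) Mw.
  exists #|free_pair sigma r (hess P H) p|.
  exact: (cell_affine i0 uP ME M_tr sigma_convex r_lt r_mono HH Gw wE Mw).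
exists m, Q; split=> //; rewrite rQ predeqE => C; split=> -[C0].
  move=> [p CE]; split=> //; have [w [t [Gw wE]]] := weyl_exists p.
  exists w; first by apply/(weyl_repP i0 sl uP); split=> //; exists p, t.
  by rewrite CE /cell (schubert_cellE uP Gw wE).
move=> [w /(weyl_repP i0 sl uP)[Gw [p [t wE]]] CE]; split=> //; exists p.
by rewrite CE /cell (schubert_cellE uP Gw wE).
Qed.

End Assembly.

Lemma bruhat_theorem (F : numFieldType) (n : nat) (i0 : 'I_n) (sl : bool) (M s : 'M[F]_n) :
  let G := @grp F n sl in
  lie_algebra G M -> jordan_decomposition M s ->
  exists (h : {vspace 'M[F]_n}) (B Bm L : set 'M[F]_n),
    [/\ cartan_subalgebra G h, borel_subgroup G B,
        [set X | X \in h] `<=` lie_algebra B,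
        lie_algebra B M & s \in h] /\
    [/\ opposite_borel h G B Bm, levi_subgroup h s G B L
      & forall H : {vspace 'M[F]_n}, hessenberg_space G B H ->
        let cell w := schubert_cell G B w `&` hessenberg_variety G B M H in
        (exists (m : nat) (P : 'I_m -> set (flag_variety G B)),
           paving_by_affines (hessenberg_variety G B M H) P /\
           range P = [set C | C !=set0 /\ exists2 w, weyl_rep h G w & C = cell w]) /\
        (forall w, weyl_rep h G w ->
           (cell w !=set0 <-> Ad (invmx w) M \in H) /\
           (Ad (invmx w) M \in H ->
              exists d : nat,
                isomorphic (induced (cell w)) (affine_space F d) /\
                d%:Z = #|` fset_set (inversions h G B w)|%fset%:Z
                  - #|` fset_set
                       (root_supports h G [set Ad u (M - s) | u in unipotent_cell B Bm w `&` L]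
                        `&` hessenberg_complement h G B H w)|%fset%:Z
                  - #|` fset_set
                       (inversions h G B w `&` root_supports h G (nilradical h s G B)
                        `&` hessenberg_complement h G B H w)|%fset%:Z))].
Proof.
move=> G M_lie /jordan_normal_form[P [sigma [r [uP sE NE sigma_convex [r_lt r_mono]]]]].
have ME : Ad (invmx P) M = Smx sigma + Nmx F r.
  by rewrite -[in LHS](subrK s M) AdD sE NE addrC.
have M_tr : sl -> \tr M = 0 by apply/(lie_grp i0 sl uP).
have sh := s_cartan i0 uP M_lie sE NE r_lt.
exists (cartan sl P), (borel sl P), (borel sl (P *m rev_mx F n)), (levi sl P sigma).
split; split.
- exact: cartan_cartan.
- exact: borel_borel.
- by move=> X /(cartan_borel i0 uP).
- exact: (M_borel i0 uP M_lie sE NE r_lt).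
- exact: sh.
- exact: borel_opposite.
- by apply: levi_levi_subgroup => // i; rewrite sE !mxE eqxx.
move=> H HH cell; split; first exact: (bruhat_paving i0 uP M_lie sE NE sigma_convex r_lt r_mono HH).
move=> w /(weyl_repP i0 sl uP)[Gw [p [t wE]]]; split.
  exact: (cell_nonempty i0 uP ME M_tr sigma_convex r_lt r_mono HH Gw wE).
move=> Mw; exists #|free_pair sigma r (hess P H) p|; split.
  exact: (cell_affine i0 uP ME M_tr sigma_convex r_lt r_mono HH Gw wE Mw).
exact: (dimension_formula i0 uP M_lie sE NE sigma_convex r_lt r_mono HH Gw wE Mw).
Qed.

Theorem theorem23 (R : realType) (n : nat) (n_gt0 : (0 < n)%N)
    (G : set 'M[R[i]]_n) (G_GL_or_SL : G = GL R[i] n \/ G = SL R[i] n)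
    (M s : 'M[R[i]]_n) (M_in_g : lie_algebra G M)
    (M_jordan : jordan_decomposition M s) :
  exists (h : {vspace 'M[R[i]]_n}) (B Bm L : set 'M[R[i]]_n),
    [/\ cartan_subalgebra G h, borel_subgroup G B,
        [set X | X \in h] `<=` lie_algebra B,
        lie_algebra B M & s \in h] /\
    [/\ opposite_borel h G B Bm, levi_subgroup h s G B L
      & forall H : {vspace 'M[R[i]]_n}, hessenberg_space G B H ->
        let cell w := schubert_cell G B w `&` hessenberg_variety G B M H in
        (exists (m : nat) (P : 'I_m -> set (flag_variety G B)),
           paving_by_affines (hessenberg_variety G B M H) P /\
           range P = [set C | C !=set0 /\ exists2 w, weyl_rep h G w & C = cell w]) /\
        (forall w, weyl_rep h G w ->
           (cell w !=set0 <-> Ad (invmx w) M \in H) /\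
           (Ad (invmx w) M \in H ->
              exists d : nat,
                isomorphic (induced (cell w)) (affine_space R[i] d) /\
                d%:Z = #|` fset_set (inversions h G B w)|%fset%:Z
                  - #|` fset_set
                       (root_supports h G [set Ad u (M - s) | u in unipotent_cell B Bm w `&` L]
                        `&` hessenberg_complement h G B H w)|%fset%:Z
                  - #|` fset_set
                       (inversions h G B w `&` root_supports h G (nilradical h s G B)
                        `&` hessenberg_complement h G B H w)|%fset%:Z))].
Proof.
have GLE : GL R[i] n = grp false by rewrite predeqE => g; split=> [ug|[]//]; split.
have SLE : SL R[i] n = grp true.
  rewrite predeqE => g; split=> [dg|[_]]; last exact.
  by split=> [|_ //]; rewrite unitmxE unitfE dg oner_neq0.
case: G_GL_or_SL => GE; rewrite GE ?GLE ?SLE in M_in_g *.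
  exact: (bruhat_theorem (Ordinal n_gt0) M_in_g M_jordan).
exact: (bruhat_theorem (Ordinal n_gt0) M_in_g M_jordan).
Qed.
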